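(* Let $s\in(0,1/2)$ and fix $\epsilon_0>0$ arbitrarily small. There exist $C>0$, an infinitesimal sequence of positive numbers $\delta$ (i.e. a sequence of positive $\delta$'s converging to $0$) and, for each $\delta$ in the sequence, a set $E_\delta\subseteq\mathbb{R}^2$ with $(\partial E_\delta)\cap\big((-\tfrac32,\tfrac32)\times(0,+\infty)\big)$ of class $C^{1,1}$, that is even symmetric with respect to the axis $\{x_1=0\}$ and satisfies: \begin{itemize} \item $E_\delta\cap\{x_1\in(-\infty,-3)\cup(-2,-1)\}=\big((-\infty,-3)\cup(-2,-1)\big)\times(-\infty,0)$, \item $E_\delta\cap\{x_1\in[-3,-2]\}=[-3,-2]\times(-\infty,C\delta)$, \item $E_\delta\supseteq\mathbb{R}\times(-\infty,0)$, \item $E_\delta\supseteq(-1,1)\times\big(-\infty,\delta^{\frac{2+\epsilon_0}{1-2s}}\big]$, \item $E_\delta\cap\{|x_1|\le1\}\subseteq\{x_2\le\delta\}$. \end{itemize} Moreover, for any $p\in(\partial E_\delta)\cap\{|x_1|<1\}$, $$\int_{\mathbb{R}^2}\frac{\chi_{E_\delta}(y)-\chi_{E_\delta^c}(y)}{|y-p|^{2+2s}}\,dy\ge0.$$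
   Context: Coordinates in $\mathbb{R}^2$ are $x=(x_1,x_2)$, $\chi_A$ is the characteristic function of $A$, and $A^c:=\mathbb{R}^2\setminus A$. The integral is understood in the principal value sense, i.e. as $\lim_{\rho\to0^+}\int_{\mathbb{R}^2\setminus B_\rho(p)}$. The parameter $s$ is fixed, so constants may depend on $s$. *)

(* Defs.v *)
From HB Require Import structures.
From mathcomp Require Import all_boot all_order all_algebra.
From mathcomp Require Import all_classical all_reals all_analysis.

Set Implicit Arguments.
Unset Strict Implicit.
Unset Printing Implicit Defensive.

Import Order.TTheory GRing.Theory Num.Theory.
Import numFieldNormedType.Exports.

Local Open Scope classical_set_scope.
Local Open Scope ring_scope.

Definition boundary (T : topologicalType) (A : set T) : set T :=
  closure A `\` A°.

(* The canonical norm of [R * R] is the sup norm, hence an explicit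
   Euclidean distance. *)
Definition edist (R : realType) (x y : R * R) : R :=
  Num.sqrt ((x.1 - y.1) ^+ 2 + (x.2 - y.2) ^+ 2).

Definition edisk (R : realType) (p : R * R) (r : R) : set (R * R) :=
  [set y | edist y p < r].

Notation lebesgue2 R := (@lebesgue_measure R \x @lebesgue_measure R)%E.

Definition C11_fun (R : realType) (f : R -> R) : Prop :=
  (forall x, derivable f x 1) /\ [lipschitz derive1 f x | x in [set: R]].

(* The part of the boundary of [E] lying in the open set [U] is of class
   C^{1,1}: around each of its points [p], in the orthonormal frame
   ((b, -a), (a, b)) centred at [p], [E] is the subgraph of a C^{1,1} function
   [phi].  Whether points of the graph belong to [E] is left free, and the
   boundary of [E] in the disk is the graph of [phi].  The Lipschitz constant
   of the derivative may depend on [p]. *)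
Definition C11_boundary_in (R : realType) (E U : set (R * R)) : Prop :=
  forall p, boundary E p -> U p ->
  exists (r a b : R) (phi : R -> R),
    [/\ 0 < r, a ^+ 2 + b ^+ 2 = 1, C11_fun phi &
      forall y, edisk p r y ->
        let t := (y.1 - p.1) * b - (y.2 - p.2) * a in
        let u := (y.1 - p.1) * a + (y.2 - p.2) * b in
        (u < phi t -> E y) /\ (phi t < u -> ~ E y)].

(* [l] is the (finite) principal value at [p] of the integral of [f] over the
   plane.  The integrability clause is needed because the library integral is
   total, with a junk value on non-integrable functions. *)
Definition is_principal_value (R : realType) (f : R * R -> R) (p : R * R)
    (l : R) : Prop :=
  (forall rho : R, 0 < rho ->
     (lebesgue2 R).-integrable (~` edisk p rho) (EFin \o f)) /\
  (\int[lebesgue2 R]_(y in ~` edisk p rho) (f y)%:E)%E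
     @[rho --> 0^'+] --> l%:E.

Definition curvature_integrand (R : realType) (s : R) (E : set (R * R))
    (p y : R * R) : R :=
  (\1_E y - \1_(~` E) y) / edist y p `^ (2 + 2 * s).

(* Main.v *)
Require Import Defs.
From HB Require Import structures.
From mathcomp Require Import all_boot all_order all_algebra.
From mathcomp Require Import all_classical all_reals all_analysis.
From mathcomp Require Import measurable_realfun.
From mathcomp Require Import ring lra.

Set Implicit Arguments.
Unset Strict Implicit.
Unset Printing Implicit Defensive.

Import Order.TTheory GRing.Theory Num.Theory.
Import numFieldNormedType.Exports.

Local Open Scope classical_set_scope.
Local Open Scope ring_scope.


(** Write [a = 1/2 + s]. The set is the union of the lower half-plane, of a
    hill [{f y_2 < cap y_1}] over [|y_1| < 1] and of two bumps
    [{2 <= |y_1| <= 3, y_2 < C delta}]. The function [cap] is even, concave,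
    C^{1,1}, and equal to [1 - |x|] for [|x| >= 1/2]. The wall [f] is
    convex, C^{1,1}, zero up to a height comparable to a parameter [eta], and
    equal to [(y / delta)^(1/a)] from the height [eta] on. So the boundary of
    the hill leaves the line [y_2 = 0] vertically at [|y_1| = 1] and then
    follows the arc [y_2 = delta * cap y_1 ^ a]. Here [delta] is a constant
    times [eta^(1-a)], and [(1 - a) (2 + eps0) / (1 - 2 s) = 1 + eps0 / 2]
    exceeds [1]: for small [eta] the power of [delta] in the statement is below
    the height of the vertical part of the wall.

    Curvature. Pair the points [p + u] and [p - u]. A pair inside [E] counts
    twice the kernel, a pair outside counts minus twice the kernel, a mixed pair
    counts nothing. Since [f] is convex and [cap] is concave, no small [u] gives
    a pair inside [E], so the gain, i.e. the integral of the kernel over the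
    pairs inside, is finite. If the loss, over the pairs outside, is at most the
    gain, then the principal value exists and is nonnegative
    ([principal_value_ge0], [gain_away]). What remains is one inequality between
    two integrals of a positive kernel, proved by slices in three zones.

    - Heights up to [eta] ([steep_balance]). The boundary is the graph
      [y_1 = 1 - f y_2], where [f'] is [Q]-Lipschitz and [Q eta] is small, so a
      point at height [y_0] loses a small multiple of [y_0^(-2s)]; it gains at
      least [y_0^(-2s) / 64] from a square of side [y_0] that pairs the foot of
      the wall with the lower half-plane.

    - The arc with [3/4 <= |p_1|] ([power_balance]). The function [x_+^a] is
      harmonic for the kernel [z^(-1-2a)] on the line; [linearized_balance] is
      the inequality that is used. To pass from this linearization to the
      planar kernel, note that the near pairs outside have slope [|w| / z] at
      least [A], and the near pairs inside that are used at most [A], where [A]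
      is the slope at the distance at which the arc doubles its height: the
      kernel is compared with the same multiple of [z^(-1-2a)] on both sides, in
      the favourable direction.

    - The top ([center_balance]). The boundary is the graph of [delta] times a
      concave C^{1,1} function, hence the loss is [O(delta)].

    In the last two zones the errors are of order [delta]. They are paid by the
    bumps, which are there for this purpose: paired with the lower half-plane
    they bring a gain of at least [(C - 2) delta / 100] ([bump_gain]), and [C]
    is chosen large. *)

(** * Symmetries of Lebesgue integrals *)

Lemma ge0_integral_shift_sign (R : realType) (f : R -> \bar R) (a e : R) :
  e = 1 \/ e = - 1 -> measurable_fun [set: R] f -> (forall x, (0 <= f x)%E) ->
  (\int[@lebesgue_measure R]_x f (a + e * x)%R = \int[@lebesgue_measure R]_x f x)%E.
Proof.
move=> he mf f0.
pose phi : R -> measurableTypeR R := fun x => a + e * x.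
have mphi : measurable_fun setT phi.
  by apply: measurable_funD => //; exact: measurable_funM.
have -> : (\int[@lebesgue_measure R]_x f x = \int[pushforward (@lebesgue_measure R) phi]_x f x)%E.
  apply: eq_measure_integral => /= A mA _.
  apply: lebesgue_measure_unique => //= _ [[b c]] _ <-.
  case: he => he; rewrite /pushforward/=.
  - rewrite (_ : phi @^-1` _ = `]b - a, c - a]%classic); last first.
      by apply/seteqP; split=> x; rewrite /phi/= he !in_itv/=; lra.
    by rewrite !lebesgue_measure_itv/= !lte_fin; congr (if _ then _ else _); [lra|rewrite -!EFinD; congr EFin; lra].
  - rewrite (_ : phi @^-1` _ = `[a - c, a - b[%classic); last first.
      by apply/seteqP; split=> x; rewrite /phi/= he !in_itv/=; lra.
    by rewrite !lebesgue_measure_itv/= !lte_fin; congr (if _ then _ else _); [lra|rewrite -!EFinD; congr EFin; lra].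
rewrite ge0_integral_pushforward//.
Qed.

Lemma measurable_affine2 (R : realType) (a b e e' : R) :
  measurable_fun [set: R * R] (fun u : R * R => (a + e * u.1, b + e' * u.2)).
Proof.
by apply: measurable_fun_pair; apply: measurable_funD => //; exact: measurable_funM.
Qed.

Lemma ge0_integral2_shift_sign (R : realType) (F : R * R -> \bar R) (a b e e' : R) :
  e = 1 \/ e = - 1 -> e' = 1 \/ e' = - 1 ->
  measurable_fun [set: R * R] F -> (forall u, (0 <= F u)%E) ->
  (\int[lebesgue2 R]_u F (a + e * u.1, b + e' * u.2)%R =
   \int[lebesgue2 R]_u F u)%E.
Proof.
move=> he he' mF F0.
have mG : measurable_fun [set: R * R] (fun u : R * R => F (a + e * u.1, b + e' * u.2)).
  by apply: (measurableT_comp mF); exact: measurable_affine2.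
rewrite [LHS]fubini_tonelli1// [RHS]fubini_tonelli1//.
rewrite -(@ge0_integral_shift_sign _ (fubini_F lebesgue_measure F) a e he).
- apply: eq_integral => x _; rewrite /fubini_F /=.
  rewrite (@ge0_integral_shift_sign _ (fun y => F (a + e * x, y)))//.
  exact: (measurableT_comp mF).
- exact: measurable_fun_fubini_tonelli_F.
- by move=> x; exact: integral_ge0.
Qed.

Lemma ge0_integral2_swap (R : realType) (F : R * R -> \bar R) :
  measurable_fun [set: R * R] F -> (forall u, (0 <= F u)%E) ->
  (\int[lebesgue2 R]_u F (u.2, u.1) = \int[lebesgue2 R]_u F u)%E.
Proof.
move=> mF F0.
have mG : measurable_fun [set: R * R] (fun u : R * R => F (u.2, u.1)).
  apply: (measurableT_comp mF); exact: measurable_fun_pair.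
by rewrite [LHS]fubini_tonelli1// [RHS]fubini_tonelli2.
Qed.

Lemma lebesgue2_line (R : realType) (c : R) :
  lebesgue2 R [set u : R * R | u.1 = c] = 0%E.
Proof.
rewrite (_ : [set u | _] = [set c] `*` setT); last first.
  by apply/seteqP; split=> -[x y] //= [].
rewrite product_measure1E//.
  by have := @lebesgue_measure_set1 R c; rewrite /= => ->; rewrite mul0e.
Qed.

Lemma measurable_half (R : realType) : measurable [set u : R * R | 0 < u.1].
Proof.
rewrite -[X in measurable X]setTI.
apply: (measurable_fun_ltr (f := cst 0) (g := fst)) => //.
Qed.

Lemma measurable_ge_fst (R : realType) (c : R) : measurable [set u : R * R | c <= u.1].
Proof.
rewrite -[X in measurable X]setTI.
by apply: (measurable_fun_ler (f := cst c) (g := fst)).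
Qed.

Lemma measurable_lt_fst (R : realType) (c : R) : measurable [set u : R * R | u.1 < c].
Proof.
rewrite -[X in measurable X]setTI.
by apply: (measurable_fun_ltr (f := fst) (g := cst c)).
Qed.

(** The reflection through [(a, b)] preserves the measure and exchanges the two
    half-planes on either side of a null line. With the sign [e] one formula
    serves for centres on both sides of an axis of symmetry. *)
Lemma ge0_integral2_fold (R : realType) (F : R * R -> \bar R) (a b e : R) :
  e = 1 \/ e = - 1 ->
  measurable_fun [set: R * R] F -> (forall u, (0 <= F u)%E) ->
  (\int[lebesgue2 R]_u F u =
   \int[lebesgue2 R]_(u in [set u | (0 < u.1)%R])
     (F (a - e * u.1, b + u.2)%R + F (a + e * u.1, b - u.2)%R))%E.
Proof.
move=> he mF F0.
have he' : - e = 1 \/ - e = - 1 by case: he => ->; [right|left; lra].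
have mG (e1 e2 : R) D : measurable D -> measurable_fun (D : set (R * R)) (fun u => F (a + e1 * u.1, b + e2 * u.2)).
  move=> mD; apply: (@measurable_funTS _ _ _ _ _ (fun u => F (a + e1 * u.1, b + e2 * u.2))).
  by apply: (measurableT_comp mF); exact: measurable_affine2.
have eqm (D : set (R*R)) : (\int[lebesgue2 R]_(u in D) F (a - e * u.1, b + u.2)%R =
   \int[lebesgue2 R]_(u in D) F (a + (- e) * u.1, b + 1 * u.2)%R)%E.
  by apply: eq_integral => u _; rewrite mul1r mulNr.
have eqp (D : set (R*R)) : (\int[lebesgue2 R]_(u in D) F (a + e * u.1, b - u.2)%R =
   \int[lebesgue2 R]_(u in D) F (a + e * u.1, b + (- 1) * u.2)%R)%E.
  by apply: eq_integral => u _; rewrite mulN1r.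
have mh := @measurable_half R.
rewrite ge0_integralD//; first last.
- apply: eq_measurable_fun (mG e (- 1) _ mh) => u _; by rewrite mulN1r.
- apply: eq_measurable_fun (mG (- e) 1 _ mh) => u _; by rewrite mul1r mulNr.
rewrite eqm eqp -(@ge0_integral2_shift_sign _ F a b (- e) 1)//; last by left.
rewrite -[in LHS](setUv [set u : R * R | 0 < u.1]) ge0_integral_setU//=; last 3 first.
- exact: measurableC.
- by rewrite setUv; exact: mG.
- by apply/disj_setPCl.
congr (_ + _)%E.
have -> : ~` [set u : R * R | 0 < u.1] = [set u : R * R | u.1 < 0] `|` [set u : R * R | u.1 = 0].
  apply/seteqP; split=> u/=; first by move/negP; rewrite -leNgt le_eqVlt => /orP[/eqP|]; tauto.
  by case=> [h|->]; apply/negP; rewrite -leNgt // ltW.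
have mn := @measurable_lt_fst R 0.
have ml : measurable [set u : R * R | u.1 = 0].
  rewrite (_ : [set u | _] = [set 0] `*` setT); last first.
    by apply/seteqP; split=> -[x y] //= [].
  by apply: measurableX.
rewrite ge0_integral_setU//=; last 2 first.
- by apply: mG; exact: measurableU.
- by rewrite disj_set2E; apply/eqP/seteqP; split=> u//= [+ u0]; rewrite u0 ltxx.
rewrite [X in (_ + X)%E]null_set_integral//; last 2 first.
- exact: mG.
- exact: lebesgue2_line.
rewrite adde0 [LHS]integral_mkcond [RHS]integral_mkcond.
rewrite -[RHS](@ge0_integral2_shift_sign _ _ 0 0 (- 1) (-1)); try by right.
- apply: eq_integral => u _; rewrite !patchE/=.
  have -> : ((0 + -1 * u.1, 0 + -1 * u.2) \in [set u : R * R | 0 < u.1]) = (u \in [set u | u.1 < 0]).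
    by apply/idP/idP; rewrite !inE/=; lra.
  case: ifP => // _; congr F; congr pair; lra.
- apply/(measurable_restrictT _ _).1 => //.
  exact: mG.
- by move=> u; rewrite patchE; case: ifP.
Qed.

(** * Integrals of powers *)

Lemma powR_continuous_pos (R : realType) (k x : R) : 0 < x -> {for x, continuous (fun y : R => y `^ k)}.
Proof.
move=> x0; apply/differentiable_continuous/derivable1_diffP.
by apply: derivable_powR; rewrite in_itv/= andbT.
Qed.

Lemma powR_neg_cvgy (R : realType) (k : R) : 0 < k -> x `^ (- k) @[x --> +oo] --> (0 : R).
Proof.
move=> k0; apply/cvgrPdist_lt => e e0; near=> x.
have x0 : 0 < x by near: x; exact: nbhs_pinfty_gt.
rewrite sub0r normrN ger0_norm ?powR_ge0// powRN.
rewrite -[e]invrK ltf_pV2 ?posrE ?powR_gt0 ?invr_gt0//.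
have -> : e^-1 = (e^-1 `^ (k^-1)) `^ k.
  by rewrite -powRrM mulVf ?gt_eqF// powRr1// invr_ge0 ltW.
rewrite gt0_ltr_powR ?nnegrE ?powR_ge0 ?(ltW x0)//.
Unshelve. all: by end_near. Qed.

Lemma integral_bigcup_le (R : realType) (F : nat -> set R) (f : R -> \bar R) (M : \bar R) :
  (forall n, measurable (F n)) -> nondecreasing_seq F ->
  measurable_fun [set: R] f -> (forall x, (0 <= f x)%E) ->
  (forall n, (\int[@lebesgue_measure R]_(x in F n) f x <= M)%E) ->
  (\int[@lebesgue_measure R]_(x in \bigcup_n F n) f x <= M)%E.
Proof.
move=> mF ndF mf f0 FM.
have h : (\int[@lebesgue_measure R]_(x in F n) f x @[n --> \oo] -->
    \int[@lebesgue_measure R]_(x in \bigcup_n F n) f x)%E.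
  by apply: ge0_nondecreasing_set_cvg_integral => // n; exact: measurable_funTS.
rewrite -(cvg_lim _ h)//; apply: lime_le; first by apply/cvg_ex; eexists; exact: h.
by apply: nearW.
Qed.

Lemma integral_derive (R : realType) (f F : R -> R) (a b : R) : a < b ->
  (forall x, a <= x <= b -> is_derive x 1 F (f x)) ->
  (forall x, a <= x <= b -> {for x, continuous f}) ->
  (\int[@lebesgue_measure R]_(x in `[a, b]) (f x)%:E = (F b - F a)%:E)%E.
Proof.
move=> ab dF cf; rewrite EFinB.
have cF x : a <= x <= b -> {for x, continuous F}.
  by move=> /dF [dFx _]; exact/differentiable_continuous/derivable1_diffP.
apply: continuous_FTC2 => //.
- apply: continuous_in_subspaceT => x; rewrite inE/= in_itv/=; exact: cf.
- split.
  + by move=> x; rewrite in_itv/= => /andP[/ltW ax /ltW xb]; have [] := dF x (introT andP (conj ax xb)).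
  + by apply: cvg_at_right_filter; apply: cF; rewrite lexx ltW.
  + by apply: cvg_at_left_filter; apply: cF; rewrite lexx ltW.
- move=> x; rewrite in_itv/= => /andP[/ltW ax /ltW xb].
  by have [_ <-] := dF x (introT andP (conj ax xb)); rewrite derive1E.
Qed.

Lemma integral_powR_tail (R : realType) (k c : R) : 0 < k -> 0 < c ->
  (\int[@lebesgue_measure R]_(x in `[c, +oo[) (x `^ (- 1 - k))%:E = (c `^ (- k) / k)%:E)%E.
Proof.
move=> k0 c0.
have dF (x : R) : 0 < x -> is_derive x 1 (fun y : R => - k^-1 * y `^ (- k)) (x `^ (- 1 - k)).
  move=> x0; have := is_derive1_powR (- k) x0.
  rewrite -[- k - 1]addrC => h; have := @is_deriveZ _ _ _ _ (- k^-1) _ _ _ h.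
  rewrite /GRing.scale/= mulrA mulrNN mulVf ?gt_eqF// mul1r.
  by rewrite -[X in is_derive _ _ X _]/(fun y : R => - k^-1 * y `^ (- k)).
rewrite (@ge0_continuous_FTC2y _ _ (fun y : R => - k^-1 * y `^ (- k)) c 0).
- by rewrite sub0e -EFinN; congr EFin; rewrite mulNr opprK mulrC.
- by move=> x _; exact: powR_ge0.
- apply: continuous_in_subspaceT => x; rewrite inE/= in_itv/= andbT => cx.
  by apply: powR_continuous_pos; exact: lt_le_trans cx.
- rewrite -[X in _ --> X](mulr0 (- k^-1)); apply: cvgMr; exact: powR_neg_cvgy.
- by move=> x cx; have [] := dF x (lt_trans c0 cx).
- apply: cvg_at_right_filter; apply: cvgMr; exact: powR_continuous_pos.
- move=> x; rewrite in_itv/= andbT => cx.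
  by have [_ <-] := dF x (lt_trans c0 cx); rewrite derive1E.
Qed.

(** The fundamental theorem applies on the segments from [c / (n + 2)] to [c],
    away from the singularity at [0]; monotone convergence does the rest. *)
Lemma integral_powR_origin (R : realType) (k c : R) : 0 < k -> 0 < c ->
  (\int[@lebesgue_measure R]_(x in `]0%R, c]) (x `^ (k - 1))%:E <= (c `^ k / k)%:E)%E.
Proof.
move=> k0 c0.
have -> : `]0, c]%classic = \bigcup_n `[c / (n.+2%:R), c]%classic.
  apply/seteqP; split=> x/=.
    rewrite in_itv/= => /andP[x0 xc].
    have cx : 0 < c / x by rewrite divr_gt0.
    exists (Num.truncn (c / x)) => //=; rewrite in_itv/= xc andbT.
    rewrite ler_pdivrMr// mulrC -ler_pdivrMr//.
    by apply/ltW/(lt_trans (truncnS_gt _)); rewrite ltr_nat.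
  by case=> n _ /=; rewrite !in_itv/= => /andP[h ->]; rewrite andbT (lt_le_trans _ h)// divr_gt0.
apply: integral_bigcup_le => //.
- move=> m n mn; rewrite subsetEset => x/=; rewrite !in_itv/= => /andP[h ->]; rewrite andbT.
  by apply: le_trans h; rewrite ler_pM2l// lef_pV2 ?posrE ?ltr0n// ler_nat.
- by apply/measurable_EFinP; exact: measurable_powR.
- by move=> x; rewrite lee_fin powR_ge0.
- move=> n; set a := c / _.
  have a0 : 0 < a by rewrite divr_gt0.
  have ac : a < c by rewrite ltr_pdivrMr// ltr_pMr// ltr1n.
  have dF (x : R) : 0 < x -> is_derive x 1 (fun y : R => k^-1 * y `^ k) (x `^ (k - 1)).
    move=> x0; have := @is_deriveZ _ _ _ _ (k^-1) _ _ _ (is_derive1_powR k x0).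
    by rewrite /GRing.scale/= mulrA mulVf ?gt_eqF// mul1r.
  have -> : (\int[@lebesgue_measure R]_(x in `[a, c]) (x `^ (k - 1))%:E =
      (k^-1 * c `^ k - k^-1 * a `^ k)%:E)%E.
    apply: (@integral_derive _ _ (fun y : R => k^-1 * y `^ k)) => // x /andP[ax _].
      by apply: dF; exact: lt_le_trans ax.
    by apply: powR_continuous_pos; exact: lt_le_trans ax.
  rewrite lee_fin -mulrBr mulrC ler_pM2r ?invr_gt0// lerBlDr lerDl powR_ge0//.
Qed.

(** * The kernel *)

(** The kernel [|u|^(-2-2s)], written with [|u|^2] to avoid a square root. *)
Definition riesz (R : realType) (s : R) (u : R * R) : R :=
  ((u.1 ^+ 2 + u.2 ^+ 2) `^ (1 + s))^-1.

Lemma riesz_ge0 (R : realType) (s : R) u : 0 <= riesz s u.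
Proof. by rewrite invr_ge0 powR_ge0. Qed.

Lemma measurable_fun_powR (R : realType) d (T : measurableType d) (D : set T)
    (f : T -> R) (p : R) :
  measurable_fun D f -> measurable_fun D (fun x => f x `^ p).
Proof.
move=> mf; apply: (@measurableT_comp _ _ _ _ _ _ (@powR R ^~ p)) => //.
Qed.

Lemma measurable_inv_pos (R : realType) d (T : measurableType d) (D : set T) (f : T -> R) :
  (forall x, 0 <= f x) -> measurable_fun D f -> measurable_fun D (fun x => (f x)^-1).
Proof.
move=> f0 mf.
have -> : (fun x => (f x)^-1) = (fun x => f x `^ (-1)).
  by apply/funext => x; rewrite powR_inv1.
exact: measurable_fun_powR.
Qed.

Lemma measurable_sqnorm (R : realType) :
  measurable_fun [set: R * R] (fun u : R * R => u.1 ^+ 2 + u.2 ^+ 2).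
Proof. by apply: measurable_funD; exact: measurable_funX. Qed.

Lemma measurable_riesz (R : realType) (s : R) : measurable_fun [set: R * R] (riesz s).
Proof.
apply: measurable_inv_pos => [u|]; first exact: powR_ge0.
apply: measurable_fun_powR; exact: measurable_sqnorm.
Qed.

Lemma riesz_le (R : realType) (s c : R) (u : R * R) : 0 < s -> 0 < c ->
  c <= u.1 ^+ 2 + u.2 ^+ 2 -> riesz s u <= (c `^ (1 + s))^-1.
Proof.
move=> s0 c0 cu.
have h : 0 <= u.1 ^+ 2 + u.2 ^+ 2 by rewrite addr_ge0 ?sqr_ge0.
rewrite lef_pV2 ?posrE ?powR_gt0 ?(lt_le_trans c0)//.
by rewrite ge0_ler_powR ?nnegrE ?(ltW c0)//; lra.
Qed.

Lemma riesz_ge (R : realType) (s c : R) (u : R * R) : 0 < s ->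
  0 < u.1 ^+ 2 + u.2 ^+ 2 <= c -> (c `^ (1 + s))^-1 <= riesz s u.
Proof.
move=> s0 /andP[u0 uc].
rewrite lef_pV2 ?posrE ?powR_gt0 ?(lt_le_trans u0)//.
by rewrite ge0_ler_powR ?nnegrE ?(ltW u0) ?(ltW (lt_le_trans u0 uc))//; lra.
Qed.

Lemma integral_tail_max_lty (R : realType) (s r : R) : 0 < s -> 0 < r ->
  (\int[@lebesgue_measure R]_x (Num.max r `|x| `^ (- 1 - s))%:E < +oo)%E.
Proof.
move=> s0 r0; pose k (x : R) := (Num.max r `|x| `^ (- 1 - s))%:E.
have mk : measurable_fun [set: R] k.
  apply/measurable_EFinP.
  apply: measurable_fun_powR.
  by apply: measurable_maxr.
have k0 x : (0 <= k x)%E by rewrite lee_fin powR_ge0.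
have hpos : (\int[@lebesgue_measure R]_(x in `[0%R, +oo[) k x < +oo)%E.
  rewrite (_ : `[0%R, +oo[%classic = `[0%R, r[ `|` `[r, +oo[); last first.
    apply/seteqP; split=> x/=; rewrite !in_itv/= ?andbT.
      by move=> x0; case: (ltP x r) => xr; [left; rewrite x0|right].
    by case=> [/andP[]//|]; apply: le_trans; exact: ltW.
  rewrite ge0_integral_setU//; last 2 first.
    exact: measurable_funTS.
    rewrite disj_set2E; apply/eqP/seteqP; split=> x//=; rewrite !in_itv/= andbT => -[/andP[_ +]].
    by rewrite ltNge => /negP.
  rewrite lte_add_pinfty//.
    apply: (@le_lt_trans _ _ (\int[@lebesgue_measure R]_(x in `[0%R, r[) (cst (r `^ (- 1 - s))%:E x))%E).
      apply: ge0_le_integral => //; first exact: measurable_funTS.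
      move=> x/=; rewrite in_itv/= => /andP[x0 xr].
      by rewrite /k lee_fin ger0_norm// max_l// ltW.
    rewrite integral_cst//; have /= := @lebesgue_measure_itv R `[0%R, r[%R.
    by rewrite lte_fin r0 => ->; rewrite -EFinB -EFinM ltry.
  rewrite (_ : (\int[_]_(x in _) _)%E = (\int[@lebesgue_measure R]_(x in `[r, +oo[) (x `^ (- 1 - s))%:E)%E).
    by rewrite integral_powR_tail// ltry.
  apply: eq_integral => x; rewrite inE/= in_itv/= andbT => rx.
  by rewrite /k ger0_norm ?max_r// (le_trans (ltW r0)).
have hneg : (\int[@lebesgue_measure R]_(x in `]-oo, 0%R]) k x < +oo)%E.
  rewrite (_ : (\int[_]_(x in _) _)%E = (\int[@lebesgue_measure R]_(x in `]-oo, 0%R]) k (- x)%R)%E).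
    by rewrite -ge0_integration_by_substitution0.
  by apply: eq_integral => x _; rewrite /k normrN.
change (\int[@lebesgue_measure R]_x k x < +oo)%E.
rewrite (_ : [set: R] = `]-oo, 0%R] `|` `]0%R, +oo[); last first.
  by apply/seteqP; split=> x//= _; rewrite !in_itv/= andbT; case: (leP x 0) => _; [left|right].
rewrite ge0_integral_setU//; last 2 first.
- exact: measurable_funTS.
- rewrite disj_set2E; apply/eqP/seteqP; split=> x//=; rewrite !in_itv/= andbT => -[].
  by rewrite leNgt => /negP.
rewrite lte_add_pinfty//.
apply: le_lt_trans hpos; apply: ge0_subset_integral => //; first exact: measurable_funTS.
by move=> x/=; rewrite !in_itv/= !andbT; exact: ltW.
Qed.

(** Outside the ball, [|u|^2] is at least the product of [max r |u_1|] and
    [max r |u_2|]. Hence the kernel is below a product of two integrable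
    functions of one variable, and polar coordinates are not needed. *)
Lemma integral_riesz_lty (R : realType) (s r : R) : 0 < s -> 0 < r ->
  (\int[lebesgue2 R]_(u in [set u | (r ^+ 2 <= u.1 ^+ 2 + u.2 ^+ 2)%R]) (riesz s u)%:E < +oo)%E.
Proof.
move=> s0 r0; pose k (x : R) := Num.max r `|x| `^ (- 1 - s).
have mk : measurable_fun [set: R] k.
  apply: measurable_fun_powR.
  by apply: measurable_maxr.
have k0 x : 0 <= k x by rewrite powR_ge0.
have mkk : measurable_fun [set: R * R] (fun u : R * R => (k u.1 * k u.2)%:E).
  by apply/measurable_EFinP; apply: measurable_funM; apply: (measurableT_comp mk).
have mD : measurable [set u : R * R | r ^+ 2 <= u.1 ^+ 2 + u.2 ^+ 2].
  rewrite -[X in measurable X]setTI.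
  apply: (measurable_fun_ler (f := cst (r ^+2)) (g := fun u : R * R => u.1 ^+ 2 + u.2 ^+ 2)) => //.
  exact: measurable_sqnorm.
apply: (@le_lt_trans _ _ (\int[lebesgue2 R]_u (k u.1 * k u.2)%:E)%E).
  rewrite integral_mkcond; apply: ge0_le_integral => //.
  - by move=> u _; rewrite erestrict_ge0// => v _; rewrite lee_fin riesz_ge0.
  - apply/(measurable_restrictT _ _).1 => //; apply/measurable_EFinP.
    by apply: measurable_funTS; exact: measurable_riesz.
  - move=> u _; rewrite patchE; case: ifPn => [|_]; last by rewrite lee_fin mulr_ge0.
    rewrite inE/= => ru; rewrite lee_fin.
    have m1 : 0 < Num.max r `|u.1| by rewrite lt_max r0.
    have m2 : 0 < Num.max r `|u.2| by rewrite lt_max r0.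
    rewrite /k -powRM ?(ltW m1) ?(ltW m2)// -opprD powRN; apply: riesz_le => //.
      exact: mulr_gt0.
    have a1 : Num.max r `|u.1| ^+ 2 <= u.1 ^+ 2 + u.2 ^+ 2.
      by rewrite maxEle; case: ifP => _ //; rewrite real_normK ?num_real// lerDl sqr_ge0.
    have a2 : Num.max r `|u.2| ^+ 2 <= u.1 ^+ 2 + u.2 ^+ 2.
      by rewrite maxEle; case: ifP => _ //; rewrite real_normK ?num_real// lerDr sqr_ge0.
    by nra.
rewrite fubini_tonelli1//; last by move=> u; rewrite lee_fin mulr_ge0.
rewrite /fubini_F/=.
have kI := integral_tail_max_lty s0 r0.
have kI0 : (0 <= \int[@lebesgue_measure R]_x (k x)%:E)%E.
  by apply: integral_ge0 => x _; rewrite lee_fin.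
have kf : (\int[@lebesgue_measure R]_x (k x)%:E)%E \is a fin_num.
  by rewrite ge0_fin_numE.
under eq_integral => x _.
  under eq_integral => y _ do rewrite EFinM.
  rewrite ge0_integralZl//; last 3 first.
    exact/measurable_EFinP.
    by move=> y _; rewrite lee_fin.
    by rewrite lee_fin.
  over.
rewrite ge0_integralZr//; last 2 first.
- exact/measurable_EFinP.
- by move=> y _; rewrite lee_fin.
by rewrite lte_mul_pinfty.
Qed.

(** * Folding the principal value *)

Lemma curvature_integrandE (R : realType) (s : R) (E : set (R * R)) (p y : R * R) :
  curvature_integrand s E p y =
  (\1_E y - \1_(~` E) y) * riesz s (y.1 - p.1, y.2 - p.2).
Proof.
rewrite /curvature_integrand /riesz/=.
set d := ((y.1 - p.1) ^+ 2 + _).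
have -> : Defs.edist y p = d `^ (2^-1).
  by rewrite powR12_sqrt ?addr_ge0 ?sqr_ge0.
rewrite -powRrM.
by congr (_ * (_ `^ _)^-1); field.
Qed.

Lemma setC_edisk (R : realType) (p : R * R) (r : R) : 0 < r ->
  ~` edisk p r = [set y | r ^+ 2 <= (y.1 - p.1) ^+ 2 + (y.2 - p.2) ^+ 2].
Proof.
move=> r0; apply/seteqP; split=> y /=; rewrite /edisk/= /Defs.edist.
  move/negP; rewrite -leNgt => h.
  have := h; rewrite -(@ler_pXn2r _ 2) ?nnegrE ?sqrtr_ge0 ?(ltW r0)//.
  by rewrite sqr_sqrtr// addr_ge0 ?sqr_ge0.
move=> h; apply/negP; rewrite -leNgt -(@ler_pXn2r _ 2) ?nnegrE ?sqrtr_ge0 ?(ltW r0)//.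
by rewrite sqr_sqrtr// addr_ge0 ?sqr_ge0.
Qed.

Section principal_value.
Context (R : realType) (s : R) (E : set (R * R)) (p : R * R) (e : R).
Hypotheses (s0 : 0 < s) (mE : measurable E) (he : e = 1 \/ e = - 1).

Let Pm (u : R * R) : R * R := (p.1 - e * u.1, p.2 + u.2).
Let Pp (u : R * R) : R * R := (p.1 + e * u.1, p.2 - u.2).
Let H : set (R * R) := [set u | 0 < u.1].
Let B (r : R) : set (R * R) := [set u | r ^+ 2 <= u.1 ^+ 2 + u.2 ^+ 2].
Let Lo : set (R * R) := [set u | [/\ 0 < u.1, ~ E (Pm u) & ~ E (Pp u)]].
Let G : set (R * R) := [set u | [/\ 0 < u.1, E (Pm u) & E (Pp u)]].
Let kp (y : R * R) := riesz s (y.1 - p.1, y.2 - p.2).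
Local Notation mu := (lebesgue2 R).

Let e2 : e * e = 1. Proof. by case: he => ->; lra. Qed.

Let mH : measurable H. Proof. exact: measurable_half. Qed.

Let mPm : measurable_fun [set: R * R] Pm.
Proof.
apply: eq_measurable_fun (@measurable_affine2 R p.1 p.2 (- e) 1) => u _.
by rewrite /Pm mul1r mulNr.
Qed.

Let mPp : measurable_fun [set: R * R] Pp.
Proof.
apply: eq_measurable_fun (@measurable_affine2 R p.1 p.2 e (- 1)) => u _.
by rewrite /Pp mulN1r.
Qed.

Let mB r : measurable (B r).
Proof.
rewrite -[X in measurable X]setTI.
apply: (measurable_fun_ler (f := cst (r ^+2)) (g := fun u : R * R => u.1 ^+ 2 + u.2 ^+ 2)) => //.
exact: measurable_sqnorm.
Qed.

Let mEm : measurable (Pm @^-1` E).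
Proof. by rewrite -[X in measurable X]setTI; exact: mPm. Qed.

Let mEp : measurable (Pp @^-1` E).
Proof. by rewrite -[X in measurable X]setTI; exact: mPp. Qed.

Let mLo : measurable Lo.
Proof.
rewrite (_ : Lo = H `&` (~` (Pm @^-1` E) `&` ~` (Pp @^-1` E))); last first.
  by apply/seteqP; split=> u/= [] // ? [].
by apply: measurableI => //; apply: measurableI; exact: measurableC.
Qed.

Let mG : measurable G.
Proof.
rewrite (_ : G = H `&` ((Pm @^-1` E) `&` (Pp @^-1` E))); last first.
  by apply/seteqP; split=> u/= [] // ? [].
by apply: measurableI => //; apply: measurableI.
Qed.

Let mkp : measurable_fun [set: R * R] kp.
Proof.
have h := @measurable_affine2 R (- p.1) (- p.2) 1 1.
apply: eq_measurable_fun (measurableT_comp (@measurable_riesz R s) h) => u _/=.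
by rewrite /kp !mul1r ![- _ + _]addrC.
Qed.

Let Em u : ((Pm u).1 - p.1) ^+ 2 + ((Pm u).2 - p.2) ^+ 2 = u.1 ^+ 2 + u.2 ^+ 2.
Proof.
have -> : (Pm u).1 - p.1 = - (e * u.1) by rewrite /Pm/=; lra.
have -> : (Pm u).2 - p.2 = u.2 by rewrite /Pm/=; lra.
by rewrite sqrrN exprMn [e ^+ 2]e2 mul1r.
Qed.

Let Ep u : ((Pp u).1 - p.1) ^+ 2 + ((Pp u).2 - p.2) ^+ 2 = u.1 ^+ 2 + u.2 ^+ 2.
Proof.
have -> : (Pp u).1 - p.1 = e * u.1 by rewrite /Pp/=; lra.
have -> : (Pp u).2 - p.2 = - u.2 by rewrite /Pp/=; lra.
by rewrite sqrrN exprMn [e ^+ 2]e2 mul1r.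
Qed.

Let kpm u : kp (Pm u) = riesz s u.
Proof. by rewrite /kp /riesz /fst /snd -/fst -/snd Em. Qed.

Let kpp u : kp (Pp u) = riesz s u.
Proof. by rewrite /kp /riesz /fst /snd -/fst -/snd Ep. Qed.

Let Dp r : 0 < r -> forall u, (Pm u \in ~` edisk p r) = (u \in B r) /\ (Pp u \in ~` edisk p r) = (u \in B r).
Proof.
move=> r0 u; rewrite setC_edisk//; split; apply/idP/idP => /set_mem h; apply/mem_set; move: h;
  by rewrite /B /mkset ?Em ?Ep.
Qed.

Let mD r : 0 < r -> measurable (~` edisk p r).
Proof.
move=> r0; rewrite setC_edisk// -[X in measurable X]setTI.
apply: (measurable_fun_ler (f := cst (r ^+2)) (g := fun y : R * R => (y.1 - p.1) ^+ 2 + (y.2 - p.2) ^+ 2)) => //.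
by apply: measurable_funD; apply: measurable_funX; apply: measurable_funB.
Qed.

Let fold_part r (A : set (R * R)) : 0 < r -> measurable A ->
  (\int[mu]_(y in ~` edisk p r) (\1_A y * kp y)%:E =
   \int[mu]_(u in H) ((\1_A (Pm u) + \1_A (Pp u)) * \1_(B r) u * riesz s u)%:E)%E.
Proof.
move=> r0 mA; rewrite integral_mkcond.
rewrite (@ge0_integral2_fold _ _ p.1 p.2 e he); last 2 first.
- apply/(measurable_restrictT _ _).1; first exact: mD.
  apply/measurable_EFinP; apply: measurable_funTS.
  by apply: measurable_funM => //; exact: measurable_indic.
- move=> u; apply: erestrict_ge0 => v _.
  by rewrite lee_fin mulr_ge0// riesz_ge0.
apply: eq_integral => u _.
rewrite -/(Pm u) -/(Pp u) !patchE; have [-> ->] := Dp r0 u.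
have -> : \1_(B r) u = (u \in B r)%:R :> R by rewrite indicE.
rewrite kpm kpp; case: (u \in B r).
  by rewrite -EFinD mulr1 mulrDl.
by rewrite mulr0 mul0r adde0.
Qed.

Let kp_lty r : 0 < r -> (\int[mu]_(y in ~` edisk p r) (kp y)%:E < +oo)%E.
Proof.
move=> r0; rewrite integral_mkcond.
rewrite -(@ge0_integral2_shift_sign _ _ p.1 p.2 e (-1)) //; last 3 first.
- by right.
- apply/(measurable_restrictT _ _).1; first exact: mD.
  by apply/measurable_EFinP; apply: measurable_funTS.
- by move=> u; apply: erestrict_ge0 => v _; rewrite lee_fin riesz_ge0.
have := integral_riesz_lty s0 r0; rewrite integral_mkcond.
congr (_ < _)%E; apply: eq_integral => u _; rewrite !patchE.
rewrite (_ : (p.1 + e * u.1, p.2 + -1 * u.2) = Pp u); last by rewrite mulN1r.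
by have [_ ->] := Dp r0 u; rewrite kpp.
Qed.

Let part_integrable r (A : set (R * R)) : 0 < r -> measurable A ->
  mu.-integrable (~` edisk p r) (fun y => (\1_A y * kp y)%:E).
Proof.
move=> r0 mA.
have mA' : measurable_fun [set: R * R] (fun y => \1_A y * kp y).
  by apply: measurable_funM => //; exact: measurable_indic.
have ikp : mu.-integrable (~` edisk p r) (EFin \o kp).
  apply/integrableP; split; first by apply/measurable_EFinP; apply: measurable_funTS.
  have := kp_lty r0; congr (_ < _)%E; apply: eq_integral => y _ /=.
  by rewrite ger0_norm// riesz_ge0.
apply: le_integrable ikp.
- exact: mD.
- by apply/measurable_EFinP; apply: measurable_funTS.
- move=> y _ /=; rewrite lee_fin !ger0_norm ?mulr_ge0 ?riesz_ge0//.
  by rewrite indicE; case: (_ \in _); rewrite ?mul1r ?mul0r ?riesz_ge0.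
Qed.

Let integrand_integrable r : 0 < r ->
  mu.-integrable (~` edisk p r) (EFin \o curvature_integrand s E p).
Proof.
move=> r0; have mEC : measurable (~` E) by exact: measurableC.
have iB : mu.-integrable (~` edisk p r)
    ((fun y => (\1_E y * kp y)%:E) \- (fun y => (\1_(~` E) y * kp y)%:E))%E.
  by apply: integrableB; [exact: mD|exact: part_integrable|exact: part_integrable].
apply: eq_integrable iB; first exact: mD.
by move=> y _ /=; rewrite curvature_integrandE mulrBl.
Qed.

Let balance (u : R * R) := 2 * (\1_G u - \1_Lo u) * riesz s u.

Let mbalance : measurable_fun [set: R * R] balance.
Proof.
apply: measurable_funM; last exact: measurable_riesz.
by apply: measurable_funM => //; apply: measurable_funB; exact: measurable_indic.
Qed.

Let integral_balance r : 0 < r ->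
  (\int[mu]_(y in ~` edisk p r) (curvature_integrand s E p y)%:E =
   \int[mu]_(u in H) (balance u * \1_(B r) u)%:E)%E.
Proof.
move=> r0; have mEC : measurable (~` E) by exact: measurableC.
have finite A : measurable A -> mu.-integrable H
    (fun u => ((\1_A (Pm u) + \1_A (Pp u)) * \1_(B r) u * riesz s u)%:E).
  move=> mA; apply/integrableP; split.
    apply/measurable_EFinP; apply: measurable_funTS.
    apply: measurable_funM; last exact: measurable_riesz.
    apply: measurable_funM; last by apply: measurable_indic; exact: mB.
    by apply: measurable_funD; apply: measurableT_comp => //; exact: measurable_indic.
  have : (\int[mu]_(y in ~` edisk p r) (\1_A y * kp y)%:E < +oo)%E.
    by apply: integrable_lty; [exact: mD|exact: part_integrable].
  rewrite fold_part//; congr (_ < _)%E; apply: eq_integral => u _ /=.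
  by rewrite ger0_norm// !(mulr_ge0, addr_ge0) ?riesz_ge0.
transitivity (\int[mu]_(y in ~` edisk p r) (((\1_E y * kp y)%:E - (\1_(~` E) y * kp y)%:E)))%E.
  by apply: eq_integral => y _; rewrite curvature_integrandE mulrBl.
rewrite integralB; [|exact: mD|exact: part_integrable|exact: part_integrable].
rewrite !fold_part//.
rewrite -integralB; [|exact: mH|exact: finite|exact: finite].
apply: eq_integral => u /[!inE] Hu /=; rewrite -EFinB; congr EFin.
rewrite -!mulrBl mulrAC; congr (_ * _ * _).
rewrite !indicE/= !in_setC.
have -> : (u \in G) = (Pm u \in E) && (Pp u \in E).
  apply/idP/andP; rewrite !inE; first by case.
  by case=> ? ?; split.
have -> : (u \in Lo) = ~~ (Pm u \in E) && ~~ (Pp u \in E).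
  apply/idP/andP; rewrite -!in_setC !inE; first by case.
  by case=> ? ?; split.
by case: (Pm u \in E); case: (Pp u \in E) => /=; lra.
Qed.

(** After folding, the integrand is twice the kernel on [G], minus twice the
    kernel on [Lo], and zero elsewhere. The integral over [G] is finite because
    [G] avoids a ball, and the one over [Lo] because it is smaller; so the folded
    integrand is integrable, and dominated convergence removes the disk. *)
Lemma principal_value_ge0 :
  (exists2 r, 0 < r & forall u, G u -> r ^+ 2 <= u.1 ^+ 2 + u.2 ^+ 2) ->
  (\int[mu]_(u in Lo) (riesz s u)%:E <= \int[mu]_(u in G) (riesz s u)%:E)%E ->
  exists l, is_principal_value (curvature_integrand s E p) p l /\ 0 <= l.
Proof.
move=> [r r0 Gr] LoG.
have mri : measurable_fun [set: R * R] (EFin \o riesz s).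
  by apply/measurable_EFinP; exact: measurable_riesz.
have Gfin : (\int[mu]_(u in G) (riesz s u)%:E < +oo)%E.
  apply: le_lt_trans (integral_riesz_lty s0 r0).
  apply: ge0_subset_integral => //; first exact: mB.
    exact: measurable_funTS.
  by move=> u _; rewrite lee_fin riesz_ge0.
have Lofin := le_lt_trans LoG Gfin.
have part A : measurable A -> A `<=` H -> (\int[mu]_(u in A) (riesz s u)%:E < +oo)%E ->
    mu.-integrable H (fun u => (2 * \1_A u * riesz s u)%:E) /\
    (\int[mu]_(u in H) (2 * \1_A u * riesz s u)%:E = 2%:E * \int[mu]_(u in A) (riesz s u)%:E)%E.
  move=> mA AH Af.
  have eqA : (\int[mu]_(u in H) (2 * \1_A u * riesz s u)%:E = 2%:E * \int[mu]_(u in A) (riesz s u)%:E)%E.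
    rewrite -ge0_integralZl//; last 2 first.
    - exact: measurable_funTS.
    - by move=> u _; rewrite lee_fin riesz_ge0.
    rewrite [RHS]integral_mkcond [LHS]integral_mkcond; apply: eq_integral => u _.
    rewrite !patchE indicE; case: (boolP (u \in A)) => uA.
      by rewrite ifT ?mulr1// inE; apply: AH; rewrite inE in uA.
    by rewrite mulr0 mul0r; case: ifP.
  split=> //; apply/integrableP; split.
    apply/measurable_EFinP; apply: measurable_funTS.
    apply: measurable_funM; last exact: measurable_riesz.
    by apply: measurable_funM => //; exact: measurable_indic.
  rewrite (_ : (\int[_]_(x in _) _)%E = \int[mu]_(u in H) (2 * \1_A u * riesz s u)%:E)%E.
    by rewrite eqA lte_mul_pinfty// lee_fin.
  by apply: eq_integral => u _ /=; rewrite ger0_norm// mulr_ge0 ?riesz_ge0// mulr_ge0.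
have [iG eG] := part G mG (fun u => fun h : G u => let: And3 h _ _ := h in h) Gfin.
have [iLo eLo] := part Lo mLo (fun u => fun h : Lo u => let: And3 h _ _ := h in h) Lofin.
have ibal : mu.-integrable H (EFin \o balance).
  have iB : mu.-integrable H ((fun u => (2 * \1_G u * riesz s u)%:E) \-
      (fun u => (2 * \1_Lo u * riesz s u)%:E))%E by exact: integrableB.
  apply: eq_integrable iB => // u _ /=.
  by rewrite -EFinB /balance; congr EFin; lra.
have ebal : (\int[mu]_(u in H) (balance u)%:E =
    2%:E * \int[mu]_(u in G) (riesz s u)%:E - 2%:E * \int[mu]_(u in Lo) (riesz s u)%:E)%E.
  rewrite -eG -eLo -integralB//; apply: eq_integral => u _.
  by rewrite -EFinB /balance; congr EFin; lra.
exists (fine (\int[mu]_(u in H) (balance u)%:E)); split; last first.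
  apply: fine_ge0; rewrite ebal sube_ge0.
    by rewrite lee_pmul2l.
  by rewrite orbC fin_numM// ge0_fin_numE//; apply: integral_ge0 => u _; rewrite lee_fin riesz_ge0.
split=> [rho rho0|]; first exact: integrand_integrable.
rewrite fineK; last exact: integrable_fin_num ibal.
rewrite -[X in _ --> X](@fineK _ (\int[mu]_(u in H) (balance u)%:E)%E); last exact: integrable_fin_num ibal.
apply/cvge_at_rightP => v [v0 vcvg].
rewrite fineK; last exact: integrable_fin_num ibal.
under eq_fun do rewrite integral_balance//.
pose F_ := fun (n : nat) (u : R * R) => (balance u * \1_(B (v n)) u)%:E.
have -> : (fun n => \int[mu]_(u in H) (balance u * \1_(B (v n)) u)%:E)%E =
  (fun n => \int[mu]_(u in H) F_ n u)%E by [].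
have ig : mu.-integrable H (abse \o (EFin \o balance)) by exact: integrable_abse.
apply: dominated_cvg; [exact: mH| | | |exact: ig|].
- move=> n; apply/measurable_EFinP; apply: measurable_funTS.
  by apply: measurable_funM => //; apply: measurable_indic; exact: mB.
- move=> u Hu; apply: cvg_near_cst.
  have u0 : 0 < u.1 by [].
  near=> n; congr EFin; rewrite indicE mem_set ?mulr1//= /B/=.
  apply: (@le_trans _ _ (u.1 ^+ 2)); last by rewrite lerDl sqr_ge0.
  rewrite ler_pXn2r ?nnegrE ?(ltW (v0 n)) ?(ltW u0)//.
  apply/ltW; near: n; exact: (cvgr_lt _ vcvg).
- by move=> u _.
- move=> n u _; rewrite lee_fin normrM ler_piMr// indicE.
  by case: (_ \in _); rewrite ?normr1 ?normr0.
Unshelve. all: by end_near. Qed.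

End principal_value.

(** * Integration by slices *)

Lemma lebesgue_segment (R : realType) (a l : R) (b0 b1 : bool) :
  @lebesgue_measure R [set` Interval (BSide b0 a) (BSide b1 (a + l))] = (Num.max l 0)%:E.
Proof.
have /= -> := @lebesgue_measure_itv R (Interval (BSide b0 a) (BSide b1 (a + l))).
by rewrite lte_fin ltrDl; case: ltP => // l0; rewrite -EFinB addrAC subrr add0r.
Qed.

(** Fubini, when every vertical slice of [A] lies in a segment of length [l z].
    A negative [l z] says that the slice is empty, hence the maximum with [0]. *)
Lemma integral_vslices_le (R : realType) (A : set (R * R)) (F : R * R -> R)
    (D : set R) (al l k : R -> R) :
  measurable A -> measurable_fun [set: R * R] F -> (forall u, 0 <= F u) ->
  measurable D -> measurable_fun D (fun z => k z * Num.max (l z) 0) ->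
  (forall z, D z -> 0 <= k z) ->
  (forall z w, A (z, w) -> [/\ D z, al z <= w <= al z + l z & F (z, w) <= k z]) ->
  (\int[lebesgue2 R]_(u in A) (F u)%:E <=
   \int[@lebesgue_measure R]_(z in D) (k z * Num.max (l z) 0)%:E)%E.
Proof.
move=> mA mF F0 mD mkl k0 h.
rewrite [leLHS]integral_mkcond.
have mFA : measurable_fun [set: R * R] ((fun u => (F u)%:E) \_ A).
  apply/(measurable_restrictT _ _).1 => //; apply/measurable_EFinP.
  exact: measurable_funTS.
have FA0 u : (0 <= ((fun u => (F u)%:E) \_ A) u)%E.
  by apply: erestrict_ge0 => v _; rewrite lee_fin.
rewrite fubini_tonelli1// [leRHS]integral_mkcond; apply: ge0_le_integral => //.
- by move=> z _; exact: integral_ge0.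
- exact: measurable_fun_fubini_tonelli_F.
- by apply/(measurable_restrictT _ _).1 => //; apply/measurable_EFinP.
move=> z _; rewrite /fubini_F patchE; case: ifPn => [/set_mem Dz|/negP Dz]; last first.
  rewrite integral0_eq// => w _; rewrite patchE ifF//; apply/negbTE/negP => /set_mem /h[/mem_set]//.
apply: (@le_trans _ _ (\int[@lebesgue_measure R]_(w in `[al z, (al z + l z)%R]) (cst (k z)%:E w))%E).
  rewrite [leRHS]integral_mkcond; apply: ge0_le_integral => //.
  - by apply: (measurableT_comp mFA); exact: measurable_fun_pair.
  - by apply/(measurable_restrictT _ _).1.
  - move=> w _; rewrite !patchE; case: ifPn => [/set_mem /h[_ wz Fk]|_].
      by rewrite ifT ?lee_fin// inE/= in_itv/=.
    by case: ifP => _ //; rewrite lee_fin k0.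
by rewrite integral_cst//; have /= -> := lebesgue_segment (al z) (l z) true false; rewrite -EFinM.
Qed.

Lemma integral_vslices_ge (R : realType) (A : set (R * R)) (F : R * R -> R)
    (D : set R) (al l k : R -> R) :
  measurable A -> measurable_fun [set: R * R] F -> (forall u, 0 <= F u) ->
  measurable D -> measurable_fun D (fun z => k z * Num.max (l z) 0) ->
  (forall z, D z -> 0 <= k z) ->
  (forall z w, D z -> al z < w < al z + l z -> A (z, w) /\ k z <= F (z, w)) ->
  (\int[@lebesgue_measure R]_(z in D) (k z * Num.max (l z) 0)%:E <=
   \int[lebesgue2 R]_(u in A) (F u)%:E)%E.
Proof.
move=> mA mF F0 mD mkl k0 h.
rewrite [leRHS]integral_mkcond.
have mFA : measurable_fun [set: R * R] ((fun u => (F u)%:E) \_ A).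
  apply/(measurable_restrictT _ _).1 => //; apply/measurable_EFinP.
  exact: measurable_funTS.
have FA0 u : (0 <= ((fun u => (F u)%:E) \_ A) u)%E.
  by apply: erestrict_ge0 => v _; rewrite lee_fin.
have kl0 z : D z -> 0 <= k z * Num.max (l z) 0.
  by move=> Dz; rewrite mulr_ge0 ?k0// le_max lexx orbT.
rewrite [leRHS]fubini_tonelli1// [leLHS]integral_mkcond; apply: ge0_le_integral => //.
- by move=> z _; apply: erestrict_ge0 => x Dx; rewrite lee_fin kl0.
- by apply/(measurable_restrictT _ _).1 => //; apply/measurable_EFinP.
- exact: measurable_fun_fubini_tonelli_F.
move=> z _; rewrite /fubini_F patchE; case: ifPn => [/set_mem Dz|/negP Dz]; last first.
  exact: integral_ge0.
apply: (@le_trans _ _ (\int[@lebesgue_measure R]_(w in `]al z, (al z + l z)%R[) (cst (k z)%:E w))%E).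
  by rewrite integral_cst//; have /= -> := lebesgue_segment (al z) (l z) false true; rewrite -EFinM.
rewrite [leLHS]integral_mkcond; apply: ge0_le_integral => //.
- by move=> w _; apply: erestrict_ge0 => x _; rewrite lee_fin k0.
- by apply/(measurable_restrictT _ _).1.
- by apply: (measurableT_comp mFA); exact: measurable_fun_pair.
- move=> w _; rewrite !patchE; case: ifPn => [/set_mem/=|_].
    by rewrite in_itv/= => /(h _ _ Dz)[/mem_set -> ]; rewrite lee_fin.
  by case: ifP => _ //; rewrite lee_fin.
Qed.

Lemma integral_riesz_swap (R : realType) (s : R) (A : set (R * R)) : measurable A ->
  (\int[lebesgue2 R]_(u in [set u | A (u.2, u.1)]) (riesz s u)%:E =
   \int[lebesgue2 R]_(u in A) (riesz s u)%:E)%E.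
Proof.
move=> mA; rewrite integral_mkcond [RHS]integral_mkcond -[RHS]ge0_integral2_swap.
- apply: eq_integral => u _; rewrite !patchE/= /riesz /= [u.2 ^+ 2 + _]addrC.
  have -> : ((u.2, u.1) \in A) = (u \in [set u | A (u.2, u.1)]) by apply/idP/idP; rewrite !inE.
  by case: ifP.
- apply/(measurable_restrictT _ _).1 => //; apply/measurable_EFinP.
  by apply: measurable_funTS; exact: measurable_riesz.
- by move=> u; apply: erestrict_ge0 => v _; rewrite lee_fin riesz_ge0.
Qed.

(** * Tangent inequalities for powers *)

(** Young's inequality for [t^a] and [1], with exponents [1/a] and [1/(1-a)],
    is the tangent inequality at [1]; the general one follows by scaling. *)
Lemma powR_le_tangent (R : realType) (a x y : R) : 0 < a < 1 -> 0 < y -> 0 <= x ->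
  x `^ a <= y `^ a + a * y `^ (a - 1) * (x - y).
Proof.
move=> /andP[a0 a1] y0 x0.
have h (t : R) : 0 <= t -> t `^ a <= 1 + a * (t - 1).
  move=> t0; have := @conjugate_powR R (t `^ a) 1 a^-1 (1 - a)^-1 (powR_ge0 _ _) ler01.
  rewrite !invrK !invr_gt0 subr_gt0 a0 a1 => /(_ isT isT) h.
  have := h ltac:(lra); rewrite mulr1 -powRrM mulfV ?gt_eqF// powRr1// powR1 mul1r; lra.
have xy : x = y * (x / y) by rewrite mulrC divfK// gt_eqF.
have t0 : 0 <= x / y by rewrite divr_ge0// ltW.
rewrite {1}xy powRM ?(ltW y0)//.
have -> : y `^ a = y * y `^ (a - 1) by rewrite mulrC -[X in _ * X]powRr1 ?ltW// -powRD ?subrK// gt_eqF ?implybT.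
have yp : 0 < y `^ (a - 1) by rewrite powR_gt0.
have := h _ t0; set u := x / y in xy t0 * => hu.
rewrite {1}xy.
have := ler_wpM2l (ltW (mulr_gt0 y0 yp)) hu.
by move=> /le_trans; apply; lra.
Qed.

(** The concave case for the exponent [1/b], at the points [x^b] and [y^b]. *)
Lemma powR_ge_tangent (R : realType) (b x y : R) : 1 < b -> 0 < y -> 0 <= x ->
  y `^ b + b * y `^ (b - 1) * (x - y) <= x `^ b.
Proof.
move=> b1 y0 x0; have b0 : 0 < b by lra.
have a01 : 0 < b^-1 < 1 by rewrite invr_gt0 b0/= invf_lt1.
have := powR_le_tangent a01 (powR_gt0 b y0) (powR_ge0 x b).
rewrite -!powRrM mulfV ?gt_eqF// !powRr1 ?(ltW y0)//.
have -> : b * (b^-1 - 1) = 1 - b by field; rewrite gt_eqF.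
have yp : 0 < y `^ (b - 1) by rewrite powR_gt0.
have -> : y `^ (1 - b) = (y `^ (b - 1))^-1 by rewrite -powRN opprB.
set P := y `^ (b - 1) in yp *.
have -> : y `^ b = y * P.
  by rewrite /P -{2}[y]powRr1 ?ltW// -powRD ?subrKC// gt_eqF ?implybT.
move=> h.
have bP : 0 < b * P by rewrite mulr_gt0.
have := ler_wpM2l (ltW bP) h.
have -> : b * P * (y + b^-1 / P * (x `^ b - y * P)) = b * P * y + x `^ b - y * P.
  by field; rewrite !gt_eqF.
lra.
Qed.

(** * The linearized balance on the power arc *)

(** This substitution scales the distance [D] out of the linearized balance. *)
Lemma integral_substV (R : realType) (G : R -> R) (D a b : R) : 0 < D -> 0 < a -> a <= b ->
  (forall x, 0 < x -> {for x, continuous G}) ->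
  (\int[@lebesgue_measure R]_(x in `[(D / b)%R, (D / a)%R]) (G x)%:E =
   \int[@lebesgue_measure R]_(x in `[a, b]) (G (D / x) * (D / x ^+ 2))%:E)%E.
Proof.
move=> D0 a0 ab cG.
pose F (x : R) := D / x.
have dF (x : R) : 0 < x -> is_derive x 1 F (- (D / x ^+ 2)).
  move=> x0; have xn : x != 0 by rewrite gt_eqF.
  have h := is_deriveZ D (@is_deriveV _ id x 1 1 xn (is_derive_id x 1)).
  apply: (is_derive_eq h).
  by rewrite /GRing.scale/= mulr1 mulrN.
have F'E (x : R) : 0 < x -> derive1 F x = - (D / x ^+ 2).
  by move=> x0; have [_ <-] := dF x x0; rewrite derive1E.
have cF (x : R) : 0 < x -> {for x, continuous F}.
  by move=> /dF [dFx _]; exact/differentiable_continuous/derivable1_diffP.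
have cF' (x : R) : 0 < x -> {for x, continuous (derive1 F)}.
  move=> x0; rewrite /prop_for /continuous_at F'E//.
  apply: (@cvg_trans _ ((fun y : R => - (D / y ^+ 2)) @ x)).
    apply: near_eq_cvg; near=> y; rewrite F'E//; near: y; exact: lt_nbhsr.
  apply: (@continuousN _ _ _ (fun y : R => D / y ^+ 2)).
  apply: (@continuousM _ _ (cst D) (fun y : R => (y ^+ 2)^-1)); first exact: cst_continuous.
  apply: (@continuousV _ _ (fun y : R => y ^+ 2)); last exact: exprn_continuous.
  by rewrite expf_neq0// gt_eqF.
have pos x : x \in `[a, b] -> 0 < x.
  by rewrite in_itv/= => /andP[+ _]; exact: lt_le_trans.
rewrite -[X in `[X, _]]/(F b) -[X in `[_, X]]/(F a).
rewrite (@integration_by_substitution_decreasing _ F G a b ab).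
- apply: eq_integral => x; rewrite inE/= => /pos x0; congr EFin.
  by rewrite !fctE F'E// opprK.
- move=> x y /pos x0 /pos y0 xy; rewrite /F ltr_pM2l// ltf_pV2//.
- move=> x xab; apply: cF'; apply: pos; move: xab; exact: subset_itv_oo_cc.
- by apply/cvg_ex; exists (derive1 F a); apply: cvg_at_right_filter; exact: cF'.
- apply/cvg_ex; exists (derive1 F b); apply: cvg_at_left_filter; apply: cF'.
  exact: lt_le_trans ab.
- split.
  + by move=> x /subset_itv_oo_cc /pos /dF [].
  + by apply: cvg_at_right_filter; exact: cF.
  + by apply: cvg_at_left_filter; apply: cF; exact: lt_le_trans ab.
- apply: continuous_in_subspaceT => x; rewrite inE/= in_itv/= => /andP[+ _].
  move=> /(lt_le_trans _) xp; apply: cG; apply: xp.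
  by rewrite divr_gt0// (lt_le_trans a0).
Unshelve. all: by end_near. Qed.

Lemma ge0_integralD_EFin (R : realType) (D : set R) (f g : R -> R) :
  measurable D -> measurable_fun [set: R] f -> measurable_fun [set: R] g ->
  (forall x, D x -> 0 <= f x) -> (forall x, D x -> 0 <= g x) ->
  (\int[@lebesgue_measure R]_(x in D) (f x)%:E + \int[@lebesgue_measure R]_(x in D) (g x)%:E =
   \int[@lebesgue_measure R]_(x in D) (f x + g x)%:E)%E.
Proof.
move=> mD mf mg f0 g0; rewrite -ge0_integralD//.
- by apply/measurable_EFinP; exact: measurable_funTS.
- by apply/measurable_EFinP; exact: measurable_funTS.
Qed.

(** Both sides come from [p + (q - p)_+ = q + (p - q)_+]; the integral of [q] has
    to be finite in order to be cancelled. *)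
Lemma integral_pos_part_le (R : realType) (I : set R) (p q : R -> R) (e : \bar R) :
  measurable I -> measurable_fun [set: R] p -> measurable_fun [set: R] q ->
  (forall x, I x -> 0 <= p x) -> (forall x, I x -> 0 <= q x) ->
  (\int[@lebesgue_measure R]_(x in I) (q x)%:E < +oo)%E ->
  (\int[@lebesgue_measure R]_(x in I) (p x)%:E <=
   \int[@lebesgue_measure R]_(x in I) (q x)%:E + e)%E ->
  (\int[@lebesgue_measure R]_(x in I) (Num.max (p x - q x) 0)%:E <=
   \int[@lebesgue_measure R]_(x in I) (Num.max (q x - p x) 0)%:E + e)%E.
Proof.
move=> mI mp mq p0 q0 qy pq.
have m1 : measurable_fun [set: R] (fun x => Num.max (p x - q x) 0).
  by apply: measurable_maxr => //; exact: measurable_funB.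
have m2 : measurable_fun [set: R] (fun x => Num.max (q x - p x) 0).
  by apply: measurable_maxr => //; exact: measurable_funB.
have qfin : (\int[@lebesgue_measure R]_(x in I) (q x)%:E)%E \is a fin_num.
  by rewrite ge0_fin_numE//; apply: integral_ge0 => x /q0; rewrite lee_fin.
rewrite -(leeD2rE _ _ qfin) ge0_integralD_EFin//; last first.
  by move=> x _; rewrite le_max lexx orbT.
rewrite -addeA [(e + _)%E]addeC.
apply: (@le_trans _ _ (\int[@lebesgue_measure R]_(x in I) (Num.max (q x - p x) 0)%:E +
    \int[@lebesgue_measure R]_(x in I) (p x)%:E)%E); last exact: leeD2l.
rewrite ge0_integralD_EFin//; last by move=> x _; rewrite le_max lexx orbT.
rewrite le_eqVlt; apply/orP; left; apply/eqP/eq_integral => x _; congr EFin.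
have [h|/ltW h] := leP (p x) (q x).
  by rewrite max_r ?subr_le0// max_l ?subr_ge0//; lra.
by rewrite max_l ?subr_ge0// max_r ?subr_le0//; lra.
Qed.

Section linearized.
Context (R : realType) (a : R).
Hypotheses (a_gt0 : 0 < a) (a_lt1 : a < 1).

(** Under [z = D / x], the fall and the rise of the power, weighted by
    [z^(-1-2a)], become [p] and [q] up to the factor [D^(-a)]. They are linked by
    [q x = p (x + 1) - S' x]. *)
Let p (x : R) := (x `^ a - Num.max (x - 1) 0 `^ a) * x `^ (a - 1).
Let q (x : R) := ((x + 1) `^ a - x `^ a) * x `^ (a - 1).
Let S (x : R) := ((x + 1) `^ a - x `^ a) ^+ 2 / (2 * a).
Local Notation mu := (@lebesgue_measure R).

Let powR0a : (0 : R) `^ a = 0. Proof. by rewrite powR0// gt_eqF. Qed.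

Let powR_max_continuous (x : R) : {for x, continuous (fun y : R => Num.max y 0 `^ a)}.
Proof.
rewrite /prop_for /continuous_at; have [x0|x0|->] := ltgtP x 0.
- rewrite powR0a; apply: cvg_near_cst; near=> y; rewrite max_r ?powR0a//.
  by apply/ltW; near: y; exact: lt_nbhsl.
- have := @powR_continuous_pos _ a _ x0; apply: cvg_trans.
  apply: near_eq_cvg; near=> y; rewrite max_l//.
  by apply/ltW; near: y; exact: lt_nbhsr.
- rewrite ?maxxx powR0a; apply/cvgrPdist_lt => e e0; near=> y.
  rewrite sub0r normrN ger0_norm ?powR_ge0//.
  rewrite (_ : e = (e `^ a^-1) `^ a); last by rewrite -powRrM mulVf ?powRr1 ?ltW// gt_eqF.
  rewrite gt0_ltr_powR ?nnegrE ?powR_ge0 ?le_max ?lexx ?orbT//.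
  rewrite gt_max powR_gt0// andbT.
  near: y; apply: lt_nbhsl; exact: powR_gt0.
Unshelve. all: by end_near. Qed.

Let cadd (c x : R) : {for x, continuous (fun y : R => y + c)}.
Proof. by apply: (@continuousD _ _ _ id (cst c)); [exact: cvg_id|exact: cst_continuous]. Qed.

Let cpow1 (k x : R) : 0 < x -> {for x, continuous (fun y : R => (y + 1) `^ k)}.
Proof.
move=> x0; apply: (@continuous_comp _ _ _ (fun y : R => y + 1) (fun y : R => y `^ k)).
  exact: cadd.
by apply: powR_continuous_pos; rewrite addr_gt0.
Qed.

Let mp : measurable_fun [set: R] p.
Proof.
apply: measurable_funM; last exact: measurable_fun_powR.
apply: measurable_funB; first exact: measurable_fun_powR.
by apply: measurable_fun_powR; apply: measurable_maxr => //; exact: measurable_funB.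
Qed.

Let mq : measurable_fun [set: R] q.
Proof.
apply: measurable_funM; last exact: measurable_fun_powR.
by apply: measurable_funB; apply: measurable_fun_powR => //; exact: measurable_funD.
Qed.

Let cp (x : R) : 0 < x -> {for x, continuous p}.
Proof.
move=> x0.
apply: (@continuousM _ _ (fun y : R => y `^ a - Num.max (y - 1) 0 `^ a)); last exact: powR_continuous_pos.
apply: (@continuousB _ _ _ (fun y : R => y `^ a) (fun y : R => Num.max (y - 1) 0 `^ a)).
  exact: powR_continuous_pos.
apply: (@continuous_comp _ _ _ (fun y : R => y - 1) (fun y : R => Num.max y 0 `^ a)).
  exact: cadd.
exact: powR_max_continuous.
Qed.

Let cq (x : R) : 0 < x -> {for x, continuous q}.
Proof.
move=> x0.
apply: (@continuousM _ _ (fun y : R => (y + 1) `^ a - y `^ a)); last exact: powR_continuous_pos.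
apply: (@continuousB _ _ _ (fun y : R => (y + 1) `^ a) (fun y : R => y `^ a)); first exact: cpow1.
exact: powR_continuous_pos.
Qed.

Let p_ge0 (x : R) : 0 <= x -> 0 <= p x.
Proof.
move=> x0; rewrite mulr_ge0 ?powR_ge0// subr_ge0 ge0_ler_powR ?nnegrE ?(ltW a_gt0)//.
  by rewrite le_max lexx orbT.
by rewrite ge_max x0 andbT; lra.
Qed.

Let q_ge0 (x : R) : 0 <= x -> 0 <= q x.
Proof.
move=> x0; rewrite mulr_ge0 ?powR_ge0// subr_ge0 ge0_ler_powR ?nnegrE ?(ltW a_gt0)//; lra.
Qed.

Let dS (x : R) : 0 < x -> is_derive x 1 S (- (q x - p (x + 1))).
Proof.
move=> x0.
have d1 : is_derive x 1 (fun y : R => (y + 1) `^ a) (a * (x + 1) `^ (a - 1)).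
  have x1 : 0 < x + 1 by lra.
  have h0 := is_deriveD (is_derive_id x (1 : R)) (is_derive_cst (1 : R) x 1).
  have h := @is_derive1_comp _ (fun y : R => y `^ a) _ x _ _ (is_derive1_powR a x1) h0.
  by apply: (is_derive_eq h); rewrite addr0 mulr1.
have d2 := is_derive1_powR a x0.
have h := is_deriveZ (2 * a)^-1 (is_deriveX 2 (is_deriveB d1 d2)).
have -> : S = (2 * a)^-1 \*: (((fun y : R => (y + 1) `^ a) - (fun y : R => y `^ a)) ^+ 2).
  by apply/funext => y; rewrite /S !fctE mulrC.
apply: (is_derive_eq h).
rewrite /p /q addrK max_l ?ltW// /GRing.scale/= !fctE expr1.
by field; rewrite gt_eqF.
Qed.

Let shift_identity (r T : R) : 0 < r -> r < T ->
  (\int[mu]_(x in `[(1 + r)%R, (1 + T)%R]) (p x)%:E + (S r - S T)%:E =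
   \int[mu]_(x in `[r, T]) (q x)%:E)%E.
Proof.
move=> r0 rT.
have -> : (\int[mu]_(x in `[(1 + r)%R, (1 + T)%R]) (p x)%:E =
    \int[mu]_(x in `[r, T]) (p (x + 1))%:E)%E.
  rewrite integral_mkcond -(@ge0_integral_shift_sign _ _ 1 1); last 3 first.
  - by left.
  - apply/(measurable_restrictT _ _).1 => //; apply/measurable_EFinP.
    exact: measurable_funTS.
  - move=> x; apply: erestrict_ge0 => y /=; rewrite in_itv/= => /andP[h _].
    by rewrite lee_fin p_ge0//; lra.
  rewrite [RHS]integral_mkcond; apply: eq_integral => x _; rewrite !patchE mul1r.
  rewrite [(1 + x)%R]addrC.
  have -> : ((x + 1) \in `[1 + r, 1 + T]%classic) = (x \in `[r, T]%classic).
    by apply/idP/idP; rewrite !inE/= !in_itv/=; lra.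
  by case: ifP.
have dSm (x : R) : 0 < x -> is_derive x 1 (fun y => - S y) (q x - p (x + 1)).
  by move=> x0; have := is_deriveN (dS x0); rewrite opprK.
have -> : (S r - S T)%:E = (\int[mu]_(x in `[r, T]) (q x - p (x + 1))%:E)%E.
  transitivity ((- S T - - S r)%:E)%E; first by congr EFin; lra.
  apply/esym; apply: (@integral_derive _ _ (fun y => - S y) r T rT).
  - by move=> x /andP[rx _]; apply: dSm; exact: lt_le_trans rx.
  - move=> x /andP[rx _]; have x0 : 0 < x by exact: lt_le_trans rx.
    apply: (@continuousB _ _ _ q (fun y => p (y + 1))); first exact: cq.
    apply: (@continuous_comp _ _ _ (fun y : R => y + 1) p); first exact: cadd.
    by apply: cp; lra.
rewrite -ge0_integralD//.
- by apply: eq_integral => x _; rewrite -EFinD subrKC.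
- by move=> x; rewrite /= in_itv/= => /andP[h _]; rewrite lee_fin p_ge0//; lra.
- apply/measurable_EFinP; apply: measurable_funTS.
  by apply: (measurableT_comp mp); exact: measurable_funD.
- move=> x; rewrite /= in_itv/= => /andP[h _]; rewrite lee_fin.
  rewrite /q /p addrK max_l; last by lra.
  rewrite -mulrBr mulr_ge0// subr_ge0.
    by rewrite ge0_ler_powR ?nnegrE ?(ltW a_gt0)//; lra.
  rewrite -[a - 1]opprB !powRN lef_pV2 ?posrE ?powR_gt0//; try lra.
  by rewrite ge0_ler_powR ?nnegrE ?subr_ge0 ?(ltW a_lt1)//; lra.
- apply/measurable_EFinP; apply: measurable_funTS; apply: measurable_funB => //.
  by apply: (measurableT_comp mp); exact: measurable_funD.
Qed.

(** [p] is [x^(2a-1)] before [1], with integral [1 / (2a)]: this is also the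
    limit of [S] at [0], so the first unit interval is paid by a boundary term
    of [shift_identity]. *)
Let near_part (r : R) : 0 < r ->
  (\int[mu]_(x in `[r, (1 + r)%R]) (p x)%:E <=
    (((1 + r) `^ (2 * a) - r `^ (2 * a)) / (2 * a))%:E)%E.
Proof.
move=> r0; have a2 : 0 < 2 * a by rewrite mulr_gt0.
apply: (@le_trans _ _ (\int[mu]_(x in `[r, (1 + r)%R]) (x `^ (2 * a - 1))%:E)%E).
  apply: ge0_le_integral => //.
  - by move=> x /=; rewrite in_itv/= => /andP[h _]; rewrite lee_fin p_ge0//; lra.
  - by apply/measurable_EFinP; apply: measurable_funTS.
  - by apply/measurable_EFinP; apply: measurable_funTS; exact: measurable_fun_powR.
  - move=> x /=; rewrite in_itv/= => /andP[h _]; rewrite lee_fin /p.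
    have x0 : 0 < x by lra.
    rewrite (_ : 2 * a - 1 = a + (a - 1)); last by lra.
    rewrite [leRHS]powRD; last by rewrite (gt_eqF x0) implybT.
    by apply: ler_wpM2r; rewrite ?powR_ge0// gerBl powR_ge0.
have -> : (\int[mu]_(x in `[r, (1 + r)%R]) (x `^ (2 * a - 1))%:E =
    ((2 * a)^-1 * (1 + r) `^ (2 * a) - (2 * a)^-1 * r `^ (2 * a))%:E)%E; last first.
  by rewrite lee_fin; lra.
apply: (@integral_derive _ _ (fun y => (2 * a)^-1 * y `^ (2 * a))).
- by lra.
- move=> x /andP[h _]; have x0 : 0 < x by lra.
  apply: (is_derive_eq (is_deriveZ (2 * a)^-1 (is_derive1_powR (2 * a) x0))).
  by rewrite /GRing.scale/= mulrA mulVf ?mul1r// gt_eqF.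
- by move=> x /andP[h _]; apply: powR_continuous_pos; lra.
Qed.

(** The error of the comparison on the segment from [r] to [1 + T]: it vanishes
    when [r] tends to [0] and [T] to infinity because [a > 0] and [a < 1] respectively. *)
Let defect (r T : R) := (r `^ a * (1 + r) `^ a) / a + S T.

Let integral_p_le (r T : R) : 0 < r -> r < T ->
  (\int[mu]_(x in `[r, (1 + T)%R]) (p x)%:E <=
   \int[mu]_(x in `[r, (1 + T)%R]) (q x)%:E + (defect r T)%:E)%E.
Proof.
move=> r0 rT.
have p0 x : r <= x -> (0 <= (p x)%:E)%E by move=> h; rewrite lee_fin p_ge0//; lra.
have mEp D : measurable D -> measurable_fun (D : set R) (fun x => (p x)%:E).
  by move=> mD; apply/measurable_EFinP; apply: measurable_funTS.
have mEq D : measurable D -> measurable_fun (D : set R) (fun x => (q x)%:E).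
  by move=> mD; apply/measurable_EFinP; apply: measurable_funTS.
have -> : `[r, 1 + T]%classic = `[r, (1 + r)] `|` `](1 + r), (1 + T)] :> set R.
  apply/seteqP; split=> x/=; rewrite !in_itv/=.
    by move=> /andP[-> ->]; rewrite andbT; case: (leP x (1 + r)) => _; [left|right].
  by case; lra.
rewrite [leLHS]ge0_integral_setU//; last 3 first.
- by apply: mEp; exact: measurableU.
- by move=> x [] /=; rewrite in_itv/= => /andP[h _]; apply: p0 => //; lra.
- rewrite disj_set2E; apply/eqP/seteqP; split=> x//=; rewrite !in_itv/=; lra.
have h1 : (\int[mu]_(x in `](1 + r)%R, (1 + T)%R]) (p x)%:E <=
    \int[mu]_(x in `[(1 + r)%R, (1 + T)%R]) (p x)%:E)%E.
  apply: ge0_subset_integral => //; first exact: mEp.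
    by move=> x /=; rewrite in_itv/= => /andP[h _]; apply: p0; lra.
  by move=> x /=; rewrite !in_itv/=; lra.
have h2 : (\int[mu]_(x in `[r, T]) (q x)%:E <=
    \int[mu]_(x in `[r, (1 + r)%R] `|` `](1 + r)%R, (1 + T)%R]) (q x)%:E)%E.
  apply: ge0_subset_integral => //; first exact: measurableU.
  - by apply: mEq; exact: measurableU.
  - by move=> x [] /=; rewrite in_itv/= => /andP[h _]; rewrite lee_fin q_ge0//; lra.
  - move=> x /=; rewrite !in_itv/= => /andP[-> h]; case: (leP x (1 + r)) => _; [left|right] => //=; lra.
have h3 := shift_identity r0 rT.
have h4 := near_part r0.
apply: (@le_trans _ _ ((((1 + r) `^ (2 * a) - r `^ (2 * a)) / (2 * a))%:E +
   \int[mu]_(x in `[(1 + r)%R, (1 + T)%R]) (p x)%:E)%E).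
  by apply: leeD; [exact: h4|exact: h1].
apply: (@le_trans _ _ (\int[mu]_(x in `[r, T]) (q x)%:E + (defect r T)%:E)%E); last exact: leeD2r.
rewrite -h3 -addeA -EFinD [leLHS]addeC; apply: leeD2l; rewrite lee_fin /defect /S.
rewrite [2 * a]mulrC !powRrM -[2]/(2%:R) !powR_mulrn ?powR_ge0// [r + 1]addrC.
rewrite -subr_ge0; set X := (1 + r) `^ a; set Y := r `^ a.
rewrite (_ : _ - _ = Y ^+ 2 / a); last by field; rewrite gt_eqF.
by rewrite divr_ge0 ?sqr_ge0// ltW.
Qed.

Let defect_small (e : R) : 0 < e ->
  exists r0 T0, 0 < r0 < T0 /\ forall r T, 0 < r <= r0 -> T0 <= T -> defect r T <= e.
Proof.
move=> e0.
have ea0 : 0 < e * a / 4 by rewrite divr_gt0// mulr_gt0.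
pose r0 := Num.min (1 / 2) ((e * a / 4) `^ a^-1).
pose T0 := Num.max 1 ((e / 2) `^ (- (1 - a)^-1)).
have r0_gt0 : 0 < r0 by rewrite lt_min powR_gt0// andbT; lra.
have a1 : 0 < 1 - a by rewrite subr_gt0.
exists r0, T0; split.
  by rewrite r0_gt0 lt_max gt_min; apply/orP; left; apply/orP; left; lra.
move=> r T /andP[r_gt0 rr0] TT0.
move: rr0; rewrite le_min => /andP[r2 re].
move: TT0; rewrite ge_max => /andP[T1 Te].
have T_gt0 : 0 < T by lra.
have ra : r `^ a <= e * a / 4.
  have -> : e * a / 4 = ((e * a / 4) `^ a^-1) `^ a.
    by rewrite -powRrM mulVf ?powRr1 ?(ltW ea0)// gt_eqF.
  by rewrite ge0_ler_powR ?nnegrE ?powR_ge0 ?(ltW a_gt0) ?(ltW r_gt0).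
have r1a : (1 + r) `^ a <= 2.
  apply: le_trans (_ : (1 + r) `^ 1 <= 2); last by rewrite powRr1; lra.
  by rewrite ler_powR ?(ltW a_lt1)//; lra.
have Ta : T `^ (a - 1) <= e / 2.
  have -> : e / 2 = (((e / 2) `^ (- (1 - a)^-1))) `^ (a - 1).
    rewrite -powRrM (_ : - (1 - a)^-1 * (a - 1) = 1); last by field; rewrite gt_eqF.
    by rewrite powRr1//; lra.
  have B0 : 0 < (e / 2) `^ (- (1 - a)^-1) by apply: powR_gt0; lra.
  rewrite -[a - 1]opprB !(powRN _ (1 - a)) lef_pV2 ?posrE ?powR_gt0 ?divr_gt0//.
  by rewrite ge0_ler_powR ?nnegrE ?(ltW a1) ?(ltW T_gt0) ?(ltW B0).
have Ta1 : T `^ (a - 1) <= 1.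
  rewrite -[leRHS](powRr0 T); apply: ler_powR => //; lra.
have T1' : 0 <= T + 1 by lra.
have := @powR_le_tangent R a (T + 1) T (introT andP (conj a_gt0 a_lt1)) T_gt0 T1'.
rewrite [T + 1 - T](_ : _ = 1); last by lra.
rewrite mulr1 => tang.
have lowT : T `^ a <= (T + 1) `^ a.
  by rewrite ge0_ler_powR ?nnegrE ?(ltW a_gt0)//; lra.
have P0 : 0 <= T `^ (a - 1) by exact: powR_ge0.
move: Ta Ta1 tang P0; set P := T `^ (a - 1) => Ta Ta1 tang P0.
have ST : S T <= e / 2.
  rewrite /S ler_pdivrMr ?mulr_gt0//.
  set d := (T + 1) `^ a - T `^ a.
  have d0 : 0 <= d by rewrite /d; lra.
  have dP : d <= a * P by rewrite /d; lra.
  have : d ^+ 2 <= (a * P) ^+ 2 by rewrite ler_pXn2r ?nnegrE// (le_trans d0).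
  move/le_trans; apply.
  have aP : a * P <= 1 by rewrite mulr_ile1// ltW.
  have : (a * P) ^+ 2 <= a * P by rewrite expr2 ler_piMl// (le_trans d0).
  move/le_trans; apply.
  have : a * P <= a * (e / 2) by rewrite ler_pM2l.
  nra.
have : r `^ a * (1 + r) `^ a / a <= e / 2.
  rewrite ler_pdivrMr//.
  apply: (@le_trans _ _ (e * a / 4 * 2)); last by nra.
  by apply: ler_pM; rewrite ?powR_ge0.
by rewrite /defect; lra.
Qed.

Let positive_part_le (r T : R) : 0 < r -> r < T ->
  (\int[mu]_(x in `[r, (1 + T)%R]) (Num.max (p x - q x) 0)%:E <=
   \int[mu]_(x in `[r, (1 + T)%R]) (Num.max (q x - p x) 0)%:E + (defect r T)%:E)%E.
Proof.
move=> r0 rT.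
have pos x : `[r, 1 + T]%classic x -> 0 <= x.
  by rewrite /= in_itv/= => /andP[+ _]; exact: le_trans (ltW r0).
apply: integral_pos_part_le.
- exact: measurable_itv.
- exact: mp.
- exact: mq.
- by move=> x /pos; exact: p_ge0.
- by move=> x /pos; exact: q_ge0.
- have iq : mu.-integrable `[r, 1 + T]%classic (EFin \o q).
    apply: continuous_compact_integrable; first exact: segment_compact.
    apply: continuous_in_subspaceT => x; rewrite inE /= in_itv/= => /andP[h _].
    by apply: cq; exact: lt_le_trans h.
  by apply: (integrable_lty _ iq); exact: measurable_itv.
- exact: integral_p_le.
Qed.

Variable D : R.
Hypothesis D_gt0 : 0 < D.

(** Height differences along the graph of [x_+^a] when the distance to the foot
    changes from [D] to [D + z] and from [D] to [D - z]. *)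
Definition rise (z : R) := (D + z) `^ a - D `^ a.
Definition fall (z : R) := D `^ a - Num.max (D - z) 0 `^ a.

Let subst_factor (x : R) : 0 < x ->
  (rise (D / x) * (D / x) `^ (- 1 - 2 * a) * (D / x ^+ 2) = q x / D `^ a) /\
  (fall (D / x) * (D / x) `^ (- 1 - 2 * a) * (D / x ^+ 2) = p x / D `^ a).
Proof.
move=> x0; have w0 : 0 < D / x by rewrite divr_gt0.
have wa : (D / x) `^ a = D `^ a / x `^ a.
  have : D `^ a = (D / x) `^ a * x `^ a by rewrite -powRM ?(ltW w0) ?(ltW x0)// divfK// gt_eqF.
  by move=> ->; rewrite mulfK// gt_eqF// powR_gt0.
have wk : (D / x) `^ (- 1 - 2 * a) = (D / x * (D / x) `^ a ^+ 2)^-1.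
  rewrite -opprD powRN; congr (_^-1).
  rewrite powRD; last by rewrite (gt_eqF w0) implybT.
  by rewrite powRr1 ?(ltW w0)// [2 * a]mulrC powRrM -[2]/(2%:R) powR_mulrn ?powR_ge0.
have xk : x `^ (a - 1) = x `^ a / x.
  by rewrite powRD ?powR_inv1 ?(ltW x0)// (gt_eqF x0) implybT.
have riseE : rise (D / x) = (D / x) `^ a * ((x + 1) `^ a - x `^ a).
  rewrite /rise mulrBr -!powRM ?(ltW w0) ?(ltW x0)//; last by lra.
  by congr (_ `^ _ - _ `^ _); field; rewrite gt_eqF.
have fallE : fall (D / x) = (D / x) `^ a * (x `^ a - Num.max (x - 1) 0 `^ a).
  rewrite /fall mulrBr -!powRM ?(ltW w0) ?(ltW x0) ?le_max ?lexx ?orbT//.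
  rewrite maxr_pMr ?(ltW w0)// mulr0.
  by congr (_ `^ _ - Num.max _ _ `^ _); field; rewrite gt_eqF.
rewrite riseE fallE wk /p /q xk wa.
have A0 : D `^ a != 0 by rewrite gt_eqF// powR_gt0.
have X0 : x `^ a != 0 by rewrite gt_eqF// powR_gt0.
have xn0 : x != 0 by rewrite gt_eqF.
have Dn0 : D != 0 by rewrite gt_eqF.
split; field; by rewrite A0 X0 xn0 Dn0.
Qed.

Let weight (f : R -> R) (z : R) := Num.max (f z) 0 * z `^ (- 1 - 2 * a).

Let crise (x : R) : 0 < x -> {for x, continuous rise}.
Proof.
move=> x0; apply: (@continuousB _ _ _ (fun z => (D + z) `^ a) (cst (D `^ a))); last exact: cst_continuous.
apply: (@continuous_comp _ _ _ (fun y : R => D + y) (fun y : R => y `^ a)).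
  by apply: (@continuousD _ _ _ (cst D) id); [exact: cst_continuous|exact: cvg_id].
by apply: powR_continuous_pos; rewrite addr_gt0.
Qed.

Let cfall (x : R) : 0 < x -> {for x, continuous fall}.
Proof.
move=> x0; apply: (@continuousB _ _ _ (cst (D `^ a)) (fun z => Num.max (D - z) 0 `^ a)); first exact: cst_continuous.
apply: (@continuous_comp _ _ _ (fun y : R => D - y) (fun y : R => Num.max y 0 `^ a)).
  by apply: (@continuousB _ _ _ (cst D) id); [exact: cst_continuous|exact: cvg_id].
exact: powR_max_continuous.
Qed.

Let cweight f (x : R) : 0 < x -> {for x, continuous f} -> {for x, continuous (weight f)}.
Proof.
move=> x0 cf; apply: (@continuousM _ _ (fun z => Num.max (f z) 0)); last exact: powR_continuous_pos.
by apply: (@continuous_max _ _ f (cst 0)) => //; exact: cst_continuous.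
Qed.

Let integral_weight (f g : R -> R) (r T : R) : 0 < r -> r <= T ->
  (forall x : R, 0 < x -> {for x, continuous f}) ->
  (forall x, 0 < x -> f (D / x) * (D / x) `^ (- 1 - 2 * a) * (D / x ^+ 2) = g x / D `^ a) ->
  measurable_fun [set: R] g ->
  (\int[mu]_(x in `[(D / T)%R, (D / r)%R]) (weight f x)%:E =
   (D `^ a)^-1%:E * \int[mu]_(x in `[r, T]) (Num.max (g x) 0)%:E)%E.
Proof.
move=> r0 rT cf fg mg.
rewrite integral_substV//; last by move=> x x0; apply: cweight => //; exact: cf.
rewrite -ge0_integralZl//; last 3 first.
- by apply/measurable_EFinP; apply: measurable_funTS; exact: measurable_maxr.
- by move=> x _; rewrite lee_fin le_max lexx orbT.
- by rewrite lee_fin invr_ge0 powR_ge0.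
apply: eq_integral => x; rewrite inE/= in_itv/= => /andP[rx _].
have x0 : 0 < x by exact: lt_le_trans rx.
rewrite -EFinM; congr EFin; rewrite /weight -mulrA.
have k0 : 0 <= (D / x) `^ (- 1 - 2 * a) * (D / x ^+ 2).
  by rewrite mulr_ge0 ?powR_ge0// divr_ge0 ?sqr_ge0// ltW.
have := fg x x0; rewrite -[X in X = _]mulrA => fgx.
rewrite maxr_pMl// mul0r fgx [_^-1 * _]mulrC maxr_pMl ?mul0r//.
by rewrite invr_ge0 powR_ge0.
Qed.

(** The function [x_+^a] is harmonic for the kernel [z^(-1-2a)]. Losses and gains
    are kept apart, as positive parts, because each side will be compared with a
    planar kernel of its own. The exhaustion of the ray by segments avoids
    subtracting infinite integrals. *)
Lemma linearized_balance :
  (\int[mu]_(z in `]0%R, +oo[) (Num.max (fall z - rise z) 0 * z `^ (- 1 - 2 * a))%:E <=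
   \int[mu]_(z in `]0%R, +oo[) (Num.max (rise z - fall z) 0 * z `^ (- 1 - 2 * a))%:E)%E.
Proof.
have mrise : measurable_fun [set: R] rise.
  by apply: measurable_funB => //; apply: measurable_fun_powR; exact: measurable_funD.
have mfall : measurable_fun [set: R] fall.
  by apply: measurable_funB => //; apply: measurable_fun_powR; apply: measurable_maxr => //; exact: measurable_funB.
have mw f : measurable_fun [set: R] f -> measurable_fun [set: R] (fun z => (weight f z)%:E).
  move=> mf; apply/measurable_EFinP; apply: measurable_funM; last exact: measurable_fun_powR.
  exact: measurable_maxr.
have w0 f z : (0 <= (weight f z)%:E)%E by rewrite lee_fin mulr_ge0 ?powR_ge0// le_max lexx orbT.
have mdu : measurable_fun [set: R] (fun z => fall z - rise z) by exact: measurable_funB.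
have mud : measurable_fun [set: R] (fun z => rise z - fall z) by exact: measurable_funB.
rewrite -/(weight (fun z => fall z - rise z)) -/(weight (fun z => rise z - fall z)).
pose I n := `[n.+1%:R^-1, n.+1%:R]%classic : set R.
have -> : (\int[mu]_(z in `]0%R, +oo[) (Num.max (fall z - rise z) 0 * z `^ (- 1 - 2 * a))%:E =
   \int[mu]_(z in \bigcup_n I n) (weight (fun z => fall z - rise z) z)%:E)%E.
  congr (integral _ _ _); apply/seteqP; split=> z/=.
    rewrite in_itv/= andbT => z0.
    have zm : Num.max z z^-1 < (Num.truncn (Num.max z z^-1)).+1%:R by exact: truncnS_gt.
    exists (Num.truncn (Num.max z z^-1)) => //; rewrite /I/= in_itv/=.
    move: zm; rewrite gt_max => /andP[h1 h2]; rewrite (ltW h1) andbT.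
    by rewrite -[leRHS]invrK lef_pV2 ?posrE ?invr_gt0 ?ltr0n// ltW.
  by case=> n _; rewrite /I/= !in_itv/= andbT => /andP[h _]; apply: lt_le_trans h; rewrite invr_gt0 ltr0n.
apply: integral_bigcup_le.
- by move=> n; exact: measurable_itv.
- move=> m n mn; rewrite subsetEset /I => z/=; rewrite !in_itv/= => /andP[h1 h2].
  rewrite (le_trans _ h1) ?(le_trans h2) ?ler_nat// lef_pV2 ?posrE ?ltr0n// ler_nat//.
- by apply: mw.
- by move=> z; apply: w0.
move=> n; apply/lee_addgt0Pr => e e0.
have Da0 : 0 < D `^ a by exact: powR_gt0.
(* [r] and [T] make the defect small and let the segment from [D / (1 + T)] to [D / r] cover [I n] *)
have [r0 [T0 [/andP[r0_gt0 rT0] small]]] := defect_small (mulr_gt0 e0 Da0).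
pose r := Num.min r0 (D / n.+1%:R).
pose T := Num.max T0 (D * n.+1%:R).
have r_gt0 : 0 < r by rewrite lt_min r0_gt0 divr_gt0.
have rT : r < T by rewrite lt_max gt_min rT0.
have := small r T; rewrite r_gt0 ge_min lexx/= le_max lexx/= => /(_ isT isT) {}small.
have rn : r <= D / n.+1%:R by rewrite ge_min lexx orbT.
have Tn : D * n.+1%:R <= T by rewrite le_max lexx orbT.
have sub : I n `<=` `[D / (1 + T), D / r]%classic.
  move=> z; rewrite /I/= !in_itv/= => /andP[h1 h2].
  have z0 : 0 < z by apply: lt_le_trans h1; rewrite invr_gt0 ltr0n.
  apply/andP; split.
    apply: le_trans h1; rewrite ler_pdivrMr; last by lra.
    rewrite -ler_pdivrMl ?invr_gt0 ?ltr0n// invrK mulrC; lra.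
  apply: (le_trans h2); rewrite ler_pdivlMr// mulrC -ler_pdivlMr ?ltr0n//.
apply: (@le_trans _ _ (\int[mu]_(x in `[(D / (1 + T))%R, (D / r)%R])
    (weight (fun z => fall z - rise z) x)%:E)%E).
  apply: ge0_subset_integral => //; first exact: measurable_itv.
  by apply: measurable_funTS; exact: mw.
have rT1 : r <= 1 + T by lra.
rewrite (@integral_weight _ (fun x => p x - q x) r (1 + T) r_gt0 rT1); last 3 first.
- by move=> x x0; apply: (@continuousB _ _ _ fall rise); [exact: cfall|exact: crise].
- by move=> x /subst_factor[hu hd]; rewrite [RHS]mulrBl -hu -hd; ring.
- exact: measurable_funB.
apply: (@le_trans _ _ ((D `^ a)^-1%:E * (\int[mu]_(x in `[r, (1 + T)%R]) (Num.max (q x - p x) 0)%:E + (defect r T)%:E))%E).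
  by rewrite lee_pmul2l ?lte_fin ?invr_gt0//; exact: positive_part_le.
rewrite ge0_muleDr; last 2 first.
- by apply: integral_ge0 => x _; rewrite lee_fin le_max lexx orbT.
- rewrite lee_fin /defect /S; apply: addr_ge0; apply: divr_ge0 => //;
    by rewrite ?sqr_ge0 ?mulr_ge0 ?powR_ge0 ?(ltW a_gt0).
have gainE : (\int[mu]_(x in `[(D / (1 + T))%R, (D / r)%R])
    (weight (fun z => rise z - fall z) x)%:E = (D `^ a)^-1%:E *
    \int[mu]_(x in `[r, (1 + T)%R]) (Num.max (q x - p x) 0)%:E)%E.
  apply: (@integral_weight _ (fun x => q x - p x) r (1 + T) r_gt0 rT1).
  - by move=> x x0; apply: (@continuousB _ _ _ rise fall); [exact: crise|exact: cfall].
  - by move=> x /subst_factor[hu hd]; rewrite [RHS]mulrBl -hu -hd; ring.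
  - exact: measurable_funB.
rewrite -gainE.
apply: leeD.
  apply: ge0_subset_integral => //; first by apply: measurable_funTS; exact: mw.
  move=> z/=; rewrite !in_itv/= andbT => /andP[h _]; apply: lt_le_trans h.
  by rewrite divr_gt0//; lra.
by rewrite -EFinM lee_fin mulrC ler_pdivrMr.
Qed.

End linearized.

(** * Convex functions with Lipschitz derivative *)

Lemma C11_fun_of_quadratic (R : realType) (f f' : R -> R) (L : R) :
  (forall x y, `|f y - f x - f' x * (y - x)| <= L * (y - x) ^+ 2) ->
  (forall x y, `|f' x - f' y| <= L * `|x - y|) -> C11_fun f.
Proof.
move=> hf hl.
have key (x : R) : h^-1 *: (f (h *: (1 : R) + x) - f x) @[h --> (0 : R)^'] --> f' x.
  apply/cvgrPdist_le => e e0; near=> h.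
  have h0 : h != 0 by near: h; exact: nbhs_dnbhs_neq.
  have := hf x (h *: (1 : R) + x); rewrite /GRing.scale/= mulr1 addrK => hh.
  have -> : f' x - h^-1 * (f (h + x) - f x) = - (h^-1 * (f (h + x) - f x - f' x * h)).
    by field.
  rewrite normrN normrM normfV.
  rewrite ler_pdivrMl ?normr_gt0//; apply: (le_trans hh).
  have -> : h ^+ 2 = `|h| * `|h| by rewrite -normrM ger0_norm ?sqr_ge0// expr2.
  rewrite mulrCA ler_wpM2l//.
  apply: (@le_trans _ _ ((`|L| + 1) * `|h|)).
    by rewrite ler_wpM2r// (le_trans (ler_norm _))// lerDl.
  rewrite -ler_pdivlMl ?ltr_wpDl//.
  apply/ltW; near: h; apply: dnbhs0_lt.
  by rewrite mulr_gt0// invr_gt0 ltr_wpDl.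
have df (x : R) : derivable f x 1 by apply/cvg_ex; exists (f' x); exact: key.
have d1 (x : R) : derive1 f x = f' x by rewrite derive1E /derive; apply: (cvg_lim _ (key x)).
have PF : ProperFilter (globally ([set: R] `*` [set: R])).
  by apply: (@globally_properfilter _ _ (0, 0)).
split=> //; apply: (@klipschitzW _ _ _ L) => -[x y] _ /=.
by rewrite !d1.
Unshelve. all: by end_near. Qed.

(** Carrying the derivative and its Lipschitz constant explicitly makes sums and
    compositions stable without any derivability condition. *)
Definition convexC11 (R : realType) (f f' : R -> R) (L : R) :=
  (forall x y, f x + f' x * (y - x) <= f y) /\
  (forall x y, `|f' x - f' y| <= L * `|x - y|).

Section convexC11.
Context (R : realType).
Implicit Types f g : R -> R.

(** The constant is [L] and not [L / 2] because the proof compares the tangents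
    at [x] and [y] instead of integrating the derivative. *)
Lemma convexC11_upper f f' L x y : convexC11 f f' L ->
  f y <= f x + f' x * (y - x) + L * (y - x) ^+ 2.
Proof.
move=> [ht hl]; have h1 := ht y x.
have : (f' y - f' x) * (y - x) <= L * (y - x) ^+ 2.
  apply: le_trans (ler_norm _) _; rewrite normrM.
  have -> : (y - x) ^+ 2 = `|y - x| * `|y - x| by rewrite -normrM ger0_norm ?sqr_ge0// expr2.
  by rewrite mulrA; apply: ler_wpM2r.
lra.
Qed.

(** The lower bound keeps the gain away from the centre of symmetry, the upper
    bound measures the slices of the loss. *)
Lemma convexC11_midpoint f f' L x h : convexC11 f f' L ->
  0 <= f (x + h) + f (x - h) - 2 * f x <= 2 * L * h ^+ 2.
Proof.
move=> hf; have [ht _] := hf.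
have h1 := ht x (x + h); have h2 := ht x (x - h).
have h3 := convexC11_upper x (x + h) hf; have h4 := convexC11_upper x (x - h) hf.
have e1 : x + h - x = h by lra.
have e2 : x - h - x = - h by lra.
rewrite e1 in h1 h3; rewrite e2 ?sqrrN in h2 h4; apply/andP; split; lra.
Qed.

Lemma convexC11_C11 f f' L k a e c : convexC11 f f' L -> `|e| = 1 ->
  C11_fun (fun t => k * f (a + e * t) + c).
Proof.
move=> hf he.
have [ht hl] := hf.
have e2 : e ^+ 2 = 1 by rewrite -[e ^+ 2]ger0_norm ?sqr_ge0// normrX he expr1n.
apply: (@C11_fun_of_quadratic _ _ (fun t => k * (e * f' (a + e * t))) (`|k| * L)).
  move=> x y.
  rewrite (_ : _ - _ - _ = k * (f (a + e * y) - f (a + e * x) - f' (a + e * x) * (e * (y - x)))); last by ring.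
  rewrite normrM -mulrA; apply: ler_wpM2l => //.
  have := ht (a + e * x) (a + e * y); have := convexC11_upper (a + e * x) (a + e * y) hf.
  rewrite (_ : a + e * y - (a + e * x) = e * (y - x)); last by ring.
  by rewrite exprMn e2 mul1r ler_norml => h1 h2; lra.
move=> x y; rewrite -mulrBr normrM -mulrA; apply: ler_wpM2l => //.
rewrite -mulrBr normrM he mul1r; apply: le_trans (hl _ _) _.
rewrite (_ : a + e * x - (a + e * y) = e * (x - y)); last by ring.
by rewrite normrM he mul1r.
Qed.

Lemma convexC11D f f' L g g' M : convexC11 f f' L -> convexC11 g g' M ->
  convexC11 (fun x => f x + g x) (fun x => f' x + g' x) (L + M).
Proof.
move=> [h1 h2] [h3 h4]; split=> x y; first by have := h1 x y; have := h3 x y; lra.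
rewrite (_ : _ - _ = (f' x - f' y) + (g' x - g' y)); last by lra.
by apply: le_trans (ler_normD _ _) _; rewrite mulrDl lerD.
Qed.

Lemma convexC11_scale f f' L k e : convexC11 f f' L -> 0 <= k -> 0 <= e ->
  convexC11 (fun x => k * f (e * x)) (fun x => k * e * f' (e * x)) (k * e ^+ 2 * L).
Proof.
move=> [h1 h2] k0 e0; split=> x y.
  have := ler_wpM2l k0 (h1 (e * x) (e * y)).
  rewrite -mulrBr; move/(le_trans _); apply; lra.
rewrite -mulrBr normrM ger0_norm ?mulr_ge0// -!mulrA; apply: ler_wpM2l => //.
apply: ler_wpM2l => //.
apply: le_trans (h2 _ _) _; rewrite -mulrBr normrM (ger0_norm e0).
lra.
Qed.

Lemma convexC11_affine (p q : R) : convexC11 (fun x => p * x + q) (fun=> p) 0.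
Proof. by split=> x y; [lra|rewrite subrr normr0 mul0r]. Qed.

Lemma concaveC11_comp (u u' g g' : R -> R) (L M B : R) :
  convexC11 (fun x => - u x) (fun x => - u' x) L ->
  convexC11 (fun x => - g x) (fun x => - g' x) M ->
  0 <= L -> 0 <= M ->
  (forall x, 0 <= u' x <= B) -> (forall x, `|g' x| <= 1) ->
  convexC11 (fun x => - u (g x)) (fun x => - (u' (g x) * g' x)) (L + B * M).
Proof.
move=> [u1 u2] [g1 g2] L0 M0 uB gB; split=> x y.
  have h1 := u1 (g x) (g y); have h2 := g1 x y.
  have /andP[h3 _] := uB (g x).
  have : u' (g x) * (g y - g x) <= u' (g x) * (g' x * (y - x)) by apply: ler_wpM2l => //; lra.
  lra.
rewrite (_ : _ - _ = (u' (g y) - u' (g x)) * g' x + u' (g y) * (g' y - g' x)); last by ring.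
apply: le_trans (ler_normD _ _) _; rewrite !normrM mulrDl; apply: lerD.
  have gl : `|g x - g y| <= `|x - y|.
    have bnd (v w : R) : g w - g v <= `|v - w|.
      have := g1 v w => h; apply: (@le_trans _ _ (g' v * (w - v))); first by lra.
      by apply: le_trans (ler_norm _) _; rewrite normrM distrC ler_piMl.
    by rewrite ler_norml; have := bnd x y; have := bnd y x; rewrite [`|y - x|]distrC; lra.
  apply: (@le_trans _ _ (L * `|x - y| * 1)); last by rewrite mulr1.
  apply: ler_pM => //; have := u2 (g x) (g y).
  rewrite (_ : - u' (g x) - - u' (g y) = u' (g y) - u' (g x)); last by ring.
  by move/le_trans; apply; apply: ler_wpM2l.
have /andP[h3 h4] := uB (g y).
rewrite (ger0_norm h3) -mulrA; apply: ler_pM => //.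
by have := g2 x y; rewrite (_ : - g' x - - g' y = g' y - g' x); last by ring.
Qed.

End convexC11.

(** * Powers with a linear continuation and a smooth positive part *)

Section tangent_power.
Context (R : realType) (c a : R).
Hypothesis c_gt0 : 0 < c.

(** The power [x^a] for [c <= x], continued by its tangent at [c]. The maximum
    and the minimum stand for the case distinction. *)
Definition tpow (x : R) := Num.max x c `^ a + a * c `^ (a - 1) * Num.min (x - c) 0.
Definition tpow' (x : R) := a * Num.max x c `^ (a - 1).

Lemma tpow_ge x : c <= x -> tpow x = x `^ a.
Proof. by move=> cx; rewrite /tpow max_l// min_r ?subr_ge0// mulr0 addr0. Qed.

Lemma tpow_le x : x <= c -> tpow x = c `^ a + a * c `^ (a - 1) * (x - c).
Proof. by move=> cx; rewrite /tpow max_r// min_l ?subr_le0. Qed.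

Let trunc_spec (x : R) : [/\ c <= Num.max x c, Num.min (x - c) 0 <= 0,
  x - c = (Num.max x c - c) + Num.min (x - c) 0 &
  Num.max x c = c \/ Num.min (x - c) 0 = 0].
Proof.
have [h|/ltW h] := leP x c.
  by rewrite min_l ?subr_le0// ?max_r//; split; [|lra|lra|left].
by rewrite min_r ?subr_ge0// ?max_l//; split; [lra| |lra|right].
Qed.

Let max_dist (x y : R) : `|Num.max x c - Num.max y c| <= `|x - y|.
Proof.
have h1 := ler_norm (x - y); have h2 := ler_norm (y - x); rewrite distrC in h2.
have h3 := normr_ge0 (x - y).
by have [hx|hx] := leP x c; have [hy|hy] := leP y c;
  rewrite ler_norml ?subrr; apply/andP; split; lra.
Qed.

Lemma tpow_convexC11 : 1 < a < 2 ->
  convexC11 tpow tpow' (a * (a - 1) * c `^ (a - 1 - 1)).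
Proof.
move=> /andP[a1 a2]; split=> x y.
  have [cX mX eX dX] := trunc_spec x; have [cY mY eY dY] := trunc_spec y.
  rewrite /tpow /tpow'.
  have X0 : 0 < Num.max x c by exact: lt_le_trans cX.
  have Y0 : 0 < Num.max y c by exact: lt_le_trans cY.
  have tang := powR_ge_tangent a1 X0 (ltW Y0).
  have mono : c `^ (a - 1) <= Num.max x c `^ (a - 1).
    by rewrite ge0_ler_powR ?nnegrE ?(ltW c_gt0) ?(ltW X0)//; lra.
  have -> : y - x = (Num.max y c - Num.max x c) + (Num.min (y - c) 0 - Num.min (x - c) 0) by lra.
  suff : a * (Num.max x c `^ (a - 1) - c `^ (a - 1)) * (Num.min (y - c) 0 - Num.min (x - c) 0) <= 0 by lra.
  case: dX => dX; first by rewrite dX subrr mulr0 mul0r.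
  by rewrite dX subr0 mulr_ge0_le0// mulr_ge0//; lra.
rewrite /tpow' -mulrBr normrM (@ger0_norm _ a); last by lra.
rewrite -!mulrA; apply: ler_wpM2l; first by lra.
have [cX _ _ _] := trunc_spec x; have [cY _ _ _] := trunc_spec y.
apply: (@le_trans _ _ ((a - 1) * (c `^ (a - 1 - 1) * `|Num.max x c - Num.max y c|))); last first.
  apply: ler_wpM2l; first by lra.
  by apply: ler_wpM2l; rewrite ?powR_ge0.
have key (X Y : R) : c <= X -> X <= Y ->
    `|X `^ (a - 1) - Y `^ (a - 1)| <= (a - 1) * (c `^ (a - 1 - 1) * `|X - Y|).
  move=> cX' XY; have X0 : 0 < X by exact: lt_le_trans cX'.
  have Y0 : 0 <= Y by lra.
  have mono : X `^ (a - 1) <= Y `^ (a - 1).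
    by rewrite ge0_ler_powR ?nnegrE ?(ltW X0)//; lra.
  have a01 : 0 < a - 1 < 1 by apply/andP; split; lra.
  have tang := powR_le_tangent a01 X0 Y0.
  rewrite distrC ger0_norm ?subr_ge0// distrC ger0_norm ?subr_ge0//.
  apply: (@le_trans _ _ ((a - 1) * X `^ (a - 1 - 1) * (Y - X))); first by lra.
  rewrite -mulrA; apply: ler_wpM2l; first by lra.
  apply: ler_wpM2r; first by lra.
  rewrite -[a - 1 - 1]opprK !(powRN _ (- _)) lef_pV2 ?posrE ?powR_gt0//.
  by rewrite ge0_ler_powR ?nnegrE ?(ltW c_gt0) ?(ltW X0)//; lra.
have [XY|/ltW XY] := leP (Num.max x c) (Num.max y c); first exact: key.
by rewrite distrC [`|Num.max x c - _|]distrC; exact: key.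
Qed.

Lemma tpow_concaveC11 : 0 < a < 1 ->
  convexC11 (fun x => - tpow x) (fun x => - tpow' x) (a * ((1 - a) / (c * c `^ (1 - a)))).
Proof.
move=> /andP[a0 a1]; split=> x y.
  have [cX mX eX dX] := trunc_spec x; have [cY mY eY dY] := trunc_spec y.
  rewrite /tpow /tpow'.
  have X0 : 0 < Num.max x c by exact: lt_le_trans cX.
  have Y0 : 0 < Num.max y c by exact: lt_le_trans cY.
  have tang := @powR_le_tangent _ a (Num.max y c) _ (introT andP (conj a0 a1)) X0 (ltW Y0).
  have mono : Num.max x c `^ (a - 1) <= c `^ (a - 1).
    rewrite -[a - 1]opprB !(powRN _ (1 - a)) lef_pV2 ?posrE ?powR_gt0//.
    by rewrite ge0_ler_powR ?nnegrE ?(ltW c_gt0) ?(ltW X0)//; lra.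
  have -> : y - x = (Num.max y c - Num.max x c) + (Num.min (y - c) 0 - Num.min (x - c) 0) by lra.
  suff : a * (c `^ (a - 1) - Num.max x c `^ (a - 1)) * (Num.min (y - c) 0 - Num.min (x - c) 0) <= 0 by lra.
  case: dX => dX; first by rewrite dX subrr mulr0 mul0r.
  by rewrite dX subr0 mulr_ge0_le0// mulr_ge0//; lra.
rewrite /tpow' (_ : _ - _ = - (a * (Num.max x c `^ (a - 1) - Num.max y c `^ (a - 1)))); last by ring.
rewrite normrN normrM (@ger0_norm _ a); last by lra.
rewrite -[leRHS]mulrA; apply: ler_wpM2l; first by lra.
have [cX _ _ _] := trunc_spec x; have [cY _ _ _] := trunc_spec y.
have K0 : 0 <= (1 - a) / (c * c `^ (1 - a)).
  by rewrite divr_ge0 ?mulr_ge0 ?powR_ge0 ?(ltW c_gt0)//; lra.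
apply: (@le_trans _ _ ((1 - a) / (c * c `^ (1 - a)) * `|Num.max x c - Num.max y c|)); last first.
  exact: ler_wpM2l.
have key (X Y : R) : c <= X -> X <= Y ->
    `|X `^ (a - 1) - Y `^ (a - 1)| <= (1 - a) / (c * c `^ (1 - a)) * `|X - Y|.
  move=> cX' XY; have X0 : 0 < X by exact: lt_le_trans cX'.
  have Y0 : 0 < Y by exact: lt_le_trans XY.
  have a01 : 0 < 1 - a < 1 by apply/andP; split; lra.
  have tang := powR_le_tangent a01 X0 (ltW Y0).
  have mono : X `^ (1 - a) <= Y `^ (1 - a).
    by rewrite ge0_ler_powR ?nnegrE ?(ltW X0) ?(ltW Y0)//; lra.
  have cXp : c `^ (1 - a) <= X `^ (1 - a).
    by rewrite ge0_ler_powR ?nnegrE ?(ltW X0) ?(ltW c_gt0)//; lra.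
  have XE : X `^ (1 - a) = X * X `^ (1 - a - 1).
    by rewrite -{2}[X]powRr1 ?(ltW X0)// -powRD ?subrKC// (gt_eqF X0) implybT.
  rewrite -[a - 1]opprB !(powRN _ (1 - a)).
  have Xp : 0 < X `^ (1 - a) by exact: powR_gt0.
  have Yp : 0 < Y `^ (1 - a) by exact: powR_gt0.
  have cp : 0 < c `^ (1 - a) by exact: powR_gt0.
  have P'0 : 0 < X `^ (1 - a - 1) by exact: powR_gt0.
  rewrite [`|X - Y|]distrC [`|Y - X|]ger0_norm ?subr_ge0//.
  rewrite ger0_norm ?subr_ge0 ?lef_pV2//.
  move: tang mono cXp XE Xp Yp cp P'0.
  set P := X `^ (1 - a); set Q := Y `^ (1 - a); set C := c `^ (1 - a); set P' := X `^ (1 - a - 1).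
  move=> tang mono cXp XE Xp Yp cp P'0.
  have -> : P^-1 - Q^-1 = (Q - P) / (P * Q) by field; rewrite !gt_eqF.
  apply: (@le_trans _ _ (((1 - a) * P' * (Y - X)) / (P * Q))).
    by rewrite ler_pM2r ?invr_gt0 ?mulr_gt0//; lra.
  have -> : (1 - a) * P' * (Y - X) / (P * Q) = ((1 - a) * (Y - X)) / (X * Q).
    by rewrite XE; field; rewrite !gt_eqF.
  have -> : (1 - a) / (c * C) * (Y - X) = ((1 - a) * (Y - X)) / (c * C) by field; rewrite !gt_eqF.
  apply: ler_wpM2l; first by rewrite mulr_ge0//; lra.
  by rewrite lef_pV2 ?posrE ?mulr_gt0//; apply: ler_pM; rewrite ?(ltW c_gt0) ?(ltW cp)//; lra.
have [XY|/ltW XY] := leP (Num.max x c) (Num.max y c); first exact: key.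
by rewrite distrC [`|Num.max x c - _|]distrC; exact: key.
Qed.

Lemma tpow'_bound : 0 < a < 1 -> forall x, 0 <= tpow' x <= a * c `^ (a - 1).
Proof.
move=> /andP[a0 a1] x; have [cX _ _ _] := trunc_spec x.
have X0 : 0 < Num.max x c by exact: lt_le_trans cX.
rewrite mulr_ge0 ?powR_ge0 ?(ltW a0)//= /tpow'; apply: ler_wpM2l; first exact: ltW.
rewrite -[a - 1]opprB !(powRN _ (1 - a)) lef_pV2 ?posrE ?powR_gt0//.
by rewrite ge0_ler_powR ?nnegrE ?(ltW c_gt0) ?(ltW X0)//; lra.
Qed.

End tangent_power.

Section ramp.
Context (R : realType) (u v : R).
Hypothesis uv : u < v.

(** A smooth positive part: it vanishes before [u] and has slope [1] after [v]. *)
Definition ramp (y : R) := (Num.max (y - u) 0 ^+ 2 - Num.max (y - v) 0 ^+ 2) / (2 * (v - u)).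
Definition ramp' (y : R) := (Num.max (y - u) 0 - Num.max (y - v) 0) / (v - u).

Let max0E (x : R) : (x <= 0 /\ Num.max x 0 = 0) \/ (0 <= x /\ Num.max x 0 = x).
Proof. by have [h|/ltW h] := leP x 0; [left|right]. Qed.

Lemma ramp_convexC11 : convexC11 ramp ramp' (v - u)^-1.
Proof.
have w0 : 0 < v - u by rewrite subr_gt0.
split=> x y.
  rewrite /ramp /ramp'.
  set xu := Num.max (x - u) 0; set xv := Num.max (x - v) 0.
  set yu := Num.max (y - u) 0; set yv := Num.max (y - v) 0.
  have -> : (xu ^+ 2 - xv ^+ 2) / (2 * (v - u)) + (xu - xv) / (v - u) * (y - x) =
    (xu ^+ 2 - xv ^+ 2 + 2 * (xu - xv) * (y - x)) / (2 * (v - u)).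
    by field; rewrite gt_eqF.
  rewrite ler_pM2r ?invr_gt0 ?mulr_gt0//.
  have q1 := sqr_ge0 (y - x); have q2 := sqr_ge0 (v - y).
  have [[a1 a2]|[a1 a2]] := max0E (x - u); have [[b1 b2]|[b1 b2]] := max0E (x - v);
  have [[c1 c2]|[c1 c2]] := max0E (y - u); have [[d1 d2]|[d1 d2]] := max0E (y - v);
  rewrite /xu /xv /yu /yv a2 b2 c2 d2; clear a2 b2 c2 d2 xu xv yu yv; nra.
rewrite /ramp' -mulrBl normrM normfV (@gtr0_norm _ (v - u))// mulrC.
apply: ler_wpM2l; first by rewrite invr_ge0 ltW.
have h1 := ler_norm (x - y); have h2 := ler_norm (y - x); rewrite distrC in h2.
have h3 := normr_ge0 (x - y).
rewrite ler_norml.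
have [[a1 a2]|[a1 a2]] := max0E (x - u); have [[b1 b2]|[b1 b2]] := max0E (x - v);
  have [[c1 c2]|[c1 c2]] := max0E (y - u); have [[d1 d2]|[d1 d2]] := max0E (y - v);
  rewrite a2 b2 c2 d2; apply/andP; split; lra.
Qed.

Lemma ramp_le y : y <= u -> ramp y = 0.
Proof. by move=> yu; rewrite /ramp !max_r ?subr_le0 ?(le_trans yu (ltW uv))// subrr mul0r. Qed.

Lemma ramp_mid y : u <= y <= v -> ramp y = (y - u) ^+ 2 / (2 * (v - u)).
Proof.
by move=> /andP[uy yv]; rewrite /ramp max_l ?subr_ge0// max_r ?subr_le0// expr0n/= subr0.
Qed.

Lemma ramp_ge y : v <= y -> ramp y = y - (u + v) / 2.
Proof.
move=> vy; rewrite /ramp !max_l ?subr_ge0// ?(le_trans (ltW uv))//.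
by field; rewrite gt_eqF// subr_gt0.
Qed.

End ramp.

(** * The cap and the wall profile *)

Section cap.
Context (R : realType).
Implicit Types x : R.

(** The function [1 - |x|], with a parabola tangent to it at [-1/2] and [1/2]
    replacing the kink. *)
Definition cap x := 3 / 4 - x ^+ 2 + Num.max (x - 1 / 2) 0 ^+ 2 + Num.max (- x - 1 / 2) 0 ^+ 2.
Definition cap' x := - 2 * x + 2 * Num.max (x - 1 / 2) 0 - 2 * Num.max (- x - 1 / 2) 0.

Let capE x : [\/ 1 / 2 <= x /\ (cap x = 1 - x /\ cap' x = - 1),
  x <= - (1 / 2) /\ (cap x = 1 + x /\ cap' x = 1) |
  - (1 / 2) <= x <= 1 / 2 /\ (cap x = 3 / 4 - x ^+ 2 /\ cap' x = - 2 * x)].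
Proof.
have [h|h] := leP (1 / 2) x.
  by apply: Or31; rewrite /cap /cap' max_l ?max_r; [split; [|split]; lra|lra|lra].
have [h'|h'] := leP x (- (1 / 2)).
  by apply: Or32; rewrite /cap /cap' max_r ?max_l; [split; [|split]; lra|lra|lra].
apply: Or33; rewrite /cap /cap' !max_r; [|lra|lra].
by rewrite (ltW h) (ltW h') expr0n/= !addr0 mulr0 addr0 subr0.
Qed.

Lemma cap_convexC11 : convexC11 (fun x => - cap x) (fun x => - cap' x) 2.
Proof.
split=> x y.
  have q1 := sqr_ge0 (y - x).
  have [[h1 [-> ->]]|[h1 [-> ->]]|[/andP[h1 h1'] [-> ->]]] := capE x;
  have [[h2 [-> _]]|[h2 [-> _]]|[/andP[h2 h2'] [-> _]]] := capE y; nra.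
have h1 := ler_norm (x - y); have h2 := ler_norm (y - x); rewrite distrC in h2.
have h3 := normr_ge0 (x - y).
rewrite ler_norml.
have [[h4 [_ ->]]|[h4 [_ ->]]|[/andP[h4 h4'] [_ ->]]] := capE x;
  have [[h5 [_ ->]]|[h5 [_ ->]]|[/andP[h5 h5'] [_ ->]]] := capE y; apply/andP; split; lra.
Qed.

Lemma cap'_bound x : `|cap' x| <= 1.
Proof.
by rewrite ler_norml; have [[h4 [_ ->]]|[h4 [_ ->]]|[/andP[h4 h4'] [_ ->]]] := capE x; lra.
Qed.

Lemma cap_even x : cap (- x) = cap x.
Proof. by rewrite /cap sqrrN opprK addrAC. Qed.

Lemma cap_right x : 1 / 2 <= x -> cap x = 1 - x.
Proof. by move=> h; rewrite /cap max_l ?max_r; lra. Qed.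

Lemma cap_out x : 1 / 2 <= `|x| -> cap x = 1 - `|x|.
Proof.
move=> h; rewrite -cap_right//; have [x0|x0] := leP 0 x; first by rewrite ger0_norm.
by rewrite ltr0_norm// cap_even.
Qed.

Lemma cap_le x : cap x <= 3 / 4.
Proof.
by have [[h4 [-> _]]|[h4 [-> _]]|[/andP[h4 h4'] [-> _]]] := capE x; [lra|lra|nra].
Qed.

Lemma cap_in x : `|x| <= 1 / 2 -> 1 / 2 <= cap x.
Proof.
by rewrite ler_norml; have [[h4 [-> _]]|[h4 [-> _]]|[/andP[h4 h4'] [-> _]]] := capE x;
  move=> /andP[h1 h2]; nra.
Qed.

Lemma cap_gt x c : c < 1 / 2 -> (c < cap x) = (`|x| < 1 - c).
Proof.
move=> c2; have [h|h] := leP `|x| (1 / 2).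
  by rewrite (lt_le_trans c2 (cap_in h)); apply/esym; lra.
by rewrite cap_out ?(ltW h)//; apply/idP/idP; lra.
Qed.

Lemma cap_continuous : continuous cap.
Proof.
move=> x; apply/differentiable_continuous/derivable1_diffP.
have [h _] := convexC11_C11 (-1) 0 0 cap_convexC11 (normr1 R).
rewrite (_ : cap = fun t => -1 * - cap (0 + 1 * t) + 0); first exact: h.
by apply/funext => t; rewrite mulN1r opprK add0r mul1r addr0.
Qed.

End cap.

Section profile.
Context (R : realType) (a : R).
Hypothesis a_range : 1 / 2 < a < 1.

Let l := a * (1 - a) ^+ 2 / 4.
Definition profile_flat := 1 - a - l.
Let v := 1 - a + l.

(** The tangent at [1] of [a y^(1/a)] is [y - (1 - a)], which vanishes at [1 - a].
    The second summand is the excess of the power over this tangent, and is zero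
    below [1]; the ramp, centred at [1 - a], is the positive part of the tangent. *)
Definition profile (y : R) :=
  ramp profile_flat v y + (a * tpow 1 a^-1 (1 * y) + (-1 * y + (1 - a))).
Definition profile' (y : R) :=
  ramp' profile_flat v y + (a * 1 * tpow' 1 a^-1 (1 * y) + - 1).
Definition profile_lip :=
  (v - profile_flat)^-1 + (a * 1 ^+ 2 * (a^-1 * (a^-1 - 1) * 1 `^ (a^-1 - 1 - 1)) + 0).

Let a0 : 0 < a. Proof. by case/andP: a_range; lra. Qed.
Let a1 : a < 1. Proof. by case/andP: a_range. Qed.
Let l0 : 0 < l. Proof. by rewrite /l divr_gt0// mulr_gt0// exprn_gt0// subr_gt0. Qed.
Let uv : profile_flat < v. Proof. by rewrite /profile_flat /v; move: l0; lra. Qed.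
Let ll : l <= (1 - a) / 8.
Proof.
rewrite /l expr2; have h1 : a * (1 - a) <= 1 / 2 by have := a1; have := a0; nra.
have h2 : 0 <= 1 - a by have := a1; lra.
nra.
Qed.
Let b_range : 1 < a^-1 < 2.
Proof.
case/andP: a_range => h1 h2; rewrite invf_gt1// h2/=.
by rewrite -[ltRHS]invrK ltf_pV2 ?posrE//; lra.
Qed.

Lemma profile_flat_lb : (1 - a) / 2 < profile_flat.
Proof. by rewrite /profile_flat; move: ll a1; lra. Qed.

Lemma profile_lip_gt0 : 0 < profile_lip.
Proof.
rewrite /profile_lip addr0 powR1 expr1n !mulr1 mulrA mulfV ?gt_eqF// mul1r.
apply: addr_gt0; first by rewrite invr_gt0 subr_gt0.
by case/andP: b_range; lra.
Qed.

Lemma profile_convexC11 : convexC11 profile profile' profile_lip.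
Proof.
apply: convexC11D; first exact: ramp_convexC11.
apply: convexC11D; last exact: convexC11_affine.
apply: convexC11_scale; [|exact: ltW|exact: ler01].
exact: tpow_convexC11.
Qed.

Let aV : a * a^-1 = 1. Proof. by rewrite mulfV// gt_eqF. Qed.

Let tpow_part (y : R) : y <= 1 -> a * tpow 1 a^-1 (1 * y) + (-1 * y + (1 - a)) = 0.
Proof.
move=> y1; rewrite mul1r tpow_le// powR1 !mulr1 mulrDr mulrA aV; lra.
Qed.

Lemma profile_low (y : R) : y <= profile_flat -> profile y = 0.
Proof.
move=> yu; rewrite /profile ramp_le// add0r tpow_part//.
by move: yu uv ll a0; rewrite /v /profile_flat; lra.
Qed.

Lemma profile'0 : profile' 0 = 0.
Proof.
rewrite /profile' /ramp' !max_r; last 2 first.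
- by have := profile_flat_lb; move: a1 uv; lra.
- by have := profile_flat_lb; move: a1 uv; lra.
rewrite subrr mul0r add0r /tpow' mulr0 max_r// powR1 !mulr1 aV; lra.
Qed.

Lemma profile_high (y : R) : 1 <= y -> profile y = a * y `^ a^-1.
Proof.
move=> y1; rewrite /profile mul1r tpow_ge// ramp_ge//.
  by rewrite /v /profile_flat; lra.
by apply: le_trans y1; case/andP: a_range; move: ll; rewrite /v; lra.
Qed.

Lemma profile_ge0 (y : R) : 0 <= profile y.
Proof.
have [h _] := profile_convexC11.
have := h 0 y; rewrite profile'0 mul0r addr0 profile_low//.
by have := profile_flat_lb; move: a1; lra.
Qed.

(** On the ramp, [l] is so small that rounding the kink at [1 - a] does not reach
    the power; elsewhere the profile is zero, a tangent, or the power itself. *)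
Lemma profile_le (y : R) : 0 <= y -> profile y <= a * y `^ a^-1.
Proof.
move=> y0; have [y1|/ltW y1] := leP 1 y; first by rewrite profile_high.
have [yu|/ltW yu] := leP y profile_flat.
  by rewrite profile_low// mulr_ge0 ?powR_ge0// ltW.
rewrite /profile tpow_part// addr0.
have [yv|/ltW yv] := leP v y.
  rewrite ramp_ge//; have /andP[b1 _] := b_range.
  have := powR_ge_tangent b1 ltr01 y0; rewrite !powR1 mulr1.
  have := ler_wpM2l (ltW a0) => H /H; rewrite mulrDr mulrA aV /v /profile_flat; lra.
rewrite ramp_mid ?yu//.
have u0 := profile_flat_lb.
have half0 : 0 < (1 - a) / 2 by move: a1; lra.
have yh : (1 - a) / 2 <= y by lra.
apply: (@le_trans _ _ (a * ((1 - a) / 2) ^+ 2)).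
  apply: (@le_trans _ _ l); last by rewrite /l; lra.
  have -> : 2 * (v - profile_flat) = 4 * l by rewrite /v /profile_flat; lra.
  rewrite ler_pdivrMr; last by move: l0; lra.
  have : 0 <= y - profile_flat <= 2 * l.
    by rewrite subr_ge0 yu/=; move: yv; rewrite /v /profile_flat; lra.
  by move=> /andP[]; set w := y - profile_flat; move: l0; nra.
apply: ler_wpM2l; first exact: ltW.
apply: (@le_trans _ _ (y ^+ 2)).
  by rewrite ler_pXn2r ?nnegrE// ltW.
rewrite -powR_mulrn//; apply: ger_powR; first by rewrite y1 andbT; lra.
by case/andP: b_range => _ /ltW.
Qed.

End profile.

(** * Gain and loss of the barrier *)

Section folded_sets.
Context (R : realType) (E : set (R * R)) (x0 y0 : R).

Definition gain : set (R * R) :=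
  [set u | [/\ 0 < u.1, E (x0 - u.1, y0 + u.2) & E (x0 + u.1, y0 - u.2)]].
Definition loss : set (R * R) :=
  [set u | [/\ 0 < u.1, ~ E (x0 - u.1, y0 + u.2) & ~ E (x0 + u.1, y0 - u.2)]].

Hypothesis mE : measurable E.

Let m1 : measurable [set u : R * R | E (x0 - u.1, y0 + u.2)].
Proof.
have h : measurable_fun [set: R * R] (fun u : R * R => (x0 - u.1, y0 + u.2)).
  by apply: eq_measurable_fun (@measurable_affine2 R x0 y0 (-1) 1) => u _; rewrite mul1r mulN1r.
by rewrite -[X in measurable X]setTI; exact: h.
Qed.

Let m2 : measurable [set u : R * R | E (x0 + u.1, y0 - u.2)].
Proof.
have h : measurable_fun [set: R * R] (fun u : R * R => (x0 + u.1, y0 - u.2)).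
  by apply: eq_measurable_fun (@measurable_affine2 R x0 y0 1 (-1)) => u _; rewrite mul1r mulN1r.
by rewrite -[X in measurable X]setTI; exact: h.
Qed.

Lemma measurable_gain : measurable gain.
Proof.
rewrite (_ : gain = [set u : R * R | 0 < u.1] `&` ([set u : R * R | E (x0 - u.1, y0 + u.2)] `&`
  [set u : R * R | E (x0 + u.1, y0 - u.2)])); last first.
  by apply/seteqP; split=> u/= [] // ? [].
by apply: measurableI; [exact: measurable_half|exact: measurableI].
Qed.

Lemma measurable_loss : measurable loss.
Proof.
rewrite (_ : loss = [set u : R * R | 0 < u.1] `&` (~` [set u : R * R | E (x0 - u.1, y0 + u.2)] `&`
  ~` [set u : R * R | E (x0 + u.1, y0 - u.2)])); last first.
  by apply/seteqP; split=> u/= [] // ? [].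
by apply: measurableI; [exact: measurable_half|apply: measurableI; exact: measurableC].
Qed.

End folded_sets.

Section kernel_bounds.
Context (R : realType) (s : R).
Hypothesis s_gt0 : 0 < s.
Notation a := (1 / 2 + s).

Let quadratic_form (A z : R) : 0 < z ->
  ((1 + A ^+ 2) * z ^+ 2) `^ (1 + s) = (1 + A ^+ 2) `^ (1 + s) * (z `^ (- 1 - 2 * a))^-1.
Proof.
move=> z0; have A0 : 0 <= 1 + A ^+ 2 by rewrite addr_ge0 ?sqr_ge0.
rewrite powRM ?sqr_ge0//; congr (_ * _).
rewrite -(powR_mulrn 2 (ltW z0)) -powRrM -powRN; congr (_ `^ _); lra.
Qed.

(** The kernel on the line [w = A z] is [slope_weight A * z^(-2-2s)]. Below, the
    exponent [-2-2s] is written [-1-2a], as in [linearized_balance]. *)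
Definition slope_weight (A : R) := ((1 + A ^+ 2) `^ (1 + s))^-1.

Lemma slope_weight_gt0 A : 0 < slope_weight A.
Proof. by rewrite invr_gt0 powR_gt0// ltr_pwDl ?sqr_ge0. Qed.

Lemma slope_weight_le1 A : slope_weight A <= 1.
Proof.
have h : 1 <= 1 + A ^+ 2 by rewrite lerDl sqr_ge0.
rewrite invf_le1 ?powR_gt0 ?(lt_le_trans ltr01)//.
by rewrite -[leLHS](powRr0 (1 + A ^+ 2)) ler_powR//; move: s_gt0; lra.
Qed.

Lemma riesz_le_slope (A z w : R) : 0 < z -> (A * z) ^+ 2 <= w ^+ 2 ->
  riesz s (z, w) <= slope_weight A * z `^ (- 1 - 2 * a).
Proof.
move=> z0 h; rewrite /slope_weight -[z `^ _]invrK -invfM -quadratic_form//.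
have A0 : 0 < 1 + A ^+ 2 by rewrite ltr_pwDl ?sqr_ge0.
apply: riesz_le => //=; first by rewrite mulr_gt0// exprn_gt0.
by rewrite mulrDl mul1r -exprMn lerD2l.
Qed.

Lemma riesz_ge_slope (A z w : R) : 0 < z -> w ^+ 2 <= (A * z) ^+ 2 ->
  slope_weight A * z `^ (- 1 - 2 * a) <= riesz s (z, w).
Proof.
move=> z0 h; rewrite /slope_weight -[z `^ _]invrK -invfM -quadratic_form//.
apply: riesz_ge => //=; rewrite ltr_pwDl ?sqr_ge0 ?exprn_gt0//=.
by rewrite mulrDl mul1r -exprMn lerD2l.
Qed.

Lemma riesz_le_fst (z w : R) : 0 < z -> riesz s (z, w) <= z `^ (- 1 - 2 * a).
Proof.
move=> z0; apply: le_trans (@riesz_le_slope 0 z w z0 _) _.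
  by rewrite mul0r expr0n sqr_ge0.
by apply: ler_piMl; rewrite ?powR_ge0// slope_weight_le1.
Qed.

Lemma riesz_sym (z w : R) : riesz s (z, w) = riesz s (w, z).
Proof. by rewrite /riesz/= addrC. Qed.

Lemma riesz_abs_snd (z w : R) : riesz s (z, w) = riesz s (z, `|w|).
Proof. by rewrite /riesz/= real_normK// num_real. Qed.

(** The integral of [z^(-1-2a)] over [z >= 1/8]. The distance [1/8] separates
    near and far displacements in all three zones. *)
Definition tail_const : R := (1 / 8) `^ (- (2 * a)) / (2 * a).

Lemma tail_const_ge0 : 0 <= tail_const.
Proof. by rewrite divr_ge0 ?powR_ge0//; move: s_gt0; lra. Qed.

Lemma integral_strip_tail (A : set (R * R)) (h : R) : measurable A -> 0 <= h ->
  (forall u, A u -> 1 / 8 <= u.1 /\ `|u.2| <= h) ->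
  (\int[lebesgue2 R]_(u in A) (riesz s u)%:E <= (2 * h * tail_const)%:E)%E.
Proof.
move=> mA h0 Ah.
have a0 : 0 < 2 * a by move: s_gt0; lra.
have e8 : 0 < 1 / 8 :> R by lra.
have mk : measurable_fun [set: R] (fun z : R => z `^ (- 1 - 2 * a)) by exact: measurable_fun_powR.
apply: (@le_trans _ _ (\int[@lebesgue_measure R]_(z in `[(1 / 8)%R, +oo[)
    (z `^ (- 1 - 2 * a) * Num.max (2 * h) 0)%:E)%E).
  apply: (@integral_vslices_le _ _ _ _ (fun=> - h) (fun=> 2 * h)).
  - exact: mA.
  - exact: measurable_riesz.
  - exact: riesz_ge0.
  - exact: measurable_itv.
  - by apply: measurable_funTS; exact: measurable_funM.
  - by move=> z _; exact: powR_ge0.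
  - move=> z w /Ah /= [z8]; rewrite ler_norml => /andP[w1 w2]; split.
    + by rewrite /= in_itv/= z8.
    + by rewrite w1/=; lra.
    + by apply: riesz_le_fst; exact: lt_le_trans z8.
rewrite max_l ?mulr_ge0//.
under eq_integral do rewrite EFinM.
rewrite ge0_integralZr//.
- by rewrite integral_powR_tail// -EFinM lee_fin /tail_const mulrC.
- by apply/measurable_EFinP; exact: measurable_funTS.
- by move=> z _; rewrite lee_fin powR_ge0.
- by rewrite lee_fin mulr_ge0.
Qed.

Lemma integral_split_at (A : set (R * R)) (c : R) : measurable A ->
  (\int[lebesgue2 R]_(u in A) (riesz s u)%:E =
   \int[lebesgue2 R]_(u in A `&` [set u | (u.1 < c)%R]) (riesz s u)%:E +
   \int[lebesgue2 R]_(u in A `&` [set u | (c <= u.1)%R]) (riesz s u)%:E)%E.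
Proof.
move=> mA.
have mlt := measurable_lt_fst c.
have mge := measurable_ge_fst c.
rewrite -ge0_integral_setU.
- rewrite -setIUr (_ : _ `|` _ = setT) ?setIT//.
  by apply/seteqP; split=> u//= _; case: (ltP u.1 c) => _; [left|right].
- exact: measurableI.
- exact: measurableI.
- apply/measurable_EFinP; apply: measurable_funTS; exact: measurable_riesz.
- by move=> u _; rewrite lee_fin riesz_ge0.
- rewrite disj_set2E; apply/eqP/seteqP; split=> u //= [[_ h1] [_ h2]].
  by move: h1; rewrite ltNge h2.
Qed.

Lemma integral_rectangle_ge (A : set (R * R)) (x1 x2 y1 y2 c : R) : measurable A ->
  x1 <= x2 -> y1 <= y2 -> 0 <= c ->
  (forall z w, x1 < z < x2 -> y1 < w < y2 -> A (z, w) /\ c <= riesz s (z, w)) ->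
  (((x2 - x1) * (y2 - y1) * c)%:E <= \int[lebesgue2 R]_(u in A) (riesz s u)%:E)%E.
Proof.
move=> mA x12 y12 c0 h.
apply: (@le_trans _ _ (\int[@lebesgue_measure R]_(z in `]x1, x2[)
    (c * Num.max (y2 - y1) 0)%:E)%E).
  rewrite integral_cst//; have /= := lebesgue_segment x1 (x2 - x1) false true.
  rewrite subrKC => ->; rewrite !max_l ?subr_ge0// -EFinM lee_fin; lra.
apply: (@integral_vslices_ge _ _ _ _ (fun=> y1) (fun=> y2 - y1) (fun=> c)).
- exact: mA.
- exact: measurable_riesz.
- exact: riesz_ge0.
- exact: measurable_itv.
- exact: measurable_cst.
- by [].
- move=> z w /=; rewrite in_itv/= => zx; rewrite subrKC; exact: h.
Qed.

End kernel_bounds.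

Section barrier.
Context (R : realType).

(** Half-plane, hill and bumps. The hill is described by its wall as a function
    of the height, because the boundary is vertical at its foot. *)
Definition barrier (f : R -> R) (H : R) : set (R * R) :=
  [set y | [\/ y.2 < 0, f y.2 < cap y.1 | 2 <= `|y.1| <= 3 /\ y.2 < H]].

Lemma barrier_even f H (x y : R) : barrier f H (- x, y) <-> barrier f H (x, y).
Proof. by rewrite /barrier/= cap_even normrN. Qed.

Lemma measurable_barrier f H : measurable_fun [set: R] f -> measurable (barrier f H).
Proof.
move=> mf.
have mcap : measurable_fun [set: R] (@cap R).
  by apply: continuous_measurable_fun; exact: cap_continuous.
rewrite (_ : barrier f H = [set y : R * R | y.2 < 0] `|` ([set y : R * R | f y.2 < cap y.1] `|`
   ([set y : R * R | 2 <= `|y.1|] `&` ([set y : R * R | `|y.1| <= 3] `&` [set y : R * R | y.2 < H])))); last first.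
  apply/seteqP; split=> y /=.
    by case; [left|right; left|move=> [/andP[? ?] ?]; right; right].
  by case=> [|[|[? [? ?]]]]; [apply: Or31|apply: Or32|apply: Or33; split=> //; apply/andP].
apply: measurableU.
  rewrite -[X in measurable X]setTI.
  by apply: (measurable_fun_ltr (f := snd) (g := cst 0)).
apply: measurableU.
  rewrite -[X in measurable X]setTI.
  apply: (measurable_fun_ltr (f := fun y : R * R => f y.2) (g := fun y : R * R => cap y.1)) => //.
    exact: (measurableT_comp mf).
  exact: (measurableT_comp mcap).
apply: measurableI.
  rewrite -[X in measurable X]setTI.
  apply: (measurable_fun_ler (f := cst 2) (g := fun y : R * R => `|y.1|)) => //.
  exact: measurableT_comp.
apply: measurableI.
  rewrite -[X in measurable X]setTI.
  apply: (measurable_fun_ler (f := fun y : R * R => `|y.1|) (g := cst 3)) => //.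
  exact: measurableT_comp.
rewrite -[X in measurable X]setTI.
by apply: (measurable_fun_ltr (f := snd) (g := cst H)).
Qed.

Lemma barrierC f H (x y : R) : ~ barrier f H (x, y) -> 0 <= y /\ cap x <= f y.
Proof.
by move=> h; split; rewrite leNgt; apply/negP => h'; apply: h; [apply: Or31|apply: Or32].
Qed.

Lemma loss_strip f H (x0 y0 : R) u : loss (barrier f H) x0 y0 u -> `|u.2| <= y0.
Proof.
move=> [_ /barrierC[h1 _] /barrierC[h2 _]].
by rewrite ler_norml; apply/andP; split; lra.
Qed.

(** Points of the right bump are opposite to points below the line [y_2 = 0].
    These pairs fill a rectangle of width [1] and height [H - 2 y0], at distance
    at most [sqrt 10], where the kernel is at least [10^(-2)]. *)
Lemma bump_gain (s : R) f (H x0 y0 : R) : 0 < s < 1 / 2 -> measurable_fun [set: R] f ->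
  0 <= x0 < 1 -> 0 < y0 -> H <= 1 -> 2 * y0 <= H ->
  (((H - 2 * y0) / 100)%:E <=
   \int[lebesgue2 R]_(u in gain (barrier f H) x0 y0 `&` [set u | (1 / 8 <= u.1)%R]) (riesz s u)%:E)%E.
Proof.
move=> /andP[s0 s1] mf /andP[x0_ge0 x0_lt1] y0_gt0 H1 yH.
have -> : (H - 2 * y0) / 100 = ((3 - x0) - (2 - x0)) * (- y0 - (y0 - H)) * 100^-1 by lra.
apply: integral_rectangle_ge.
- apply: measurableI; last exact: measurable_ge_fst.
  by apply: measurable_gain; exact: measurable_barrier.
- by lra.
- by lra.
- by rewrite invr_ge0.
move=> z w /andP[z1 z2] /andP[w1 w2]; split.
  split=> /=; last by lra.
  split=> /=; first by lra.
    by apply: Or31 => /=; lra.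
  apply: Or33 => /=; split; last by lra.
  by rewrite ger0_norm; [apply/andP; split; lra|lra].
apply: (@le_trans _ _ ((10 `^ (1 + s))^-1)).
  rewrite lef_pV2 ?posrE ?powR_gt0//.
  have -> : (100 : R) = 10 `^ 2%:R by rewrite powR_mulrn//; lra.
  by apply: ler_powR; lra.
apply: riesz_ge => //=; apply/andP; split; nra.
Qed.

End barrier.

(** * Boundary points on the wall *)

Lemma convexC11_continuous (R : realType) (f f' : R -> R) L : convexC11 f f' L -> continuous f.
Proof.
move=> hf x; apply/differentiable_continuous/derivable1_diffP.
have [h _] := convexC11_C11 1 0 0 hf (normr1 R).
rewrite (_ : f = fun t => 1 * f (0 + 1 * t) + 0); first exact: h.
by apply/funext => t; rewrite !mul1r add0r addr0.
Qed.

Lemma integral_even_power (R : realType) (k c : R) : 0 < k -> 0 < c ->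
  (\int[@lebesgue_measure R]_(w in `[(- c)%R, 0%R[ `|` `]0%R, c]) (`|w| `^ (k - 1))%:E <=
   (2 * (c `^ k / k))%:E)%E.
Proof.
move=> k0 c0; have h := integral_powR_origin k0 c0.
have mk : measurable_fun [set: R] (fun w : R => (`|w| `^ (k - 1))%:E).
  by apply/measurable_EFinP; apply: measurable_fun_powR.
have k_ge0 (w : R) : (0 <= (`|w| `^ (k - 1))%:E)%E by rewrite lee_fin powR_ge0.
have hpos : (\int[@lebesgue_measure R]_(w in `]0%R, c]) (`|w| `^ (k - 1))%:E <= (c `^ k / k)%:E)%E.
  apply: le_trans h; rewrite le_eqVlt; apply/orP; left; apply/eqP/eq_integral => w.
  by rewrite inE/= in_itv/= => /andP[w0 _]; rewrite gtr0_norm.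
have hneg : (\int[@lebesgue_measure R]_(w in `[(- c)%R, 0%R[) (`|w| `^ (k - 1))%:E =
   \int[@lebesgue_measure R]_(w in `]0%R, c]) (`|w| `^ (k - 1))%:E)%E.
  rewrite integral_mkcond -(@ge0_integral_shift_sign _ _ 0 (-1)).
  - rewrite [RHS]integral_mkcond; apply: eq_integral => w _; rewrite !patchE add0r mulN1r normrN.
    have -> : (- w \in `[- c, 0[%classic) = (w \in `]0, c]%classic).
      by apply/idP/idP; rewrite !inE/= !in_itv/=; lra.
    by case: ifP.
  - by right.
  - by apply/(measurable_restrictT _ _).1 => //; exact: measurable_funTS.
  - by move=> w; apply: erestrict_ge0.
rewrite ge0_integral_setU//.
- rewrite hneg (_ : 2 * (c `^ k / k) = c `^ k / k + c `^ k / k); last by lra.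
  by rewrite EFinD; exact: leeD.
- exact: measurable_funTS.
- rewrite disj_set2E; apply/eqP/seteqP; split=> w //=; rewrite !in_itv/=; lra.
Qed.

(** In horizontal slices the loss has length at most [2 Q w^2] for [|w| <= y0],
    hence it is at most a multiple of [Q y0^(1-2s)], up to the far part. The
    square of displacements [y0 < z, w < 2 y0] is a gain of at least
    [y0^(-2s) / 64]; each of the last two hypotheses makes one part of the loss
    at most half of this. *)
Lemma steep_balance (R : realType) (s Q eta H x0 y0 : R) (f f' : R -> R) :
  0 < s < 1 / 2 -> convexC11 f f' Q -> 0 <= Q -> f 0 = 0 -> f' 0 = 0 ->
  3 / 4 <= x0 < 1 -> f y0 = 1 - x0 -> 0 < y0 <= eta -> eta <= 1 / 8 ->
  4 * (Q * eta) / (1 - 2 * s) <= 1 / 128 -> 2 * eta * tail_const s <= 1 / 128 ->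
  (\int[lebesgue2 R]_(u in loss (barrier f H) x0 y0) (riesz s u)%:E <=
   \int[lebesgue2 R]_(u in gain (barrier f H) x0 y0) (riesz s u)%:E)%E.
Proof.
move=> /andP[s0 s1] fC Q0 f00 f'0 /andP[x34 x1] fy /andP[y0_gt0 y_eta] eta8 hQ hM.
have mf : measurable_fun [set: R] f.
  by apply: continuous_measurable_fun; exact: convexC11_continuous fC.
have mE : measurable (barrier f H) by exact: measurable_barrier.
have mL := measurable_loss x0 y0 mE.
have mG := measurable_gain x0 y0 mE.
have k0 : 0 < 1 - 2 * s by lra.
have M0 := tail_const_ge0 s0.
set P := y0 `^ (- (2 * s)).
have P1 : 1 <= P.
  rewrite /P -[leLHS](powRr0 y0); apply: ger_powR; last by lra.
  by rewrite y0_gt0/=; lra.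
have yk : y0 `^ (1 - 2 * s) = y0 * P.
  by rewrite /P powRD ?powRr1 ?(ltW y0_gt0)// (gt_eqF y0_gt0) implybT.
have far : (\int[lebesgue2 R]_(u in loss (barrier f H) x0 y0 `&` [set u | (1 / 8 <= u.1)%R])
    (riesz s u)%:E <= (2 * y0 * tail_const s)%:E)%E.
  apply: integral_strip_tail => //.
  - by apply: measurableI => //; exact: measurable_ge_fst.
  - exact: ltW.
  - by move=> u [/loss_strip].
set near := loss (barrier f H) x0 y0 `&` [set u | u.1 < 1 / 8].
have mnear : measurable near by apply: measurableI => //; exact: measurable_lt_fst.
have near_le : (\int[lebesgue2 R]_(u in near) (riesz s u)%:E <=
    (2 * Q * (2 * (y0 `^ (1 - 2 * s) / (1 - 2 * s))))%:E)%E.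
  rewrite -integral_riesz_swap//.
  pose D : set R := `[- y0, 0[ `|` `]0, y0].
  have mD : measurable D by apply: measurableU; exact: measurable_itv.
  pose l w := f (y0 + w) + f (y0 - w) - 2 * (1 - x0).
  have ml : measurable_fun [set: R] l.
    apply: measurable_funB => //; apply: measurable_funD; apply: (measurableT_comp mf).
      exact: measurable_funD.
    exact: measurable_funB.
  have mpow p : measurable_fun [set: R] (fun w : R => `|w| `^ p).
    exact: measurable_fun_powR.
  apply: (@le_trans _ _ (\int[@lebesgue_measure R]_(w in D)
      (`|w| `^ (- 1 - 2 * (1 / 2 + s)) * Num.max (l w) 0)%:E)%E).
    apply: (@integral_vslices_le _ _ _ _ (fun w => 1 - x0 - f (y0 - w))).
    - rewrite -[X in measurable X]setTI.
      have msw : measurable_fun [set: R * R] (fun u : R * R => (u.2, u.1)) by exact: measurable_fun_pair.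
      exact: msw.
    - exact: measurable_riesz.
    - exact: riesz_ge0.
    - exact: mD.
    - apply: measurable_funTS; apply: measurable_funM; first exact: mpow.
      exact: measurable_maxr.
    - by move=> w _; exact: powR_ge0.
    - move=> w z [/= hL z8].
      have wy := loss_strip hL; rewrite /= in wy.
      case: hL => /= z0 /barrierC[_ h1] /barrierC[_ h2].
      rewrite cap_right in h1; last by lra.
      rewrite cap_right in h2; last by lra.
      have w0 : w != 0.
        apply/eqP => w0; move: h1; rewrite w0 addr0 fy; lra.
      split; last first.
      + rewrite riesz_sym riesz_abs_snd riesz_sym; apply: riesz_le_fst => //.
        by rewrite normr_gt0.
      + by rewrite /l; apply/andP; split; lra.
      + move: wy; rewrite ler_norml => /andP[w1 w2]; rewrite /D/= !in_itv/= w1 w2 andbT/=.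
        by case: (ltgtP w 0) w0 => // _ _; [left|right].
  apply: (@le_trans _ _ (\int[@lebesgue_measure R]_(w in D) (2 * Q * `|w| `^ (1 - 2 * s - 1))%:E)%E).
    apply: ge0_le_integral => //.
    - by move=> w _; rewrite lee_fin mulr_ge0 ?powR_ge0// le_max lexx orbT.
    - apply/measurable_EFinP; apply: measurable_funTS; apply: measurable_funM; first exact: mpow.
      exact: measurable_maxr.
    - by apply/measurable_EFinP; apply: measurable_funTS; apply: measurable_funM => //; exact: mpow.
    - move=> w Dw; rewrite lee_fin.
      have w0 : 0 < `|w|.
        by rewrite normr_gt0; move: Dw; rewrite /D/= !in_itv/=; case: eqVneq => // ->; rewrite ltxx ?andbF; case.
      have /andP[_] := convexC11_midpoint y0 w fC; rewrite fy => h.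
      have lw : Num.max (l w) 0 <= 2 * Q * `|w| ^+ 2.
        rewrite ge_max real_normK ?num_real//; apply/andP; split; first by rewrite /l; lra.
        by rewrite mulr_ge0 ?sqr_ge0 ?mulr_ge0.
      apply: (@le_trans _ _ (`|w| `^ (- 1 - 2 * (1 / 2 + s)) * (2 * Q * `|w| ^+ 2))).
        by apply: ler_wpM2l => //; exact: powR_ge0.
      rewrite mulrCA; apply: ler_wpM2l; first by rewrite mulr_ge0.
      rewrite -(powR_mulrn 2 (ltW w0)) -powRD; last by rewrite (gt_eqF w0) implybT.
      by rewrite (_ : - 1 - 2 * (1 / 2 + s) + 2%:R = 1 - 2 * s - 1)//; lra.
  under eq_integral do rewrite EFinM.
  rewrite ge0_integralZl//.
  - rewrite [leRHS]EFinM; apply: lee_wpmul2l; first by rewrite lee_fin mulr_ge0.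
    exact: integral_even_power.
  - by apply/measurable_EFinP; apply: measurable_funTS; exact: mpow.
  - by rewrite lee_fin mulr_ge0.
rewrite (@integral_split_at R s _ (1 / 8) mL).
(* up to the height [3 y0] the wall is so steep that the square lies in the hill *)
have fsmall y : 0 <= y <= 3 * y0 -> f y <= y0.
  move=> /andP[ya yb]; have := convexC11_upper 0 y fC.
  rewrite f00 f'0 subr0 mul0r !add0r => /le_trans; apply.
  have Qe : Q * eta <= 1 / 512.
    have : 4 * (Q * eta) / (1 - 2 * s) * (1 - 2 * s) <= 1 / 128 * 1.
      by apply: ler_pM => //; rewrite ?divr_ge0 ?mulr_ge0//; lra.
    rewrite divfK ?gt_eqF//; lra.
  apply: (@le_trans _ _ (Q * (9 * (eta * y0)))).
    by apply: ler_wpM2l => //; nra.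
  by have := ler_wpM2r (ltW y0_gt0) Qe; lra.
apply: (@le_trans _ _ (((2 * y0 - y0) * (2 * y0 - y0) * ((8 * y0 ^+ 2) `^ (1 + s))^-1)%:E)); last first.
  apply: integral_rectangle_ge => //.
  - by lra.
  - by lra.
  - by rewrite invr_ge0 powR_ge0.
  move=> z w /andP[z1 z2] /andP[w1 w2]; split.
    split=> /=.
    - by lra.
    - apply: Or32 => /=; rewrite cap_right; last by lra.
      by have := fsmall (y0 + w) ltac:(apply/andP; split; lra); lra.
    - by apply: Or31 => /=; lra.
  by apply: riesz_ge => //=; apply/andP; split; nra.
apply: (le_trans (leeD near_le far)); rewrite -EFinD lee_fin yk.
have -> : (2 * y0 - y0) * (2 * y0 - y0) * ((8 * y0 ^+ 2) `^ (1 + s))^-1 = (8 `^ (1 + s))^-1 * P.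
  have y2 : 0 < y0 ^+ 2 by rewrite exprn_gt0.
  rewrite powRM ?(ltW y2)// invfM.
  have -> : (y0 ^+ 2) `^ (1 + s) = y0 ^+ 2 * P^-1.
    rewrite /P -powRN opprK -(powR_mulrn 2 (ltW y0_gt0)) -powRrM -powRD; last first.
      by rewrite (gt_eqF y0_gt0) implybT.
    by congr (_ `^ _); lra.
  rewrite invfM invrK; have -> : 2 * y0 - y0 = y0 by lra.
  by field; rewrite !gt_eqF// powR_gt0.
have e8 : 1 / 64 <= (8 `^ (1 + s))^-1.
  rewrite div1r lef_pV2 ?posrE ?powR_gt0//.
  have -> : (64 : R) = 8 `^ 2%:R by rewrite powR_mulrn//; lra.
  by apply: ler_powR; lra.
apply: (@le_trans _ _ (1 / 64 * P)); last by apply: ler_wpM2r => //; lra.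
have t1 : 2 * y0 * tail_const s <= 1 / 128 * P.
  have : y0 * tail_const s <= eta * tail_const s by apply: ler_wpM2r.
  lra.
have t2 : 2 * Q * (2 * (y0 * P / (1 - 2 * s))) <= 1 / 128 * P.
  have -> : 2 * Q * (2 * (y0 * P / (1 - 2 * s))) = 4 * (Q * y0) / (1 - 2 * s) * P.
    by field; rewrite gt_eqF.
  apply: ler_wpM2r; first by lra.
  apply: le_trans hQ; rewrite ler_pM2r ?invr_gt0//.
  by have := ler_wpM2l Q0 y_eta; lra.
lra.
Qed.

(** * Boundary points near the axis *)

Lemma barrierC_height (R : realType) (a delta H x y : R) (f : R -> R) : 0 < a -> 0 < delta ->
  (forall t, 0 <= t -> f t <= (t / delta) `^ a^-1) -> ~ barrier f H (x, y) ->
  delta * Num.max (cap x) 0 `^ a <= y.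
Proof.
move=> a0 d0 fle /barrierC[y0 cf].
rewrite mulrC -ler_pdivlMr//.
have -> : y / delta = ((y / delta) `^ a^-1) `^ a.
  by rewrite -powRrM mulVf ?gt_eqF// powRr1// divr_ge0// ltW.
rewrite ge0_ler_powR ?nnegrE ?powR_ge0 ?(ltW a0)//.
  by rewrite le_max lexx orbT.
by rewrite ge_max powR_ge0 andbT; apply: le_trans cf _; exact: fle.
Qed.

Section dome.
Context (R : realType) (a : R).

(** The power [cap^a], modified near the foot of the hill, where [cap] is below
    [1/8], in order to be C^{1,1} on the whole line. *)
Definition dome (x : R) := tpow (1 / 8) a (cap x).
Definition dome' (x : R) := tpow' (1 / 8) a (cap x) * cap' x.
Definition dome_lip := a * ((1 - a) / (1 / 8 * (1 / 8) `^ (1 - a))) + a * (1 / 8) `^ (a - 1) * 2.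

Lemma dome_convexC11 : 0 < a < 1 ->
  convexC11 (fun x => - dome x) (fun x => - dome' x) dome_lip.
Proof.
move=> a01; have e8 : 0 < 1 / 8 :> R by lra.
have [a0 a1] := andP a01.
apply: (@concaveC11_comp _ (tpow (1 / 8) a) (tpow' (1 / 8) a) (@cap R) (@cap' R) _ 2 (a * (1 / 8) `^ (a - 1))).
- exact: tpow_concaveC11.
- exact: cap_convexC11.
- by rewrite mulr_ge0 ?divr_ge0 ?mulr_ge0 ?powR_ge0//; lra.
- by [].
- exact: tpow'_bound.
- exact: cap'_bound.
Qed.

Lemma domeE x : `|x| < 7 / 8 -> dome x = cap x `^ a.
Proof.
move=> x78; have h : (1 / 8 : R) < cap x by rewrite cap_gt; lra.
by rewrite /dome tpow_ge// ltW.
Qed.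

Lemma dome_lip_ge0 : 0 < a < 1 -> 0 <= dome_lip.
Proof.
by move=> /andP[a0 a1]; rewrite /dome_lip addr_ge0 ?mulr_ge0 ?invr_ge0 ?mulr_ge0 ?powR_ge0//; lra.
Qed.

End dome.

Definition center_const (R : realType) (s : R) : R :=
  2 * dome_lip (1 / 2 + s) * ((1 / 8) `^ (1 - 2 * s) / (1 - 2 * s)) + 2 * tail_const s.

(** Outside the barrier the height is at least [delta * dome], a concave
    C^{1,1} function: near the centre the vertical slices of the loss have length
    at most [2 delta dome_lip z^2]. The total loss is of order [delta] and is
    paid by the bump. *)
Lemma center_balance (R : realType) (s delta H x0 y0 : R) (f : R -> R) :
  0 < s < 1 / 2 -> measurable_fun [set: R] f -> 0 < delta ->
  (forall t, 0 <= t -> f t <= (t / delta) `^ (1 / 2 + s)^-1) ->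
  0 <= x0 < 3 / 4 -> y0 = delta * cap x0 `^ (1 / 2 + s) -> 0 < y0 -> H <= 1 ->
  2 * delta <= H -> delta * center_const s <= (H - 2 * delta) / 100 ->
  (\int[lebesgue2 R]_(u in loss (barrier f H) x0 y0) (riesz s u)%:E <=
   \int[lebesgue2 R]_(u in gain (barrier f H) x0 y0) (riesz s u)%:E)%E.
Proof.
move=> s01 mf d0 fle /andP[x0_ge0 x34] y0E y0_gt0 H1 dH hC.
have /andP[s0 s1] := s01.
set a := 1 / 2 + s.
have a01 : 0 < a < 1 by apply/andP; split; rewrite /a; lra.
have /andP[a0 a1] := a01.
have mE : measurable (barrier f H) by exact: measurable_barrier.
have mL := measurable_loss x0 y0 mE.
have mG := measurable_gain x0 y0 mE.
have k0 : 0 < 1 - 2 * s by lra.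
have M0 := tail_const_ge0 s0.
have cap_pos : 1 / 8 < cap x0 by rewrite cap_gt ?ger0_norm; lra.
have yd : y0 <= delta.
  have h : cap x0 `^ a <= 1 `^ a.
    by apply: ge0_ler_powR; rewrite ?nnegrE ?(ltW a0)//; have := cap_le x0; lra.
  by rewrite powR1 in h; rewrite y0E ger_pMr.
have far : (\int[lebesgue2 R]_(u in loss (barrier f H) x0 y0 `&` [set u | (1 / 8 <= u.1)%R])
    (riesz s u)%:E <= (2 * y0 * tail_const s)%:E)%E.
  apply: integral_strip_tail => //.
  - by apply: measurableI => //; exact: measurable_ge_fst.
  - exact: ltW.
  - by move=> u [/loss_strip].
set near := loss (barrier f H) x0 y0 `&` [set u | u.1 < 1 / 8].
have mnear : measurable near by apply: measurableI => //; exact: measurable_lt_fst.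
have domeC := dome_convexC11 a01.
have mdome : measurable_fun [set: R] (dome a).
  have -> : dome a = fun x => - (- dome a x) by apply/funext => x; rewrite opprK.
  apply: measurable_funN; apply: continuous_measurable_fun.
  exact: convexC11_continuous domeC.
have L0 := dome_lip_ge0 a01.
have near_le : (\int[lebesgue2 R]_(u in near) (riesz s u)%:E <=
    (2 * delta * dome_lip a * ((1 / 8) `^ (1 - 2 * s) / (1 - 2 * s)))%:E)%E.
  pose D : set R := `]0, 1 / 8]%classic.
  have mD : measurable D by exact: measurable_itv.
  pose l z := 2 * y0 - delta * dome a (x0 - z) - delta * dome a (x0 + z).
  have ml : measurable_fun [set: R] l.
    apply: measurable_funB; first apply: measurable_funB => //.
      by apply: measurable_funM => //; apply: (measurableT_comp mdome); exact: measurable_funB.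
    by apply: measurable_funM => //; apply: (measurableT_comp mdome); exact: measurable_funD.
  have mpow p : measurable_fun [set: R] (fun w : R => w `^ p).
    exact: measurable_fun_powR.
  apply: (@le_trans _ _ (\int[@lebesgue_measure R]_(z in D)
      (z `^ (- 1 - 2 * a) * Num.max (l z) 0)%:E)%E).
    apply: (@integral_vslices_le _ _ _ _ (fun z => delta * dome a (x0 - z) - y0)).
    - exact: mnear.
    - exact: measurable_riesz.
    - exact: riesz_ge0.
    - exact: mD.
    - apply: measurable_funTS; apply: measurable_funM; first exact: mpow.
      exact: measurable_maxr.
    - by move=> z _; exact: powR_ge0.
    - move=> z w [[/= z0 hm hp] z8].
      have := barrierC_height a0 d0 fle hm; have := barrierC_height a0 d0 fle hp.
      have xm : `|x0 - z| < 7 / 8 by rewrite ltr_norml; apply/andP; split; lra.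
      have xp : `|x0 + z| < 7 / 8 by rewrite ltr_norml; apply/andP; split; lra.
      have cm : (1 / 8 : R) < cap (x0 - z) by rewrite cap_gt; lra.
      have cp : (1 / 8 : R) < cap (x0 + z) by rewrite cap_gt; lra.
      rewrite !max_l ?(le_trans _ (ltW cm)) ?(le_trans _ (ltW cp))//; try lra.
      rewrite -!domeE// => h1 h2; split.
      + by rewrite /D/= in_itv/= z0 ltW.
      + by rewrite /l; apply/andP; split; lra.
      + exact: riesz_le_fst.
  apply: (@le_trans _ _ (\int[@lebesgue_measure R]_(z in D)
      (2 * delta * dome_lip a * z `^ (1 - 2 * s - 1))%:E)%E).
    apply: ge0_le_integral => //.
    - by move=> z _; rewrite lee_fin mulr_ge0 ?powR_ge0// le_max lexx orbT.
    - apply/measurable_EFinP; apply: measurable_funTS; apply: measurable_funM; first exact: mpow.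
      exact: measurable_maxr.
    - by apply/measurable_EFinP; apply: measurable_funTS; apply: measurable_funM => //; exact: mpow.
    - move=> z; rewrite /D/= in_itv/= => /andP[z0 z8]; rewrite lee_fin.
      have /andP[_ h] := convexC11_midpoint x0 z domeC.
      have dx0 : delta * dome a x0 = y0.
        by rewrite y0E domeE// ger0_norm//; lra.
      have lz : Num.max (l z) 0 <= 2 * delta * dome_lip a * z ^+ 2.
        rewrite ge_max; apply/andP; split; last by rewrite mulr_ge0 ?sqr_ge0 ?mulr_ge0 ?(ltW d0).
        have -> : l z = delta * (- dome a (x0 + z) - dome a (x0 - z) - 2 * (- dome a x0)).
          by rewrite /l -dx0; ring.
        by have := ler_wpM2l (ltW d0) h; lra.
      apply: (@le_trans _ _ (z `^ (- 1 - 2 * a) * (2 * delta * dome_lip a * z ^+ 2))).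
        by apply: ler_wpM2l => //; exact: powR_ge0.
      rewrite mulrCA; apply: ler_wpM2l; first by rewrite !mulr_ge0 ?(ltW d0).
      rewrite -(powR_mulrn 2 (ltW z0)) -powRD; last by rewrite (gt_eqF z0) implybT.
      by rewrite (_ : - 1 - 2 * a + 2%:R = 1 - 2 * s - 1)//; rewrite /a; lra.
  under eq_integral do rewrite EFinM.
  rewrite ge0_integralZl//.
  - rewrite [leRHS]EFinM; apply: lee_wpmul2l; first by rewrite lee_fin !mulr_ge0 ?(ltW d0).
    by apply: integral_powR_origin => //; lra.
  - by apply/measurable_EFinP; apply: measurable_funTS; exact: mpow.
  - by move=> w _; rewrite lee_fin powR_ge0.
  - by rewrite lee_fin !mulr_ge0 ?(ltW d0).
rewrite (@integral_split_at R s _ (1 / 8) mL).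
apply: (le_trans (leeD near_le far)).
apply: (@le_trans _ _ ((H - 2 * y0) / 100)%:E).
  rewrite -EFinD lee_fin; apply: le_trans (_ : (H - 2 * delta) / 100 <= _); last by lra.
  apply: le_trans hC; rewrite /center_const -/a.
  have := ler_wpM2r M0 yd; lra.
apply: le_trans (@bump_gain R s f H x0 y0 s01 mf _ y0_gt0 H1 _) _.
- by rewrite x0_ge0/=; lra.
- by lra.
apply: ge0_subset_integral => //.
- by apply: measurableI => //; exact: measurable_ge_fst.
- by apply/measurable_EFinP; apply: measurable_funTS; exact: measurable_riesz.
- by move=> u _; rewrite lee_fin riesz_ge0.
Qed.

(** * Boundary points on the power arc *)

Section rise_fall.
Context (R : realType) (a D : R).
Hypotheses (a01 : 0 < a < 1) (D_gt0 : 0 < D).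

Local Notation rise := (rise a D).
Local Notation fall := (fall a D).
(** Where the rise reaches [D^a], the largest possible fall. Losses occur before
    this distance, gains after it. *)
Definition double_point := (2 `^ a^-1 - 1) * D.

Let a0 : 0 < a. Proof. by case/andP: a01. Qed.

Lemma double_point_gt0 : 0 < double_point.
Proof.
have /(_ 1 2) h := @gt0_ltr_powR R a^-1 ltac:(by rewrite invr_gt0).
rewrite mulr_gt0// subr_gt0; move: h; rewrite powR1 !nnegrE; apply=> //.
by rewrite ltr1n.
Qed.

Lemma rise_double_point : rise double_point = D `^ a.
Proof.
rewrite /rise /double_point.
have -> : D + (2 `^ a^-1 - 1) * D = 2 `^ a^-1 * D by ring.
rewrite powRM ?powR_ge0 ?(ltW D_gt0)// -powRrM mulVf ?gt_eqF// powRr1//; lra.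
Qed.

Lemma rise_concave z1 z2 : 0 <= z1 <= z2 -> z1 * rise z2 <= z2 * rise z1.
Proof.
move=> /andP[z1_ge0 z12]; rewrite /rise.
have Dz : 0 < D + z1 by move: D_gt0; lra.
have h1 := powR_le_tangent a01 Dz (ltW D_gt0).
have h2 := @powR_le_tangent _ a (D + z2) _ a01 Dz ltac:(move: D_gt0; lra).
set P := a * _ in h1 h2.
have h3 : z1 * ((D + z2) `^ a - D `^ a) <= z1 * ((D + z1) `^ a - D `^ a + P * (z2 - z1)).
  by apply: ler_wpM2l => //; lra.
have h4 : (z2 - z1) * (P * z1) <= (z2 - z1) * ((D + z1) `^ a - D `^ a).
  by apply: ler_wpM2l; lra.
lra.
Qed.

Lemma rise_le_fall z : 0 <= z <= D -> rise z <= fall z.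
Proof.
move=> /andP[z0 zD]; rewrite /rise /fall max_l ?subr_ge0//.
have h1 := @powR_le_tangent _ a (D + z) _ a01 D_gt0 ltac:(move: D_gt0; lra).
have h2 := @powR_le_tangent _ a (D - z) _ a01 D_gt0 ltac:(lra).
lra.
Qed.

Lemma fall_le z : fall z <= D `^ a.
Proof. by rewrite /fall gerBl powR_ge0. Qed.

Lemma fall_ge z : D <= z -> fall z = D `^ a.
Proof. by move=> Dz; rewrite /fall max_r ?subr_le0// powR0 ?gt_eqF// subr0. Qed.

Lemma fall_ge0 z : 0 <= z -> 0 <= fall z.
Proof.
move=> z0; rewrite /fall subr_ge0; apply: ge0_ler_powR; rewrite ?nnegrE ?(ltW a0) ?(ltW D_gt0)//.
  by rewrite le_max lexx orbT.
by rewrite ge_max (ltW D_gt0) andbT; lra.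
Qed.

Lemma rise_lt z1 z2 : 0 <= z1 < z2 -> rise z1 < rise z2.
Proof.
move=> /andP[z10 z12]; rewrite /rise ltrD2r; apply: gt0_ltr_powR; rewrite ?nnegrE//; move: D_gt0; lra.
Qed.

Lemma rise_le_linear z : D <= 1 / 4 -> 1 / 8 <= z -> rise z <= 11 * z.
Proof.
move=> D4 z8; have := @powR_le_tangent _ a (D + z) 1 a01 ltr01 ltac:(move: D_gt0; lra).
rewrite !powR1 mulr1 /rise => h.
have : a * (D + z - 1) <= 1 * (D + z).
  apply: (@le_trans _ _ (a * (D + z))); first by apply: ler_wpM2l; move: a0; lra.
  by apply: ler_wpM2r; case/andP: a01; move: D_gt0; lra.
have := powR_gt0 a D_gt0; lra.
Qed.

Lemma measurable_rise : measurable_fun [set: R] rise.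
Proof. by apply: measurable_funB => //; apply: measurable_fun_powR; exact: measurable_funD. Qed.

Lemma measurable_fall : measurable_fun [set: R] fall.
Proof.
apply: measurable_funB => //; apply: measurable_fun_powR; apply: measurable_maxr => //.
exact: measurable_funB.
Qed.

End rise_fall.

(** Vertical slices between the heights [delta * h z] and [delta * g z], for a
    kernel with weight [W]. *)
Definition excess (R : realType) (a W delta : R) (g h : R -> R) (z : R) : R :=
  W * z `^ (- 1 - 2 * a) * Num.max (delta * g z - delta * h z) 0.

Lemma measurable_excess (R : realType) (a W delta : R) (g h : R -> R) :
  measurable_fun [set: R] g -> measurable_fun [set: R] h ->
  measurable_fun [set: R] (excess a W delta g h).
Proof.
move=> mg mh; apply: measurable_funM.
  by apply: measurable_funM => //; exact: measurable_fun_powR.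
by apply: measurable_maxr => //; apply: measurable_funB; exact: measurable_funM.
Qed.

Lemma excess_ge0 (R : realType) (a W delta : R) (g h : R -> R) z : 0 <= W ->
  0 <= excess a W delta g h z.
Proof. by move=> W0; rewrite !mulr_ge0 ?powR_ge0// le_max lexx orbT. Qed.

Lemma integral_excess (R : realType) (a W delta : R) (g h : R -> R) :
  measurable_fun [set: R] g -> measurable_fun [set: R] h -> 0 <= W -> 0 <= delta ->
  (\int[@lebesgue_measure R]_(z in `]0%R, +oo[) (excess a W delta g h z)%:E =
   (W * delta)%:E * \int[@lebesgue_measure R]_(z in `]0%R, +oo[)
     (Num.max (g z - h z) 0 * z `^ (- 1 - 2 * a))%:E)%E.
Proof.
move=> mg mh W0 d0; rewrite -ge0_integralZl//.
- apply: eq_integral => z _; rewrite /excess -EFinM -mulrBr; congr EFin.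
  have -> : Num.max (delta * (g z - h z)) 0 = delta * Num.max (g z - h z) 0.
    by rewrite -[X in Num.max _ X](mulr0 delta) maxr_pMr.
  ring.
- apply/measurable_EFinP; apply: measurable_funTS; apply: measurable_funM; last exact: measurable_fun_powR.
  by apply: measurable_maxr => //; exact: measurable_funB.
- by move=> z _; rewrite lee_fin mulr_ge0 ?powR_ge0// le_max lexx orbT.
- by rewrite lee_fin mulr_ge0.
Qed.

Lemma integral_ray_split (R : realType) (c : R) (g : R -> R) : 0 < c ->
  measurable_fun [set: R] g -> (forall z, 0 <= g z) ->
  (\int[@lebesgue_measure R]_(z in `]0%R, +oo[) (g z)%:E =
   \int[@lebesgue_measure R]_(z in `]0%R, c[) (g z)%:E +
   \int[@lebesgue_measure R]_(z in `[c, +oo[) (g z)%:E)%E.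
Proof.
move=> c0 mg g0; rewrite -ge0_integral_setU//.
- congr (integral _ _ _); apply/seteqP; split=> z /=; rewrite !in_itv/= !andbT.
    by move=> ->; case: (ltP z c) => _; [left|right].
  by case=> [/andP[]//|]; lra.
- by apply/measurable_EFinP; exact: measurable_funTS.
- by move=> z _; rewrite lee_fin.
- rewrite disj_set2E; apply/eqP/seteqP; split=> z //=; rewrite !in_itv/=; lra.
Qed.

Section power_arc.
Context (R : realType) (s delta H x0 y0 : R) (f : R -> R).
Let a := 1 / 2 + s.
Hypotheses (s01 : 0 < s < 1 / 2) (mf : measurable_fun [set: R] f) (d0 : 0 < delta).
Hypothesis fle : forall t, 0 <= t -> f t <= (t / delta) `^ a^-1.
Hypotheses (x34 : 3 / 4 <= x0) (x1 : x0 < 1).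
Let D := 1 - x0.
Hypothesis y0E : y0 = delta * D `^ a.
Let z0 := double_point a D.
(** The slope of the arc, seen from its point at distance [D], at
    [double_point]. *)
Let A := delta * D `^ a / z0.
Let W := slope_weight s A.
Let loss_density := excess a W delta (fall a D) (rise a D).
Let gain_density := excess a W delta (rise a D) (fall a D).

Let s0 : 0 < s. Proof. by case/andP: s01. Qed.
Let a01 : 0 < a < 1. Proof. by move: s01; rewrite /a; lra. Qed.
Let a0 : 0 < a. Proof. by case/andP: a01. Qed.
Let D0 : 0 < D. Proof. by move: x1; rewrite /D; lra. Qed.
Let D4 : D <= 1 / 4. Proof. by move: x34; rewrite /D; lra. Qed.
Let y0_gt0 : 0 < y0. Proof. by rewrite y0E mulr_gt0// powR_gt0. Qed.
Let z0_gt0 : 0 < z0. Proof. exact: double_point_gt0. Qed.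
Let A0 : 0 < A. Proof. by rewrite /A divr_gt0// mulr_gt0// powR_gt0. Qed.
Let W0 : 0 < W. Proof. exact: slope_weight_gt0. Qed.
Let mE : measurable (barrier f H). Proof. exact: measurable_barrier. Qed.
Let mL := measurable_loss x0 y0 mE.
Let mG := measurable_gain x0 y0 mE.
Let mrise := measurable_rise a D.
Let mfall := measurable_fall a D.
Let mld : measurable_fun [set: R] loss_density. Proof. exact: measurable_excess. Qed.
Let mgd : measurable_fun [set: R] gain_density. Proof. exact: measurable_excess. Qed.
Let gd0 z : 0 <= gain_density z. Proof. by apply: excess_ge0; exact: ltW. Qed.
Let Wp0 z : 0 <= W * z `^ (- 1 - 2 * a). Proof. by rewrite mulr_ge0 ?powR_ge0 ?ltW. Qed.

(** A nonempty slice needs [rise z <= fall z <= D^a], hence [z <= z0]; by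
    concavity of [rise] the slope [w / z] is then at least [A], and the kernel at
    most [W * z^(-1-2a)]. *)
Lemma near_loss_le :
  (\int[lebesgue2 R]_(u in loss (barrier f H) x0 y0 `&` [set u | (u.1 < 1 / 8)%R])
     (riesz s u)%:E <= \int[@lebesgue_measure R]_(z in `]0%R, +oo[) (loss_density z)%:E)%E.
Proof.
have := x1; have := x34; have := D0; have := y0_gt0 => y_gt0 D_gt0 lx ux.
apply: (@integral_vslices_le _ _ _ _ (fun z => delta * rise a D z)).
- by apply: measurableI => //; exact: measurable_lt_fst.
- exact: measurable_riesz.
- exact: riesz_ge0.
- exact: measurable_itv.
- exact: measurable_funTS.
- by move=> z _.
- move=> z w [[/= z_gt0 hm hp] z8].
  have := barrierC_height a0 d0 fle hm; have := barrierC_height a0 d0 fle hp.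
  rewrite !cap_right; [|lra|lra].
  have -> : 1 - (x0 + z) = D - z by rewrite /D; ring.
  have -> : 1 - (x0 - z) = D + z by rewrite /D; ring.
  rewrite (max_l (x := D + z)); last by lra.
  move=> h1 h2.
  have w1 : delta * rise a D z <= w by rewrite /rise mulrBr -y0E; lra.
  have w2 : w <= delta * fall a D z by rewrite /fall mulrBr -y0E; lra.
  have zz0 : z <= z0.
    rewrite leNgt; apply/negP => zz.
    have := @rise_lt _ a D a01 D0 z0 z; rewrite rise_double_point// zz (ltW z0_gt0) => /(_ isT) h3.
    have := fall_le a D z; rewrite leNgt => /negP; apply.
    apply: lt_le_trans h3 _; rewrite -(ler_pM2l d0); exact: le_trans w2.
  split.
  + by rewrite /= in_itv/= z_gt0.
  + by rewrite w1 subrKC.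
  + apply: riesz_le_slope => //.
    have Az0 : 0 <= A * z by rewrite mulr_ge0 ?ltW.
    have Aw : A * z <= w.
      apply: le_trans w1; have -> : A * z = delta * (z * D `^ a / z0) by rewrite /A; ring.
      rewrite ler_wpM2l ?(ltW d0)// ler_pdivrMr// [leRHS]mulrC -(rise_double_point a01 D0).
      by apply: rise_concave => //; rewrite zz0 ltW.
    by rewrite ler_pXn2r ?nnegrE// (le_trans Az0 Aw).
Qed.

(** The mirror image: [rise z > fall z] forces [z >= D], where the fall is all of
    [D^a], then [z >= z0] and a slope at most [A]. The lower point of the pair is
    in the half-plane and the upper one under the arc. *)
Lemma near_gain_ge :
  (\int[@lebesgue_measure R]_(z in `]0%R, (1 / 8)%R[) (gain_density z)%:E <=
    \int[lebesgue2 R]_(u in gain (barrier f H) x0 y0 `&` [set u | (u.1 < 1 / 8)%R]) (riesz s u)%:E)%E.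
Proof.
have := x1; have := x34; have := D0; have := y0_gt0 => y_gt0 D_gt0 lx ux.
apply: (@integral_vslices_ge _ _ _ _ (fun z => delta * fall a D z)).
- by apply: measurableI => //; exact: measurable_lt_fst.
- exact: measurable_riesz.
- exact: riesz_ge0.
- exact: measurable_itv.
- exact: measurable_funTS.
- by move=> z _.
- move=> z w; rewrite /= in_itv/= => /andP[z_gt0 z8]; rewrite subrKC => /andP[w1 w2].
  have ltfr : fall a D z < rise a D z by rewrite -(ltr_pM2l d0); exact: lt_trans w2.
  have Dz : D <= z.
    rewrite leNgt; apply/negP => zD.
    by move: ltfr; rewrite ltNge rise_le_fall// (ltW z_gt0) ltW.
  rewrite fall_ge// in w1 ltfr; rewrite -y0E in w1.
  have zz0 : z0 <= z.
    rewrite leNgt; apply/negP => zz.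
    have := @rise_lt _ a D a01 D0 z z0; rewrite rise_double_point// zz (ltW z_gt0) => /(_ isT) h3.
    by move: (lt_trans ltfr h3); rewrite ltxx.
  split.
  + split=> //; split=> //=; last by apply: Or31 => /=; lra.
    apply: Or32 => /=; rewrite cap_right; last by lra.
    have yw0 : 0 <= y0 + w by lra.
    apply: (le_lt_trans (fle yw0)).
    have -> : 1 - (x0 - z) = D + z by rewrite /D; ring.
    have Dz0 : 0 <= D + z by lra.
    have -> : D + z = ((D + z) `^ a) `^ a^-1 by rewrite -powRrM mulfV ?gt_eqF// powRr1.
    apply: gt0_ltr_powR; rewrite ?nnegrE ?powR_ge0 ?invr_gt0 ?(divr_ge0 yw0 (ltW d0))//.
    rewrite ltr_pdivrMr// mulrC.
    by move: w2; rewrite /rise mulrBr -y0E; lra.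
  + apply: riesz_ge_slope => //.
    have Az0 : 0 <= A * z by rewrite mulr_ge0 ?ltW.
    rewrite ler_pXn2r ?nnegrE//; last by lra.
    apply: le_trans (ltW w2) _; have -> : A * z = delta * (z * D `^ a / z0) by rewrite /A; ring.
    rewrite ler_wpM2l ?(ltW d0)// ler_pdivlMr// mulrC -(rise_double_point a01 D0).
    by apply: rise_concave => //; rewrite zz0 ltW.
Qed.

Lemma far_rise_le :
  (\int[@lebesgue_measure R]_(z in `[(1 / 8)%R, +oo[) (gain_density z)%:E <=
    (delta * (11 * ((1 / 8) `^ (- (2 * s)) / (2 * s))))%:E)%E.
Proof.
have := x1; have := x34; have := D0; have := y0_gt0 => y_gt0 D_gt0 lx ux.
apply: (@le_trans _ _ (\int[@lebesgue_measure R]_(z in `[(1 / 8)%R, +oo[)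
   ((delta * 11) * z `^ (- 1 - 2 * s))%:E)%E).
  apply: ge0_le_integral => //.
  - by move=> z _; rewrite lee_fin.
  - by apply/measurable_EFinP; exact: measurable_funTS.
  - by apply/measurable_EFinP; apply: measurable_funTS; apply: measurable_funM => //; exact: measurable_fun_powR.
  - move=> z; rewrite /= in_itv/= andbT => z8; rewrite lee_fin /gain_density.
    have z_gt0 : 0 < z by lra.
    have -> : z `^ (- 1 - 2 * s) = z `^ (- 1 - 2 * a) * z.
      apply: esym; rewrite -{2}[z](powRr1 (ltW z_gt0)) -powRD ?(gt_eqF z_gt0) ?implybT//.
      by congr (_ `^ _); rewrite /a; lra.
    have hr : rise a D z <= 11 * z by exact: rise_le_linear.
    have hf : 0 <= fall a D z by apply: fall_ge0 => //; exact: ltW.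
    have hm : Num.max (delta * rise a D z - delta * fall a D z) 0 <= delta * (11 * z).
      rewrite ge_max; apply/andP; split; last by rewrite !mulr_ge0 ?(ltW d0) ?(ltW z_gt0).
      by rewrite -mulrBr; apply: ler_wpM2l; [exact: ltW|lra].
    apply: (@le_trans _ _ (1 * z `^ (- 1 - 2 * a) * (delta * (11 * z)))); last by lra.
    apply: ler_pM => //; first by rewrite le_max lexx orbT.
    by apply: ler_wpM2r; [exact: powR_ge0|exact: slope_weight_le1].
under eq_integral do rewrite EFinM.
rewrite ge0_integralZl//.
- by rewrite integral_powR_tail ?mulr_gt0// -EFinM lee_fin mulrA.
- by apply/measurable_EFinP; apply: measurable_funTS; exact: measurable_fun_powR.
- by move=> z _; rewrite lee_fin powR_ge0.
- by rewrite lee_fin mulr_ge0// ltW.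
Qed.

Definition power_const : R :=
  11 * ((1 / 8) `^ (- (2 * s)) / (2 * s)) + 2 * tail_const s.

(** [linearized_balance] bounds the near loss by the gain density on the whole
    ray. Its part beyond [1/8] need not be a gain of the barrier, but it is of order
    [delta], as is the far loss, and the bump pays for both. *)
Lemma power_balance : H <= 1 ->
  2 * delta <= H -> delta * power_const <= (H - 2 * delta) / 100 ->
  (\int[lebesgue2 R]_(u in loss (barrier f H) x0 y0) (riesz s u)%:E <=
   \int[lebesgue2 R]_(u in gain (barrier f H) x0 y0) (riesz s u)%:E)%E.
Proof.
move=> H1 dH hC.
have M0 := tail_const_ge0 s0.
have yd : y0 <= delta.
  have h : D `^ a <= 1 `^ a.
    by apply: ge0_ler_powR; rewrite ?nnegrE ?(ltW a0) ?(ltW D0)//; move: D4; lra.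
  by rewrite powR1 in h; rewrite y0E ger_pMr.
have far : (\int[lebesgue2 R]_(u in loss (barrier f H) x0 y0 `&` [set u | (1 / 8 <= u.1)%R])
    (riesz s u)%:E <= (2 * y0 * tail_const s)%:E)%E.
  apply: integral_strip_tail => //.
  - by apply: measurableI => //; exact: measurable_ge_fst.
  - exact: ltW.
  - by move=> u [/loss_strip].
have balance : (\int[@lebesgue_measure R]_(z in `]0%R, +oo[) (loss_density z)%:E <=
    \int[@lebesgue_measure R]_(z in `]0%R, +oo[) (gain_density z)%:E)%E.
  rewrite [leLHS](integral_excess a mfall mrise (ltW W0) (ltW d0)).
  rewrite [leRHS](integral_excess a mrise mfall (ltW W0) (ltW d0)).
  apply: lee_wpmul2l; first by rewrite lee_fin mulr_ge0 ?ltW.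
  by apply: linearized_balance; [exact: a0|case/andP: a01|exact: D0].
rewrite (@integral_split_at R s _ (1 / 8) mL) (@integral_split_at R s _ (1 / 8) mG).
apply: (le_trans (leeD (le_trans near_loss_le balance) far)).
rewrite (@integral_ray_split _ (1 / 8) _ _ mgd gd0); last by lra.
rewrite -addeA; apply: leeD; first exact: near_gain_ge.
apply: le_trans (@bump_gain R s f H x0 y0 s01 mf _ y0_gt0 H1 _).
- apply: (le_trans (leeD far_rise_le (lexx _))); rewrite -EFinD lee_fin.
  apply: (@le_trans _ _ ((H - 2 * delta) / 100)); last by lra.
  apply: le_trans hC; rewrite /power_const.
  have := ler_wpM2r M0 yd; lra.
- by move: x34 x1; lra.
- by lra.
Qed.

End power_arc.

(** * Geometry of the barrier *)

Section barrier_geometry.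
Context (R : realType) (a delta H Q y1 eta : R) (f f' : R -> R).
Hypotheses (a01 : 0 < a < 1) (d0 : 0 < delta) (H0 : 0 < H) (y1_gt0 : 0 < y1).
Hypothesis fC : convexC11 f f' Q.
Hypothesis f_flat : forall y, y <= y1 -> f y = 0.
Hypothesis f_ge0 : forall y, 0 <= f y.
Hypothesis f_le : forall y, 0 <= y -> f y <= (y / delta) `^ a^-1.
Hypothesis f_power : forall y, eta <= y -> f y = (y / delta) `^ a^-1.
Hypotheses (eta0 : 0 < eta) (f_eta : f eta <= 1 / 8).
Notation E := (barrier f H).

Let a0 : 0 < a. Proof. by case/andP: a01. Qed.

Let root_lt (y c : R) : 0 <= y -> 0 <= c -> (y / delta < c `^ a) = ((y / delta) `^ a^-1 < c).
Proof.
move=> y0 c0; have yd : 0 <= y / delta by rewrite divr_ge0// ltW.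
have e : c = (c `^ a) `^ a^-1 by rewrite -powRrM mulfV ?gt_eqF// powRr1.
apply/idP/idP => h; first by rewrite e gt0_ltr_powR ?nnegrE ?powR_ge0 ?invr_gt0.
have -> : y / delta = ((y / delta) `^ a^-1) `^ a by rewrite -powRrM mulVf ?gt_eqF// powRr1.
by rewrite gt0_ltr_powR ?nnegrE ?powR_ge0.
Qed.

Lemma power_small y : 0 <= y <= eta -> (y / delta) `^ a^-1 <= 1 / 8.
Proof.
move=> /andP[y0 ye]; apply: le_trans f_eta; rewrite f_power//.
apply: ge0_ler_powR; rewrite ?invr_ge0 ?(ltW a0) ?nnegrE ?divr_ge0 ?(ltW d0) ?(ltW eta0)//.
by rewrite ler_pM2r ?invr_gt0.
Qed.

Lemma barrier_between x y : 0 <= y -> `|x| < 2 -> E (x, y) <-> f y < cap x.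
Proof.
move=> y0 x2; split; last by apply: Or32.
case=> //=; first by rewrite ltNge y0.
by move=> [/andP[]]; rewrite leNgt x2.
Qed.

Lemma barrier_boundary p : boundary E p -> 0 < p.2 -> `|p.1| < 2 -> f p.2 = cap p.1.
Proof.
move=> [clE nE] p2 p1.
have cf : continuous f by exact: convexC11_continuous fC.
pose g (y : R * R) := f y.2 - cap y.1.
have cg : continuous g.
  move=> y; apply: cvgB; first by apply: (@cvg_comp _ _ _ snd f); [exact: cvg_snd|exact: cf].
  by apply: (@cvg_comp _ _ _ fst (@cap R)); [exact: cvg_fst|exact: cap_continuous].
have c2 : y.2 @[y --> p] --> p.2 by exact: cvg_snd.
have c1 : y.1 @[y --> p] --> p.1 by exact: cvg_fst.
have n2 : \forall y \near p, 0 < y.2 by exact: (cvgr_gt _ c2).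
have n1 : \forall y \near p, `|y.1| < 2 by exact: (cvgr_lt _ (cvg_norm c1)).
case: (ltgtP (f p.2) (cap p.1)) => // h.
  exfalso; apply: nE; rewrite /interior/=.
  have : \forall y \near p, g y < 0 by apply: (cvgr_lt _ (cg p)); rewrite subr_lt0.
  by apply: filterS => y; rewrite /g subr_lt0 => hy; apply: Or32.
have ng : \forall y \near p, 0 < g y by apply: (cvgr_gt _ (cg p)); rewrite subr_gt0.
have [y [Ey [[y2 y1'] gy]]] := clE _ (filterI (filterI n2 n1) ng).
have Ey' : E (y.1, y.2) by case: y Ey {y2 y1' gy}.
move: gy => /=; rewrite /g subr_gt0 ltNge.
by rewrite (ltW ((barrier_between (ltW y2) y1').1 Ey')).
Qed.

Lemma barrier_boundary_height p : boundary E p -> `|p.1| < 1 -> 0 < p.2.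
Proof.
move=> [_ nE] p1; rewrite ltNge; apply/negP => p2; apply: nE; rewrite /interior/=.
have cp : 0 < cap p.1 by rewrite cap_gt; lra.
have c2 : y.2 @[y --> p] --> p.2 by exact: cvg_snd.
have c1 : cap y.1 @[y --> p] --> cap p.1.
  by apply: (@cvg_comp _ _ _ fst (@cap R)); [exact: cvg_fst|exact: cap_continuous].
have n2 : \forall y \near p, y.2 < y1 by apply: (cvgr_lt _ c2); exact: le_lt_trans p2 _.
have n1 : \forall y \near p, 0 < cap y.1 by exact: (cvgr_gt _ c1).
by apply: filterS2 n2 n1 => y y2 cy; apply: Or32; rewrite f_flat// ltW.
Qed.

Lemma edisk_coords (p y : R * R) r : edisk p r y -> `|y.1 - p.1| < r /\ `|y.2 - p.2| < r.
Proof.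
rewrite /edisk/= /Defs.edist => h.
have r0 : 0 <= r by exact: ltW (le_lt_trans (sqrtr_ge0 _) h).
have coord (v w : R) : `|v| <= Num.sqrt (v ^+ 2 + w ^+ 2).
  by rewrite -sqrtr_sqr ler_sqrt ?lerDl ?addr_ge0 ?sqr_ge0.
split; apply: le_lt_trans h; first exact: (coord (y.1 - p.1) (y.2 - p.2)).
by rewrite [X in Num.sqrt X]addrC; exact: (coord (y.2 - p.2) (y.1 - p.1)).
Qed.

(** For [|p_1| < 3/4] the boundary is the graph of [delta * dome]. For larger
    [|p_1|] it is a graph over the vertical axis, with [cap y_1 = 1 - e y_1],
    where [e] is the sign of [p_1]. *)
Lemma barrier_C11 : C11_boundary_in E (`](- (3 / 2)), (3 / 2)[ `*` `]0, +oo[).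
Proof.
move=> p pE [/=]; rewrite !in_itv/= andbT => p1 p2.
have p1' : `|p.1| < 3 / 2 by rewrite ltr_norml.
have fp : f p.2 = cap p.1 by apply: barrier_boundary => //; lra.
have [mid|side] := ltP `|p.1| (3 / 4).
  pose r := Num.min (1 / 8) p.2.
  exists r, 0, 1, (fun t => - delta * (- dome a (p.1 + 1 * t)) + (- p.2)); split.
  - by rewrite /r lt_min p2 andbT; lra.
  - by rewrite expr0n expr1n add0r.
  - by apply: convexC11_C11 (dome_convexC11 a01) _; rewrite normr1.
  move=> [x y] /edisk_coords [/=]; rewrite /r !lt_min => /andP[hx _] /andP[_ hy].
  rewrite !mulr1 !mulr0 subr0 add0r mulrN mulNr opprK mul1r.
  have -> : p.1 + (x - p.1) = x by ring.
  have y0 : 0 < y by move: hy; rewrite ltr_norml; lra.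
  have x78 : `|x| < 7 / 8.
    have -> : x = p.1 + (x - p.1) by ring.
    by apply: le_lt_trans (ler_normD _ _) _; lra.
  have cx : 1 / 8 < cap x by rewrite cap_gt; lra.
  have cx0 : 0 <= cap x by lra.
  have EP := @barrier_between x y (ltW y0) ltac:(lra).
  rewrite domeE// ltrD2r ltrD2r; split=> h.
    apply/EP; apply: le_lt_trans (f_le (ltW y0)) _.
    by rewrite -root_lt ?(ltW y0)// ltr_pdivrMr// mulrC.
  move/EP; rewrite ltNge => /negP; apply.
  have h1 : cap x <= (y / delta) `^ a^-1.
    by rewrite leNgt -root_lt ?(ltW y0)// -leNgt ler_pdivlMr// mulrC ltW.
  rewrite f_power//; have [//|/ltW ye] := leP eta y.
  by have := @power_small y; rewrite (ltW y0) ye => /(_ isT); lra.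
have [e [he pe]] : exists e : R, `|e| = 1 /\ `|p.1| = e * p.1.
  have [h|h] := leP 0 p.1; first by exists 1; rewrite normr1 ger0_norm ?mul1r.
  by exists (-1); rewrite normrN normr1 ltr0_norm ?mulN1r.
have ee : e * e = 1 by rewrite -expr2 -[e ^+ 2]ger0_norm ?sqr_ge0// normrX he expr1n.
exists (Num.min (1 / 4) p.2), e, 0, (fun t => - 1 * f (p.2 + (- e) * t) + (1 - e * p.1)); split.
- by rewrite lt_min p2 andbT; lra.
- by rewrite expr0n/= addr0 expr2.
- by apply: convexC11_C11 fC _; rewrite normrN.
move=> [x y] /edisk_coords [/=]; rewrite !lt_min => /andP[hx _] /andP[_ hy].
rewrite !mulr0 sub0r addr0.
have -> : p.2 + - e * - ((y - p.2) * e) = y.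
  by rewrite mulrNN mulrCA ee mulr1; ring.
have y0 : 0 < y by move: hy; rewrite ltr_norml => /andP[h _]; lra.
have hex : `|e * (x - p.1)| < 1 / 4 by rewrite normrM he (mul1r `|_|).
have ex : 1 / 2 < e * x.
  by move: hex; rewrite ltr_norml => /andP[h _]; move: h; rewrite mulrBr; lra.
have xe : `|x| = e * x.
  by rewrite -[LHS](mul1r `|x|) -{1}he -normrM ger0_norm//; lra.
have x2 : `|x| < 2.
  by rewrite xe; move: hex; rewrite ltr_norml => /andP[_ h]; move: h; rewrite mulrBr; lra.
have EP := @barrier_between x y (ltW y0) x2.
have cx : cap x = 1 - e * x by rewrite cap_out xe// ltW.
split=> h; first by apply/EP; rewrite cx; lra.
by move/EP; rewrite cx; lra.
Qed.

(** If both points of a pair were in the hill, the midpoint inequalities for the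
    convex [f] and the concave [cap] would contradict [f y0 = cap x0]; for small
    [u] the other parts of the barrier are out of reach. *)
Lemma gain_away (x0 y0 : R) : 0 <= x0 < 1 -> 0 < y0 -> f y0 = cap x0 ->
  exists2 r, 0 < r & forall u, gain E x0 y0 u -> r ^+ 2 <= u.1 ^+ 2 + u.2 ^+ 2.
Proof.
move=> /andP[x0_ge0 x1] y0_gt0 fy; exists (Num.min 1 y0); first by rewrite lt_min ltr01.
move=> u [u1 Em Ep]; rewrite leNgt; apply/negP => h.
have r0 : 0 <= Num.min 1 y0 by rewrite le_min ler01 ltW.
have b1 : `|u.1| < Num.min 1 y0.
  rewrite -(ltr_pXn2r (n := 2)) ?nnegrE ?normr_ge0// real_normK ?num_real//.
  by apply: le_lt_trans h; rewrite lerDl sqr_ge0.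
have b2 : `|u.2| < Num.min 1 y0.
  rewrite -(ltr_pXn2r (n := 2)) ?nnegrE ?normr_ge0// real_normK ?num_real//.
  by apply: le_lt_trans h; rewrite lerDr sqr_ge0.
move: b1 b2; rewrite !lt_min !ltr_norml => /andP[/andP[b1 b2] _] /andP[_ /andP[b3 b4]].
have yp : 0 <= y0 + u.2 by lra.
have ym : 0 <= y0 - u.2 by lra.
have xm : `|x0 - u.1| < 2 by rewrite ltr_norml; apply/andP; split; lra.
have xp : `|x0 + u.1| < 2 by rewrite ltr_norml; apply/andP; split; lra.
have h1 := (barrier_between yp xm).1 Em; have h2 := (barrier_between ym xp).1 Ep.
have /andP[h3 _] := convexC11_midpoint y0 u.2 fC.
have /andP[h4 _] := convexC11_midpoint x0 u.1 (@cap_convexC11 R).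
lra.
Qed.

Lemma barrier_flat_columns :
  E `&` ((`]-oo, (- 3)[ `|` `](- 2), (- 1)[) `*` setT) = (`]-oo, (- 3)[ `|` `](- 2), (- 1)[) `*` `]-oo, 0[.
Proof.
apply/seteqP; split=> -[x y] /=.
  rewrite !in_itv/= => -[hE [hx _]]; split=> //.
  have x0 : x < 0 by case: hx => [|/andP[]]; lra.
  have x1 : 1 < - x by case: hx => [|/andP[]]; lra.
  case: hE => //= [h|[/andP[h2 h3] _]]; last first.
    by move: h2 h3; rewrite (ltr0_norm x0); case: hx => [|/andP[]]; lra.
  have cx : cap x = 1 - - x by rewrite cap_out (ltr0_norm x0)//; lra.
  by have := f_ge0 y; rewrite cx in h; lra.
by rewrite !in_itv/= => -[hx y0]; split=> //; apply: Or31.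
Qed.

Lemma barrier_bump_column :
  E `&` (`[(- 3), (- 2)] `*` setT) = `[(- 3), (- 2)] `*` `]-oo, H[.
Proof.
apply/seteqP; split=> -[x y] /=; rewrite !in_itv/=.
  move=> -[hE [hx _]]; split=> //.
  have x0 : x < 0 by case/andP: hx; lra.
  case: hE => //= [h|h|[]//]; first exact: lt_trans H0.
  have cx : cap x = 1 - - x by rewrite cap_out (ltr0_norm x0)//; case/andP: hx; lra.
  by have := f_ge0 y; rewrite cx in h; case/andP: hx; lra.
move=> [hx y0]; split=> //; apply: Or33 => /=; split=> //.
by rewrite ltr0_norm; case/andP: hx; lra.
Qed.

Lemma barrier_core : `](- 1), 1[ `*` `]-oo, y1] `<=` E.
Proof.
move=> [x y] [/=]; rewrite !in_itv/= => hx hy; apply: Or32 => /=.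
by rewrite f_flat// cap_gt; [rewrite subr0 ltr_norml|lra].
Qed.

Lemma barrier_below : E `&` [set y | `|y.1| <= 1] `<=` [set y | y.2 <= delta].
Proof.
move=> [x y] [hE /= x1]; rewrite leNgt; apply/negP => yd.
have y0 : 0 < y by exact: lt_trans yd.
have fy := (@barrier_between x y (ltW y0) ltac:(lra)).1 hE.
have big : 1 <= (y / delta) `^ a^-1.
  have <- : 1 `^ a^-1 = 1 :> R by rewrite powR1.
  by apply: ge0_ler_powR; rewrite ?nnegrE ?divr_ge0 ?invr_ge0 ?(ltW a0) ?(ltW y0) ?(ltW d0)// ler_pdivlMr// mul1r ltW.
have [ye|/ltW ye] := leP eta y; last first.
  by have := @power_small y; rewrite (ltW y0) ye => /(_ isT); lra.
by rewrite f_power// in fy; have := cap_le x; lra.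
Qed.

End barrier_geometry.

(** * Choice of the parameters *)

Lemma barrier_curvature (R : realType) (s H : R) (f : R -> R) (p : R * R) :
  0 < s -> measurable_fun [set: R] f ->
  (exists2 r, 0 < r & forall u, gain (barrier f H) `|p.1| p.2 u -> r ^+ 2 <= u.1 ^+ 2 + u.2 ^+ 2) ->
  (\int[lebesgue2 R]_(u in loss (barrier f H) `|p.1| p.2) (riesz s u)%:E <=
   \int[lebesgue2 R]_(u in gain (barrier f H) `|p.1| p.2) (riesz s u)%:E)%E ->
  exists l : R, is_principal_value (curvature_integrand s (barrier f H) p) p l /\ 0 <= l.
Proof.
move=> s0 mf.
have mE : measurable (barrier f H) by exact: measurable_barrier.
have [e [he pe]] : exists e : R, (e = 1 \/ e = - 1) /\ p.1 = e * `|p.1|.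
  have [h|h] := leP 0 p.1; first by exists 1; rewrite mul1r ger0_norm//; split=> //; left.
  by exists (-1); rewrite ltr0_norm// mulrNN mul1r; split=> //; right.
have flip t y : barrier f H (p.1 + e * t, y) <-> barrier f H (`|p.1| + t, y).
  have -> : p.1 + e * t = e * (`|p.1| + t) by rewrite mulrDr -pe.
  case: he => ->; first by rewrite mul1r.
  by rewrite mulN1r; exact: barrier_even.
have flipN t y : barrier f H (p.1 - e * t, y) <-> barrier f H (`|p.1| - t, y).
  by rewrite -mulrN; exact: flip.
have -> : gain (barrier f H) `|p.1| p.2 = [set u | [/\ 0 < u.1,
    barrier f H (p.1 - e * u.1, p.2 + u.2) & barrier f H (p.1 + e * u.1, p.2 - u.2)]].
  apply/seteqP; split=> u [u0 h1 h2]; (split; first exact: u0).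
  - exact: (flipN u.1 (p.2 + u.2)).2 h1.
  - exact: (flip u.1 (p.2 - u.2)).2 h2.
  - exact: (flipN u.1 (p.2 + u.2)).1 h1.
  - exact: (flip u.1 (p.2 - u.2)).1 h2.
have -> : loss (barrier f H) `|p.1| p.2 = [set u | [/\ 0 < u.1,
    ~ barrier f H (p.1 - e * u.1, p.2 + u.2) & ~ barrier f H (p.1 + e * u.1, p.2 - u.2)]].
  apply/seteqP; split=> u [u0 h1 h2]; (split; [exact: u0|move=> h|move=> h]).
  - exact: h1 ((flipN u.1 (p.2 + u.2)).1 h).
  - exact: h2 ((flip u.1 (p.2 - u.2)).1 h).
  - exact: h1 ((flipN u.1 (p.2 + u.2)).2 h).
  - exact: h2 ((flip u.1 (p.2 - u.2)).2 h).
exact: principal_value_ge0.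
Qed.

Section parameters.
Context (R : realType) (s : R).
Hypothesis s01 : 0 < s < 1 / 2.
Let a := 1 / 2 + s.

(** Such that the Lipschitz constant [Q] of the derivative of [wall eta]
    satisfies [4 (Q eta) / (1 - 2 s) = 1 / 128], as [steep_balance] requires. *)
Definition profile_slope : R := (1 - 2 * s) / (2 ^+ 9 * profile_lip a).
Definition wall (eta y : R) : R := profile_slope * eta * profile a (eta^-1 * y).
Definition wall' (eta y : R) : R := profile_slope * eta * eta^-1 * profile' a (eta^-1 * y).
(** The [delta] for which [wall eta y = (y / delta)^(1/a)] above the height
    [eta]. *)
Definition width (eta : R) : R := (profile_slope * a) `^ (- a) * eta `^ (1 - a).
(** Large enough for the bumps to pay the errors of [center_balance] and
    [power_balance]. *)
Definition bump_ratio : R := 2 + 100 * (center_const s + power_const s).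

Let a_range : 1 / 2 < a < 1. Proof. by move: s01; rewrite /a; lra. Qed.
Let a0 : 0 < a. Proof. by case/andP: a_range; lra. Qed.
Let a01 : 0 < a < 1. Proof. by rewrite a0; case/andP: a_range. Qed.
Let s0 : 0 < s. Proof. by case/andP: s01. Qed.
Let k0 : 0 < 1 - 2 * s. Proof. by case/andP: s01; lra. Qed.
Let lip0 : 0 < profile_lip a. Proof. exact: profile_lip_gt0. Qed.

Lemma profile_slope_gt0 : 0 < profile_slope.
Proof. by apply: divr_gt0; [exact: k0|apply: mulr_gt0; [exact: exprn_gt0|exact: lip0]]. Qed.

Let m0 := profile_slope_gt0.

Lemma center_const_ge0 : 0 <= center_const s.
Proof.
have h1 := dome_lip_ge0 a01; have h2 := tail_const_ge0 s0.
rewrite /center_const -/a; set t := _ / (1 - 2 * s).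
have t0 : 0 <= t by rewrite divr_ge0 ?powR_ge0// ltW.
by have := mulr_ge0 h1 t0; lra.
Qed.

Lemma power_const_ge0 : 0 <= power_const s.
Proof.
have h2 := tail_const_ge0 s0; rewrite /power_const; set t := _ / (2 * s).
have t0 : 0 <= t by rewrite divr_ge0 ?powR_ge0// mulr_ge0// ltW.
lra.
Qed.

Lemma width_gt0 eta : 0 < eta -> 0 < width eta.
Proof. by move=> e0; rewrite mulr_gt0 ?powR_gt0// mulr_gt0. Qed.

Lemma width_power eta y : 0 < eta -> 0 <= y ->
  (y / width eta) `^ a^-1 = profile_slope * eta * (a * (eta^-1 * y) `^ a^-1).
Proof.
move=> e0 y0; have ma : 0 < profile_slope * a by rewrite mulr_gt0.
have -> : y / width eta = (eta^-1 * y) * (profile_slope * a * eta) `^ a.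
  rewrite /width; set q := profile_slope * a in ma *.
  rewrite (powRM _ (ltW ma) (ltW e0)) invfM powRN invrK.
  have -> : eta `^ a = eta * (eta `^ (1 - a))^-1.
    rewrite -powRN -{2}[eta](powRr1 (ltW e0)) -powRD ?(gt_eqF e0) ?implybT//.
    by congr (_ `^ _); ring.
  by field; rewrite !gt_eqF ?powR_gt0.
have c0 : 0 <= eta^-1 * y by apply: mulr_ge0 => //; rewrite invr_ge0 ltW.
have q0 : 0 <= profile_slope * a * eta by exact: ltW (mulr_gt0 ma e0).
rewrite (powRM _ c0 (powR_ge0 _ _)) -powRrM mulfV ?gt_eqF// (powRr1 q0).
set t := _ `^ _; ring.
Qed.

Lemma wall_convexC11 eta : 0 < eta ->
  convexC11 (wall eta) (wall' eta) (profile_slope * profile_lip a / eta).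
Proof.
move=> e0; have -> : profile_slope * profile_lip a / eta =
    profile_slope * eta * eta^-1 ^+ 2 * profile_lip a by field; rewrite gt_eqF.
apply: convexC11_scale; first exact: profile_convexC11.
  by rewrite mulr_ge0 ?(ltW m0) ?ltW.
by rewrite invr_ge0 ltW.
Qed.

Lemma wall_ge0 eta y : 0 < eta -> 0 <= wall eta y.
Proof. by move=> e0; rewrite mulr_ge0 ?profile_ge0// mulr_ge0 ?(ltW m0) ?ltW. Qed.

Lemma wall_flat eta y : 0 < eta -> y <= profile_flat a * eta -> wall eta y = 0.
Proof.
by move=> e0 h; rewrite /wall profile_low ?mulr0// mulrC ler_pdivrMr.
Qed.

Lemma wall_le eta y : 0 < eta -> 0 <= y -> wall eta y <= (y / width eta) `^ a^-1.
Proof.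
move=> e0 y0; rewrite (width_power e0 y0) /wall; apply: ler_wpM2l.
  by apply: mulr_ge0; [exact: ltW m0|exact: ltW].
by apply: (profile_le a_range); apply: mulr_ge0 => //; rewrite invr_ge0 ltW.
Qed.

Lemma wall_power eta y : 0 < eta -> eta <= y -> wall eta y = (y / width eta) `^ a^-1.
Proof.
move=> e0 ey; rewrite width_power//; last exact: le_trans (ltW e0) ey.
by rewrite /wall profile_high// mulrC ler_pdivlMr// mul1r.
Qed.

Lemma wall_eta eta : 0 < eta -> wall eta eta = profile_slope * a * eta.
Proof.
move=> e0; rewrite /wall mulVf ?gt_eqF// (profile_high a_range)// powR1; ring.
Qed.

Lemma profile_flat_gt0 : 0 < profile_flat a.
Proof. by apply: lt_trans (profile_flat_lb a_range); case/andP: a_range; lra. Qed.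

(** The boundary point lies on the wall, on the arc or near the axis according
    to [p.2 <= eta] and [3/4 <= |p.1|]. *)
Lemma wall_curvature_ge0 eta p : 0 < eta -> eta <= 1 / 8 -> profile_slope * a * eta <= 1 / 8 ->
  2 * eta * tail_const s <= 1 / 128 -> bump_ratio * width eta <= 1 ->
  boundary (barrier (wall eta) (bump_ratio * width eta)) p -> `|p.1| < 1 ->
  exists l : R, is_principal_value
    (curvature_integrand s (barrier (wall eta) (bump_ratio * width eta)) p) p l /\ 0 <= l.
Proof.
move=> e0 e8 ce8 et H1 pE p1.
set H := bump_ratio * width eta in H1 pE *; set f := wall eta in pE *.
have fC := wall_convexC11 e0.
have d0 := width_gt0 e0.
have mf : measurable_fun [set: R] f.
  by apply: continuous_measurable_fun; exact: convexC11_continuous fC.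
have c0 := center_const_ge0; have q0 := power_const_ge0.
have y1_gt0 : 0 < profile_flat a * eta by rewrite mulr_gt0// profile_flat_gt0.
have p2 : 0 < p.2.
  by apply: (@barrier_boundary_height _ H _ f y1_gt0 _ p pE p1) => y; exact: wall_flat.
have fp : f p.2 = cap p.1 by apply: (barrier_boundary fC pE p2); lra.
have cabs : cap `|p.1| = cap p.1.
  by have [h|h] := leP 0 p.1; [rewrite ger0_norm|rewrite ltr0_norm// cap_even].
have n0 := normr_ge0 p.1.
have fle t : 0 <= t -> f t <= (t / width eta) `^ a^-1 by exact: wall_le.
have dH : 2 * width eta <= H.
  by rewrite /H /bump_ratio ler_pM2r//; lra.
have hC c : c <= center_const s + power_const s -> width eta * c <= (H - 2 * width eta) / 100.
  move=> hc; rewrite [leLHS]mulrC /H /bump_ratio.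
  by have := ler_wpM2r (ltW d0) hc; lra.
apply: barrier_curvature => //.
  by apply: (@gain_away _ H _ _ _ fC) => //; [rewrite n0|rewrite cabs].
have [ye|ye] := leP p.2 eta.
  have h78 : 7 / 8 <= `|p.1|.
    rewrite leNgt; apply/negP => h.
    have : 1 / 8 < cap p.1 by rewrite cap_gt; lra.
    rewrite -fp ltNge => /negP; apply; apply: le_trans (fle _ (ltW p2)) _.
    apply: (@power_small _ a (width eta) eta f) => //.
    - by move=> y; exact: wall_power.
    - by rewrite /f wall_eta.
    - by rewrite (ltW p2).
  apply: (@steep_balance _ s _ eta H _ _ f _ s01 fC) => //.
  - by apply: divr_ge0; [exact: mulr_ge0 (ltW m0) (ltW lip0)|exact: ltW].
  - by rewrite /f wall_flat// ltW.
  - by rewrite /wall' mulr0 profile'0 ?mulr0.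
  - by lra.
  - by rewrite fp cap_out//; lra.
  - by rewrite p2.
  - rewrite divfK ?gt_eqF// /profile_slope.
    have -> : 4 * ((1 - 2 * s) / (2 ^+ 9 * profile_lip a) * profile_lip a) / (1 - 2 * s) = 1 / 128.
      by field; rewrite !gt_eqF.
    by [].
have yE : p.2 = width eta * cap p.1 `^ a.
  rewrite -fp /f wall_power ?(ltW ye)// -powRrM mulVf ?gt_eqF// powRr1 ?divr_ge0 ?ltW//.
  by rewrite mulrC divfK ?gt_eqF.
have [side|mid] := leP (3 / 4) `|p.1|.
  apply: (@power_balance _ s (width eta)) => //.
  - by rewrite yE cap_out//; lra.
  - by apply: hC; lra.
apply: (@center_balance _ s (width eta)) => //.
- by rewrite n0.
- by rewrite cabs.
- by apply: hC; lra.
Qed.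

Lemma bump_ratio_gt0 : 0 < bump_ratio.
Proof. by have := center_const_ge0; have := power_const_ge0; rewrite /bump_ratio; lra. Qed.

(** The bounds on [eta] that the balances need, and the height of the vertical
    part of the wall. *)
Definition admissible (eps0 eta : R) : Prop :=
  [/\ eta <= 1 / 8, profile_slope * a * eta <= 1 / 8, 2 * eta * tail_const s <= 1 / 128,
      bump_ratio * width eta <= 1 &
      width eta `^ ((2 + eps0) / (1 - 2 * s)) <= profile_flat a * eta].

Let powR_small (p c : R) : 0 < p -> 0 < c -> \forall x \near (0 : R)^'+, x `^ p <= c.
Proof. by move=> p0 c0; apply: (cvgr_le 0) => //; exact: powR_cvg0. Qed.

(** All conditions reduce to [eta^p <= c] with [p > 0]. For the last one,
    [width eta] to the given power is a multiple of [eta^(1 + eps0 / 2)]. *)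
Lemma admissible_near0 eps0 : 0 < eps0 -> \forall eta \near (0 : R)^'+, admissible eps0 eta.
Proof.
move=> he; have ma : 0 < profile_slope * a by rewrite mulr_gt0.
pose K := (profile_slope * a) `^ (- a); have K0 : 0 < K by exact: powR_gt0.
pose g := (2 + eps0) / (1 - 2 * s).
have t0 := tail_const_ge0 s0; have b0 := bump_ratio_gt0.
have a1 : 0 < 1 - a by case/andP: a01; lra.
near=> eta.
have e0 : 0 < eta by near: eta; exact: nbhs_right_gt.
split.
- by near: eta; apply: nbhs_right_le; lra.
- rewrite mulrC -ler_pdivlMr//; near: eta; apply: nbhs_right_le; apply: divr_gt0 => //; lra.
- have h : eta <= (1 / 128) / (2 * tail_const s + 1).
    by near: eta; apply: nbhs_right_le; apply: divr_gt0; lra.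
  by rewrite ler_pdivlMr in h; lra.
- rewrite /width mulrCA -/K mulrA mulrC -ler_pdivlMr ?mulr_gt0//.
  near: eta; apply: powR_small => //; apply: divr_gt0 => //; exact: mulr_gt0.
- have h : eta `^ (eps0 / 2) <= profile_flat a / K `^ g.
    near: eta; apply: powR_small; first by lra.
    by rewrite divr_gt0 ?profile_flat_gt0// powR_gt0.
  rewrite ler_pdivlMr ?powR_gt0// in h.
  rewrite -/g /width -/K powRM ?powR_ge0// -powRrM.
  have -> : (1 - a) * g = 1 + eps0 / 2.
    by rewrite /g /a; field; rewrite gt_eqF.
  rewrite powRD ?(gt_eqF e0) ?implybT// powRr1 ?(ltW e0)//.
  by have := ler_wpM2r (ltW e0) h; lra.
Unshelve. all: by end_near. Qed.

Lemma width_cvg0 (e : R) : 0 < e -> width (e * harmonic k) @[k --> \oo] --> (0 : R).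
Proof.
move=> e0; have a1 : 0 < 1 - a by case/andP: a01; lra.
rewrite -(mulr0 ((profile_slope * a) `^ (- a))); apply: cvgM; first exact: cvg_cst.
have /cvg_at_rightP := powR_cvg0 a1; apply; split=> [k|].
  by apply: mulr_gt0 => //; exact: harmonic_gt0.
by rewrite -(mulr0 e); apply: cvgM; [exact: cvg_cst|exact: cvg_harmonic].
Qed.

End parameters.

Theorem proposition7p3 (R : realType) (s eps0 : R)
    (hs0 : 0 < s) (hs1 : s < 1 / 2) (heps0 : 0 < eps0) :
  exists (C : R) (delta : nat -> R),
    [/\ 0 < C,
        forall k, 0 < delta k,
        delta @ \oo --> (0 : R) &
        forall k, exists E : set (R * R),
          [/\ C11_boundary_in E (`](- (3 / 2)), (3 / 2)[ `*` `]0, +oo[),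
              forall x1 x2 : R, E (x1, x2) <-> E (- x1, x2),
              [/\ E `&` ((`]-oo, (- 3)[ `|` `](- 2), (- 1)[) `*` setT)
                    = (`]-oo, (- 3)[ `|` `](- 2), (- 1)[) `*` `]-oo, 0[,
                  E `&` (`[(- 3), (- 2)] `*` setT)
                    = `[(- 3), (- 2)] `*` `]-oo, (C * delta k)[,
                  setT `*` `]-oo, 0[ `<=` E,
                  `](- 1), 1[ `*`
                      `]-oo, (delta k `^ ((2 + eps0) / (1 - 2 * s)))] `<=` E &
                  E `&` [set y | `|y.1| <= 1] `<=` [set y | y.2 <= delta k]] &
              forall p : R * R, boundary E p -> `|p.1| < 1 ->
                exists l : R,
                  is_principal_value (curvature_integrand s E p) p l /\
                  0 <= l]].
Proof.
have s01 : 0 < s < 1 / 2 by rewrite hs0.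
have a01 : 0 < 1 / 2 + s < 1 by lra.
have [e /= e0 he] := admissible_near0 s01 heps0.
(* the half keeps [eta k] strictly inside the neighbourhood for [k = 0] *)
pose eta k := e / 2 * harmonic k.
have eta0 k : 0 < eta k by apply: mulr_gt0; [exact: divr_gt0|exact: harmonic_gt0].
have etaP k : admissible s eps0 (eta k).
  apply: he => //=; rewrite sub0r normrN gtr0_norm//.
  have : (harmonic k : R) <= 1 by rewrite /harmonic/= invf_le1// ler1n.
  rewrite /eta; have := ltW (eta0 k); nra.
exists (bump_ratio s), (fun k => width s (eta k)); split.
- exact: bump_ratio_gt0.
- by move=> k; exact: width_gt0.
- by apply: width_cvg0 => //; exact: divr_gt0.
move=> k; have [h1 h2 h3 h4 h5] := etaP k.
have fC := wall_convexC11 s01 (eta0 k).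
have d0 := width_gt0 s01 (eta0 k).
have Hd : 0 < bump_ratio s * width s (eta k) by rewrite mulr_gt0// bump_ratio_gt0.
have f0 y : 0 <= wall s (eta k) y by exact: wall_ge0.
have fle y : 0 <= y -> wall s (eta k) y <= (y / width s (eta k)) `^ (1 / 2 + s)^-1.
  exact: wall_le.
have fpow y : eta k <= y -> wall s (eta k) y = (y / width s (eta k)) `^ (1 / 2 + s)^-1.
  exact: wall_power.
have fe : wall s (eta k) (eta k) <= 1 / 8 by rewrite wall_eta.
exists (barrier (wall s (eta k)) (bump_ratio s * width s (eta k))); split.
- exact: (@barrier_C11 _ _ _ _ _ _ _ _ a01 d0 fC fle fpow (eta0 k) fe).
- by move=> x1 x2; exact: (iff_sym (barrier_even _ _ _ _)).
- split.
  + exact: barrier_flat_columns.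
  + exact: barrier_bump_column.
  + by move=> [x y] [_ /=]; rewrite in_itv/=; exact: Or31.
  + apply: subset_trans (@barrier_core _ _ (profile_flat (1 / 2 + s) * eta k) _ _).
      by move=> [x y] [hx /=]; rewrite in_itv/= => hy; split=> //=; rewrite in_itv/=; exact: le_trans h5.
    by move=> y; exact: wall_flat.
  + exact: (@barrier_below _ _ _ _ _ _ a01 d0 fpow (eta0 k) fe).
- by move=> p; exact: wall_curvature_ge0.
Qed.
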